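(* Let $\gamma\ge0$, let $\nabla_{\mathcal L}$ and $\mathcal L$ be the Baouendi–Grushin gradient and operator on $\mathbb{R}^{n+k}$, $\rho$ the associated homogeneous norm and $Q=n+(1+\gamma)k$ the homogeneous dimension (see context). Let $p\ge2$ and $\theta\in\mathbb{R}$ satisfy $$(Q-p(\theta+2))(p\theta+Q(p-1))\ge0\quad\text{and}\quad Q>2\gamma(p-1)+(1+\gamma)k\ \text{ if }k\ne0.$$ Then, for all $u\in C_c^\infty(\mathbb{R}^{n+k}\setminus\{0\})$, $$\left(\frac{(Q-p(\theta+2))(p\theta+Q(p-1))}{p^2}\right)^p\int_{\mathbb{R}^{n+k}}\frac{|u|^p}{\rho^{p(\theta+2)}}|\nabla_{\mathcal L}\rho|^2\,dx\,dy\le\int_{\mathbb{R}^{n+k}}\frac{|\mathcal L u|^p}{\rho^{p\theta}}|\nabla_{\mathcal L}\rho|^{-2(p-1)}\,dx\,dy.$$ The constant is optimal and equality occurs, up to a multiplicative factor, for $u=\rho^{\frac{p(\theta+2)-Q}{p}}$.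
   Context: On $\mathbb{R}^{n+k}$ with coordinates $(x,y)\in\mathbb{R}^n\times\mathbb{R}^k$ and $\gamma\ge0$, set $\nabla_{\mathcal L}=\big(\nabla_x,(1+\gamma)|x|^\gamma\nabla_y\big)$, $\mathcal L=\Delta_x+(1+\gamma)^2|x|^{2\gamma}\Delta_y$, and $\rho(x,y)=\big(|x|^{2(1+\gamma)}+|y|^2\big)^{1/(2+2\gamma)}$, so that $|\nabla_{\mathcal L}\rho|=|x|^\gamma/\rho^\gamma$. The number $Q=n+(1+\gamma)k$ is the homogeneous dimension associated with the dilations $\delta_\lambda(x,y)=(\lambda x,\lambda^{1+\gamma}y)$, $\lambda>0$. For $k=0$ or $\gamma=0$ the operator $\mathcal L$ is the classical Laplacian. *)

(* Defs.v *)
From HB Require Import structures.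
From mathcomp Require Import all_boot all_order all_algebra.
From mathcomp Require Import all_classical all_reals all_analysis.

Set Implicit Arguments.
Unset Strict Implicit.
Unset Printing Implicit Defensive.

Import Order.TTheory GRing.Theory Num.Theory.
Import numFieldNormedType.Exports.

Local Open Scope classical_set_scope.
Local Open Scope ring_scope.

Section LebesgueMeasure.
Context (R : realType).

Definition tuple_cons m (q : m.-tuple R * R) : m.+1.-tuple R :=
  [the m.+1.-tuple R of q.2 :: q.1].

Lemma measurable_tuple_cons m : measurable_fun [set: m.-tuple R * R] (@tuple_cons m).
Proof.
by apply: measurable_cons; [exact: measurable_snd|exact: measurable_fst].
Qed.

Definition lebesgue_cons m (mu : {measure set (m.-tuple R) -> \bar R}) :
    set (m.+1.-tuple R) -> \bar R :=
  pushforward (mu \x lebesgue_measure)%E (@tuple_cons m).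

Section LebesgueCons.
Context m (mu : {measure set (m.-tuple R) -> \bar R}).

Let pushforward_cons : {measure set (m.+1.-tuple R) -> \bar R} :=
  measure_function_pushforward__canonical__measure_function_Measure
    (mu \x lebesgue_measure)%E (@measurable_tuple_cons m).

HB.instance Definition _ := Measure.copy (lebesgue_cons mu) pushforward_cons.

End LebesgueCons.

(* Lebesgue measure on R^m: the m-fold product of the one-dimensional one. *)
Fixpoint lebesgue_tuple m : {measure set (m.-tuple R) -> \bar R} :=
  match m with
  | 0 => dirac [tuple]
  | m'.+1 => lebesgue_cons (lebesgue_tuple m')
  end.

Definition integral_rV m (f : 'rV[R]_m -> R) : \bar R :=
  (\int[lebesgue_tuple m]_t (f (\row_i tnth t i))%:E)%E.

End LebesgueMeasure.

Section TestFunctions.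
Context (R : realType) (m : nat).
Implicit Types f u : 'rV[R]_m -> R.

Definition partial (i : 'I_m) f : 'rV[R]_m -> R :=
  fun z => 'D_(delta_mx 0 i) f z.

Definition smooth f := forall s : seq 'I_m,
  continuous (foldr partial f s) /\
  forall i z, derivable (foldr partial f s) z (delta_mx 0 i).

Definition support_closure f : set 'rV[R]_m := closure [set z | f z != 0].

(* C_c^oo(R^m \ {0}), its elements being extended by zero to R^m. *)
Definition test_function u :=
  [/\ smooth u, compact (support_closure u) & ~ support_closure u 0].

End TestFunctions.

(* Euclidean norm; the library norm `|v| on row vectors is the sup norm. *)
Definition enorm (R : realType) m (v : 'rV[R]_m) : R :=
  Num.sqrt (\sum_i v 0 i ^+ 2).

(* A point z : 'rV[R]_(n + k) of R^n x R^k is (x, y) = (lsubmx z, rsubmx z). *)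
Section Grushin.
Context (R : realType) (n k : nat) (g : R).
Implicit Types (f : 'rV[R]_(n + k) -> R) (z : 'rV[R]_(n + k)).

Definition grushin_grad f z : 'rV[R]_(n + k) :=
  row_mx (\row_i partial (lshift k i) f z)
         (((1 + g) * enorm (lsubmx z) `^ g) *:
            \row_j partial (rshift n j) f z).

Definition grushin_op f z : R :=
  \sum_i partial (lshift k i) (partial (lshift k i) f) z +
  (1 + g) ^+ 2 * enorm (lsubmx z) `^ (2 * g) *
    \sum_j partial (rshift n j) (partial (rshift n j) f) z.

Definition grushin_rho z : R :=
  (enorm (lsubmx z) `^ (2 * (1 + g)) + enorm (rsubmx z) ^+ 2) `^ (2 + 2 * g)^-1.

Definition grushin_dim : R := n%:R + (1 + g) * k%:R.

Definition rellich_lhs (p theta : R) f z : R :=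
  `|f z| `^ p / grushin_rho z `^ (p * (theta + 2)) *
    enorm (grushin_grad grushin_rho z) ^+ 2.

(* On {x = 0}, a null set, the negative power may be one of 0; powR then
   gives 0. *)
Definition rellich_rhs (p theta : R) f z : R :=
  `|grushin_op f z| `^ p / grushin_rho z `^ (p * theta) *
    enorm (grushin_grad grushin_rho z) `^ (- (2 * (p - 1))).

End Grushin.

(* Main.v *)
(* Put N = rho ^ (2 + 2 g) = |x| ^ (2 + 2 g) + |y| ^ 2, a = p (theta + 2) - 2 and
   c = (Q - p (theta + 2)) / p; the constant is C0 ^ p with C0 = c (c (p - 1) + a).

   Inequality. Testing L u against |u| ^ (p - 2) u rho ^ (- a) and completing the
   square around the equality case grad u = - c u grad rho / rho gives, up to a
   divergence,
     C0 |u| ^ p rho ^ (- a - 2) |grad rho| ^ 2 <= |u| ^ (p - 1) |L u| rho ^ (- a),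
   and Young's inequality separates the right-hand side. The divergence of a
   compactly supported field integrates to 0 by Fubini and the fundamental theorem
   of calculus.

   Optimality. For u = N ^ s b(kap ln N), with N ^ s the extremal power and b a
   cutoff, both integrals have the form J(xi (kap .)), where J(xi) is the integral
   of xi(ln N) against the weight invariant under dilations, and kap J(xi (kap .)) = J(xi).
   Hence K J(|b| ^ p) <= J(|- C0 b + kap w1 b' + kap ^ 2 w2 b''| ^ p) for all kap <= 1,
   and kap -> 0 gives K <= C0 ^ p. As N is not smooth on {x = 0}, these u are first
   replaced by functions of |x| ^ (2 + 2 g) exp (- del / |x| ^ 2) + |y| ^ 2, whose
   image under L is |x| ^ (2 g) times a bounded function; then del -> 0. *)

(* Where [C0] comes from: on functions of [rho] the operator is
   [|grad rho| ^ 2 (f'' + (Q - 1) f' / rho)], hence [L rho ^ (- c) = - c (Q - 2 - c) rho ^ (- c - 2)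
   |grad rho| ^ 2], and [Q = p c + a + 2] turns [Q - 2 - c] into [c (p - 1) + a]. The set [{x = 0}]
   shapes the proof. The fields whose divergence is integrated must be differentiable there too:
   [p >= 2] makes [|t| ^ (p - 2) t] of class C^1, and [|x| ^ (2 g) x] is C^1 as well. The integrands
   of the theorem are compared only off this null set. For optimality, the weight
   [|grad rho| ^ (- 2 (p - 1))] blows up like [|x| ^ (- 2 g (p - 1))]; if [L u] is [|x| ^ (2 g)]
   times a bounded function, a harmless [|x| ^ (2 g)] remains. The factor [exp (- del / |x| ^ 2)]
   achieves this with bounds independent of [del], which is what dominated convergence needs. No
   polar coordinates are used: the scaling law of [J] is itself a divergence identity, and
   [J (|b| ^ p)] is never computed, only shown to be positive. *)
From HB Require Import structures.
Require Import Defs.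
From mathcomp Require Import all_boot all_order all_algebra.
From mathcomp Require Import all_classical all_reals all_analysis.
From mathcomp Require Import measurable_realfun ring lra.

Import Order.TTheory GRing.Theory Num.Theory.
Import numFieldNormedType.Exports.

Local Open Scope classical_set_scope.
Local Open Scope ring_scope.

Set Implicit Arguments.
Unset Strict Implicit.
Unset Printing Implicit Defensive.

(** * Lebesgue measure on tuples *)

(* Fubini's theorem needs a sigma-finite structure, which [lebesgue_tuple] gets only
   through a proof by induction on the dimension. *)
Section SigmaFiniteCopy.
Context d (T : measurableType d) (R : realType) (nu : {measure set T -> \bar R}).

Definition sigma_finite_copy of sigma_finite setT nu : set T -> \bar R := nu.

Hypothesis nuT : sigma_finite setT nu.

HB.instance Definition _ := Measure.copy (sigma_finite_copy nuT) nu.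
HB.instance Definition _ :=
  Measure_isSigmaFinite.Build _ _ _ (sigma_finite_copy nuT) nuT.

End SigmaFiniteCopy.

Section TupleMeasure.
Context (R : realType).
Local Notation mu := (@lebesgue_measure R).
Local Notation lam := (@lebesgue_tuple R).

(** Induction on the dimension: an increasing exhaustion [F] by sets of finite measure is multiplied
    by the intervals [[- i, i]]. As [h] inverts [tuple_cons], preimages under [h] have the measure
    of these products. *)
Lemma lebesgue_tuple_sigma_finite m : sigma_finite setT (lam m).
Proof.
elim: m => [|m IH] /=.
  exists (fun=> setT) => //; first by rewrite bigcup_const//; exists 0%N.
  by move=> i; split => //; rewrite diracT ltry.
have [F [TF ndF Foo]] := (sigma_finiteP setT (lam m)).1 IH.
pose h (t : m.+1.-tuple R) := (([tuple of behead t] : m.-tuple R), thead t).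
have mh : measurable_fun setT h.
  apply: measurable_fun_pair; first exact: measurable_behead.
  exact: (@measurable_tnth _ R m.+1 ord0).
have hK q : h (tuple_cons q) = q.
  by case: q => a b; congr pair; apply: val_inj.
exists (fun i => h @^-1` (F i `*` `[- i%:R, i%:R])).
  apply/seteqP; split => // t _.
  have [i _ Fi] : (\bigcup_i F i) ([tuple of behead t] : m.-tuple R) by rewrite -TF.
  pose j := maxn i (Num.truncn `|thead t|).+1.
  exists j => //; split => /=.
    by move: Fi; exact/subsetPset/ndF/leq_maxl.
  rewrite in_itv/= -ler_norml; apply: (le_trans (ltW (truncnS_gt _))).
  by rewrite ler_nat leq_maxr.
move=> i; have [mFi Fi] := Foo i; split.
  by rewrite -[X in measurable X]setTI; apply: mh => //; exact: measurableX.
rewrite /lebesgue_cons /pushforward /= (_ : _ @^-1` _ = F i `*` `[- i%:R, i%:R]).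
  rewrite product_measure1E//= lte_mul_pinfty ?ge0_fin_numE//.
  by rewrite lebesgue_measure_itv; case: ifP => _; rewrite ?ltry.
by rewrite -[LHS]/((fun q => h (tuple_cons q)) @^-1` _) (funext hK).
Qed.

Local Notation slam m := (sigma_finite_copy (lebesgue_tuple_sigma_finite m)).

(** Both orders of integration are recorded: [integral_partial_eq0] has the first coordinate
    innermost when it differentiates along it, and outermost in its induction. *)
Lemma integrable_integral_tuple_cons m (f : m.+1.-tuple R -> \bar R) :
  (lam m.+1).-integrable setT f ->
  (\int[lam m.+1]_t f t = \int[mu]_s \int[lam m]_t f (tuple_cons (t, s)))%E /\
  (\int[lam m.+1]_t f t = \int[lam m]_t \int[mu]_s f (tuple_cons (t, s)))%E.
Proof.
move=> If.
have mf := measurable_int _ If.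
have Ig : ((slam m) \x mu)%E.-integrable setT (f \o @tuple_cons R m).
  have mg : measurable_fun setT (f \o @tuple_cons R m).
    by apply: measurableT_comp => //; exact: measurable_tuple_cons.
  apply/integrableP; split => //.
  have /integrableP[_] := If.
  rewrite ge0_integral_pushforward//; first exact: measurable_tuple_cons.
  by apply: measurableT_comp.
have E : (\int[lam m.+1]_t f t = \int[(slam m) \x mu]_t f (tuple_cons t))%E.
  have := @integral_pushforward _ _ (m.-tuple R * measurableTypeR R)%type _ R (@tuple_cons R m) (@measurable_tuple_cons R m) ((slam m) \x mu)%E setT f (measurable_int _ If).
  by rewrite preimage_setT /=; apply.
by split; rewrite E; [have := integral21_prod_meas1 Ig|have := integral12_prod_meas1 Ig].
Qed.

End TupleMeasure.

(** * Borel sets, cubes and hyperplanes of row vectors *)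

Section RowFunctions.
Context (R : realType).
Local Notation lam := (@lebesgue_tuple R).

Definition tuple_row m (t : m.-tuple R) : 'rV[R]_m := \row_i tnth t i.

Lemma tuple_rowE m (t : m.-tuple R) i : tuple_row t 0 i = tnth t i.
Proof. by rewrite mxE. Qed.

Lemma tuple_row_cons m (t : m.-tuple R) s i :
  tuple_row (tuple_cons (t, s)) 0 i =
  if unlift ord0 i is Some j then tuple_row t 0 j else s.
Proof.
rewrite tuple_rowE; case: unliftP => [j ->|->] //=.
by rewrite tuple_rowE tnthS.
Qed.

Lemma measurable_row_ball m (c : 'rV[R]_m) r :
  measurable [set t : m.-tuple R | ball c r (tuple_row t)].
Proof.
(* [0 < r] is part of a ball of matrices; for [m = 0] the coordinate conditions are void and would
   not imply it. *)
have -> : [set t : m.-tuple R | ball c r (tuple_row t)] =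
   [set t | 0 < r] `&` \bigcap_i (fun t => tnth t i) @^-1` (ball (c 0 i) r).
  apply/seteqP; split => [t [r0 H]|t [r0 H]]; split => //.
    by move=> i _; have := H 0 i; rewrite tuple_rowE.
  by move=> j i; rewrite (ord1 j) tuple_rowE; apply: H.
apply: measurableI.
  by case: (ltP 0 r) => _; [rewrite (_ : [set _ | _] = setT)//|
    rewrite (_ : [set _ | _] = set0)//]; apply/seteqP; split.
apply: fin_bigcap_measurable => // i _.
rewrite -[X in measurable X]setTI; apply: (measurable_tnth (T := R) i) => //.
exact: measurable_ball.
Qed.

(** [U] is the union of the sup-norm balls inside it with rational centres and radii [1 / (j + 1)],
    a countable family; a ball that is not inside [U] is replaced by the empty set. *)
Lemma measurable_open_row m (U : set 'rV[R]_m) : open U ->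
  measurable [set t : m.-tuple R | U (tuple_row t)].
Proof.
move=> oU.
pose B (k : 'rV[rat]_m * nat) : set 'rV[R]_m :=
  ball (map_mx (ratr : rat -> R) k.1 : 'rV[R]_m) (k.2.+1%:R^-1).
pose F k : set (m.-tuple R) :=
  if pselect (B k `<=` U) then [set t | B k (tuple_row t)] else set0.
have -> : [set t : m.-tuple R | U (tuple_row t)] = \bigcup_k F k.
  apply/seteqP; split => [t Ut|t [k _]]; last first.
    by rewrite /F; case: pselect => // BU; exact: BU.
  have /nbhs_ballP[e/= e0 eU] : nbhs (tuple_row t) U by exact: open_nbhs_nbhs.
  (* The radius is at most [e / 2], so the ball about a close rational centre stays within [e] of
     [tuple_row t]. *)
  pose j := Num.truncn (2 / e).
  have j0 : 0 < j.+1%:R^-1 :> R by rewrite invr_gt0.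
  have je : j.+1%:R^-1 + j.+1%:R^-1 <= e.
    have : 2 / e < j.+1%:R by exact: truncnS_gt.
    rewrite ltr_pdivrMr// => /ltW H.
    by rewrite -mulr2n -[leLHS]mulr_natl ler_pdivrMr// mulrC.
  have Hq i : {q : rat | ratr q \in `]tnth t i - j.+1%:R^-1, tnth t i + j.+1%:R^-1[}.
    by apply/cid/rat_in_itvoo; rewrite ltrD2l (lt_trans _ j0)// oppr_lt0.
  pose c : 'rV[rat]_m := \row_i projT1 (Hq i).
  have cE i : ball (tuple_row t 0 i) j.+1%:R^-1 (ratr (c 0 i)).
    rewrite !mxE; case: (Hq i) => q /=; rewrite in_itv/= => /andP[q1 q2].
    rewrite -ball_normE/= ltr_norml.
    by move: (ratr q) (j.+1%:R^-1) q1 q2 => x y ? ?; apply/andP; split; lra.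
  exists (c, j) => //; rewrite /F; case: pselect => //= [_|[]].
    split => // a i; rewrite (ord1 a) mxE; apply: ball_sym; exact: cE.
  move=> z [_ Bz]; apply: eU; split => // a i; rewrite (ord1 a).
  apply: (le_ball je); apply: ball_triangle (cE i) _.
  by have := Bz 0 i; rewrite mxE.
apply: countable_bigcupT_measurable => [|k]; first exact: countableP.
by rewrite /F; case: pselect => H /=; [exact: measurable_row_ball|exact: measurable0].
Qed.

Lemma measurable_continuous_row m (f : 'rV[R]_m -> R) : continuous f ->
  measurable_fun setT (f \o @tuple_row m).
Proof.
move=> cf; apply: (measurability _ (RGenOpens.measurableE R)).
move=> _ [_ [a [b ->] <-]]; rewrite setTI.
have /measurable_open_row : open (f @^-1` `]a, b[); last exact.
by apply: open_comp => [? _|]; [exact: cf|exact: interval_open].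
Qed.

Lemma lebesgue_tuple_cube m (c : 'rV[R]_m) (r : R) : 0 <= r ->
  measurable [set t : m.-tuple R | forall i, `|tnth t i - c 0 i| <= r] /\
  lam m [set t : m.-tuple R | forall i, `|tnth t i - c 0 i| <= r] =
    ((r *+ 2) ^+ m)%:E.
Proof.
move=> r0; have mC m' (c' : 'rV[R]_m') : measurable
    [set t : m'.-tuple R | forall i, `|tnth t i - c' 0 i| <= r].
  rewrite (_ : [set _ | _] = \bigcap_i (fun t => tnth t i) @^-1`
      `[c' 0 i - r, c' 0 i + r]).
    apply: fin_bigcap_measurable => // i _.
    rewrite -[X in measurable X]setTI; exact: (measurable_tnth (T := R) i).
  apply/seteqP; split => t H i; first by move=> _ /=; rewrite in_itv/= -ler_distl.
  by have := H i I; rewrite /= in_itv/= -ler_distl.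
split => //; elim: m c => [|m IH] c.
  by rewrite expr0 /= diracE mem_set//= => -[].
pose c' : 'rV[R]_m := \row_i c 0 (lift ord0 i).
rewrite /= /lebesgue_cons /pushforward
  (_ : _ @^-1` _ = [set t : m.-tuple R | forall i, `|tnth t i - c' 0 i| <= r] `*`
     `[c 0 ord0 - r, c 0 ord0 + r]); last first.
  apply/seteqP; split => -[t s] /=.
    move=> H; split.
      by move=> i; have := H (lift ord0 i); rewrite tnthS mxE.
    by rewrite in_itv/= -ler_distl; exact: (H ord0).
  move=> [H]; rewrite in_itv/= -ler_distl => H' i.
  case: (unliftP ord0 i) => [j ->|->] //.
  by have := H j; rewrite tnthS mxE.
rewrite product_measure1E//=; last exact: mC.
rewrite IH lebesgue_measure_itv/= lte_fin.
case: ifP => rr.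
  by rewrite -EFinB -EFinM exprSr; congr (_ * _)%:E; rewrite mulr2n; lra.
have -> : r = 0 by move/negbT: rr; rewrite -leNgt => rr; lra.
by rewrite mule0 mul0rn expr0n.
Qed.

Lemma lebesgue_tuple_hyperplane m :
  measurable [set t : m.+1.-tuple R | thead t = 0] /\
  lam m.+1 [set t : m.+1.-tuple R | thead t = 0] = 0.
Proof.
split.
  rewrite -[X in measurable X]setTI.
  exact: (@measurable_tnth _ R m.+1 ord0 _ [set 0]).
rewrite /= /lebesgue_cons /pushforward (_ : _ @^-1` _ = setT `*` [set 0]); last first.
  by apply/seteqP; split => -[t s] /=; rewrite theadE// => -[].
by rewrite product_measure1E//= lebesgue_measure_set1 mule0.
Qed.

End RowFunctions.

Import HBNNSimple.

(* [f] and [g] need not be measurable: on [{x = 0}] nothing is known about the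
   integrands of the theorem. *)
Lemma ge0_le_integral_off_null d (T : measurableType d) (R : realType)
    (mu : {measure set T -> \bar R}) (N : set T) (f g : T -> \bar R) :
  measurable N -> mu N = 0 -> (forall x, 0 <= f x)%E -> (forall x, 0 <= g x)%E ->
  (forall x, ~ N x -> f x <= g x)%E ->
  (\int[mu]_x f x <= \int[mu]_x g x)%E.
Proof.
move=> mN N0 f0 g0 fg.
(* Each simple [h] below [f] is cut off to the complement of [N]: its integral does not change, and
   the result lies below [g]. *)
rewrite ge0_integralTE//; apply: ge_ereal_sup => _ [h hf <-].
have mNC : measurable (~` N) by exact: measurableC.
have -> : sintegral mu h = (\int[mu]_x (h x)%:E)%E.
  by rewrite integral_nnsfun// patch_setT.
rewrite (ge0_negligible_integral mN)//; last 2 first.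
- exact/measurable_EFinP.
- by move=> x _; rewrite lee_fin.
rewrite setTD integral_nnsfun// (mrestrict h mNC) ge0_integralTE//.
apply: ereal_sup_ubound; exists (proj_nnsfun h mNC) => // x.
rewrite -(mrestrict h mNC) patchE; case: ifPn => xN; last exact: g0.
by apply: (le_trans (hf x)); apply: fg; move: xN; rewrite inE.
Qed.

(** The two difference quotients are the same function of [h], so nothing is asked of [f] beyond its
    derivative along [v]. *)
Lemma is_derive_comp_affine (R : numFieldType) (U V W : normedModType R)
    (phi : U -> V) (f : V -> W) (a u : U) (v : V) (d : W) :
  (forall h : R, phi (h *: u + a) = h *: v + phi a) ->
  is_derive (phi a) v f d -> is_derive a u (f \o phi) d.
Proof.
move=> phiE [fd fE].
have E : (fun h : R => h^-1 *: (((f \o phi) \o shift a) (h *: u) - (f \o phi) a)) =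
    (fun h : R => h^-1 *: ((f \o shift (phi a)) (h *: v) - f (phi a))).
  by apply/funext => h /=; rewrite phiE.
by split; rewrite /derivable /derive E.
Qed.

(** * Vanishing integrals of partial derivatives *)

Section Fundamental.
Context (R : realType).
Local Notation mu := (@lebesgue_measure R).
Local Notation lam := (@lebesgue_tuple R).

Lemma integral_derivative_eq0 (f h : R -> R) (L : R) :
  (forall x : R, is_derive x 1 f (h x)) -> continuous h ->
  (forall x, L < `|x| -> f x = 0) -> (forall x, L < `|x| -> h x = 0) ->
  (\int[mu]_x (h x)%:E = 0)%E.
Proof.
move=> fh ch f0 h0.
(* [L] may be negative, whereas [[- M, M]] must be nondegenerate. *)
pose M := `|L| + 1.
have LM : L < M by rewrite (le_lt_trans (ler_norm _))// ltrDl.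
have M0 : 0 < M by rewrite ltr_wpDl.
have -> : (\int[mu]_x (h x)%:E = \int[mu]_(x in `[(- M)%R, M]) (h x)%:E)%E.
  rewrite [RHS]integral_mkcond; apply: eq_integral => x _.
  rewrite patchE; case: ifPn => //; rewrite notin_setE/= in_itv/= => H.
  by rewrite h0// (lt_trans LM)// ltNge ler_norml; exact/negP.
have fc : continuous f.
  by move=> x; apply/differentiable_continuous/derivable1_diffP; have [] := fh x.
rewrite (@continuous_FTC2 _ h f).
- by rewrite !f0 ?subee// ?normrN ger0_norm// ltW.
- by rewrite gt0_cp.
- exact: continuous_subspaceT.
- split => [x _||]; first by have [] := fh x.
    exact/cvg_at_right_filter/fc.
  exact/cvg_at_left_filter/fc.
- by move=> x _; rewrite derive1E; have [] := fh x.
Qed.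

(** A cube rather than a Euclidean ball: the same [L] then serves every coordinate slice. *)
Definition vanishes_outside m (L : R) (f : 'rV[R]_m -> R) :=
  forall (z : 'rV[R]_m) i, L < `|z 0 i| -> f z = 0.

Lemma bounded_rV_integrable m (f : 'rV[R]_m -> R) (L M : R) :
  measurable_fun setT (f \o @tuple_row R m) -> vanishes_outside L f ->
  (forall z, `|f z| <= M) -> (lam m).-integrable setT (EFin \o f \o @tuple_row R m).
Proof.
move=> mf fL fM.
have [mA lA] := @lebesgue_tuple_cube R m 0 `|L| (normr_ge0 _).
set A := [set t | _] in mA lA.
have iA : (lam m).-integrable setT (fun t => (M%:E * (\1_A t)%:E)%E).
  apply: integrableZl => //; apply/integrableP; split.
    exact/measurable_EFinP.
  rewrite (eq_integral (fun t => (\1_A t)%:E)); last first.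
    by move=> t _; rewrite gee0_abs// lee_fin.
  by rewrite integral_indic// setIT [X in (X < _)%E]lA ltry.
apply: le_integrable iA => //; first exact/measurable_EFinP.
move=> t _ /=; rewrite indicE; have [tA|/negP tA] := boolP (t \in A).
  by rewrite mulr1 lee_fin (le_trans (fM _))// ler_norm.
rewrite mulr0 normr0 (_ : f _ = 0) ?normr0//.
have [i Hi] : exists i, ~ (`|tnth t i - (0 : 'rV[R]_m) 0 i| <= `|L|).
  by apply/existsNP => H; apply: tA; rewrite inE.
apply: (fL _ i); rewrite tuple_rowE; move/negP: Hi.
by rewrite mxE subr0 -ltNge; apply: le_lt_trans; exact: ler_norm.
Qed.

Lemma continuous_vanishing_bounded m (f : 'rV[R]_m -> R) (L : R) :
  continuous f -> vanishes_outside L f -> exists M, forall z, `|f z| <= M.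
Proof.
move=> cf fL.
pose A := [set z : 'rV[R]_m | forall i, z 0 i \in `[- L, L]].
have cA : compact A.
  apply: (@rV_compact _ m (fun=> `[- L, L]%classic)) => i; exact: segment_compact.
have cfA : compact (f @` A).
  by apply: continuous_compact => //; exact: continuous_subspaceT.
have [M [_ HM]] := compact_bounded cfA.
exists (`|M| + 1) => z.
have [zA|/existsNP[i]] := pselect (A z).
  apply: (HM (`|M| + 1)); last by exists z.
  by rewrite (le_lt_trans (ler_norm _))// ltrDl.
move=> /negP; rewrite in_itv/= -ler_norml -ltNge => /fL ->.
by rewrite normr0 addr_ge0.
Qed.

Lemma continuous_vanishing_integrable m (f : 'rV[R]_m -> R) (L : R) :
  continuous f -> vanishes_outside L f ->
  (lam m).-integrable setT (EFin \o f \o @tuple_row R m).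
Proof.
move=> cf fL; have [M fM] := continuous_vanishing_bounded cf fL.
apply: bounded_rV_integrable fL fM; exact: measurable_continuous_row.
Qed.

Definition row_cons m (s : R) (z : 'rV[R]_m) : 'rV[R]_m.+1 :=
  \row_i if unlift ord0 i is Some j then z 0 j else s.

Lemma tuple_row_consE m (t : m.-tuple R) s :
  tuple_row (tuple_cons (t, s)) = row_cons s (tuple_row t).
Proof.
apply/rowP => i; rewrite tuple_row_cons mxE; by case: unlift.
Qed.

Lemma row_cons_continuousl m (z : 'rV[R]_m) : continuous (fun s => row_cons s z).
Proof.
move=> s; apply/cvg_ballP => e e0; near=> s'; split => // a i.
rewrite !mxE; case: unlift => [j|]; first exact: ballxx.
by near: s'; exact: (nbhsx_ballx s e e0).
Unshelve. all: by end_near. Qed.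

Lemma row_cons_continuousr m s : continuous (@row_cons m s).
Proof.
move=> z A /nbhs_ballP[e e0 eA].
apply: (filterS _ (nbhsx_ballx z e e0)) => z' [_ Bz]; apply: eA; split => // a i.
by rewrite !mxE; case: unlift => [j|]; [exact: Bz|exact: ballxx].
Qed.

(** Induction on the dimension, splitting off the first coordinate [s]. If the derivative is along
    another coordinate, every slice [s = const] falls under the induction hypothesis; if it is along
    the first, the inner integral vanishes by the fundamental theorem of calculus. *)
Lemma integral_partial_eq0 m (i : 'I_m) (f h : 'rV[R]_m -> R) (L : R) :
  (forall z, is_derive z (delta_mx 0 i) f (h z)) -> continuous h ->
  vanishes_outside L f -> vanishes_outside L h -> integral_rV h = 0%E.
Proof.
elim: m i f h => [[]//|m IH] i f h fh ch fL hL.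
have Ih := continuous_vanishing_integrable ch hL.
have [E1 E2] := integrable_integral_tuple_cons Ih.
rewrite /integral_rV; case: (unliftP ord0 i) => [j ij|i0].
  rewrite [LHS]E1 integral0_eq// => s _.
  under eq_integral do rewrite /= tuple_row_consE.
  apply: (IH j (f \o row_cons s) (h \o row_cons s)) => [z||z k Hk|z k Hk].
  - apply: is_derive_comp_affine (fh (row_cons s z)) => x.
    apply/rowP => k; rewrite !mxE ij.
    case: unliftP => [l ->|->] /=; rewrite ?mxE/=.
      by rewrite (inj_eq lift_inj).
    by rewrite mulr0 add0r.
  - by move=> z; apply: continuous_comp; [exact: row_cons_continuousr|exact: ch].
  - by apply: (fL _ (lift ord0 k)); rewrite mxE liftK.
  - by apply: (hL _ (lift ord0 k)); rewrite mxE liftK.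
rewrite [LHS]E2 integral0_eq// => t _.
under eq_integral do rewrite /= tuple_row_consE.
apply: (@integral_derivative_eq0 (fun s => f (row_cons s (tuple_row t)))
   (fun s => h (row_cons s (tuple_row t))) L) => [s||s Hs|s Hs].
- apply: (@is_derive_comp_affine _ _ _ _ (fun s => row_cons s (tuple_row t))
    f s 1 _ _ _ (fh _)) => x.
  apply/rowP => k; rewrite !mxE i0.
  by case: unliftP => [l ->|->] /=; rewrite ?mulr0 ?add0r.
- by move=> s; apply: (continuous_comp (f := fun s => row_cons s _)); [exact: row_cons_continuousl|exact: ch].
- by apply: (fL _ ord0); rewrite mxE unlift_none.
- by apply: (hL _ ord0); rewrite mxE unlift_none.
Qed.

End Fundamental.

(** * Directional derivatives *)

Section PointwiseRules.
Context (R : realType) (V : normedModType R).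
Implicit Types (f g : V -> R) (z v : V).

Lemma is_derive_addf z v f g a b : is_derive z v f a -> is_derive z v g b ->
  is_derive z v (fun x => f x + g x) (a + b).
Proof. exact: is_deriveD. Qed.

Lemma is_derive_mulf z v f g a b : is_derive z v f a -> is_derive z v g b ->
  is_derive z v (fun x => f x * g x) (a * g z + f z * b).
Proof.
move=> fa gb; apply: (is_derive_eq (is_deriveM fa gb)).
by rewrite addrC /GRing.scale/= [g z * a]mulrC.
Qed.

Lemma is_derive_mulcf z v f a (c : R) : is_derive z v f a ->
  is_derive z v (fun x => c * f x) (c * a).
Proof. exact: is_deriveZ. Qed.

Lemma is_derive_sumf n z v (h : 'I_n -> V -> R) (dh : 'I_n -> R) :
  (forall i, is_derive z v (h i) (dh i)) ->
  is_derive z v (fun x => \sum_i h i x) (\sum_i dh i).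
Proof.
move=> H; rewrite (_ : (fun x => _) = \sum_i h i); first exact: is_derive_sum.
by apply/funext => x; rewrite fct_sumE.
Qed.

(** Since [f] is known only along [v], [F] is composed with [f (h v + z)] as a function of the real
    variable [h], and the one-variable chain rule applies. *)
Lemma is_derive_compf (F : R -> R) f z v a b : is_derive z v f a ->
  is_derive (f z) 1 F b -> is_derive z v (fun x => F (f x)) (b * a).
Proof.
move=> fa Fb.
have la : is_derive (0 : R) 1 (fun h : R => f (h *: v + z)) a.
  apply: (@is_derive_comp_affine _ _ _ _ (fun h : R => h *: v + z) f 0 1 v).
    by move=> h /=; rewrite addr0 scale0r add0r /GRing.scale/= mulr1.
  by rewrite scale0r add0r.
have Fb' : is_derive (f (0 *: v + z)) 1 F b by rewrite scale0r add0r.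
have [lc lE] := is_derive1_comp Fb' la.
have E : (fun h : R => h^-1 *: ((((fun x => F (f x)) \o shift z) (h *: v) - F (f z)) : R)) =
   (fun h : R => h^-1 *: (((F \o (fun h : R => f (h *: v + z))) \o shift 0) (h *: (1 : R))
     - (F \o (fun h : R => f (h *: v + z))) 0)).
  by apply/funext => h /=; rewrite addr0 scale0r add0r /GRing.scale/= mulr1.
by split; rewrite /derivable /derive E.
Qed.

End PointwiseRules.
Arguments is_derive_compf {R V} F f {z v a b}.

(** * Powers and flat functions of one variable *)

Section OneDim.
Context (R : realType).
Implicit Types (t a b p : R).

(** The exception is real: at [t = 0] and [a = -1] the left side is [0 ^ 0 = 1] and the right side
    is 0. *)
Lemma powRD1 t a : 0 <= t -> a != -1 -> t `^ (a + 1) = t `^ a * t.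
Proof.
move=> t0 a1; rewrite powRD ?powRr1//; apply/implyP => /eqP H.
by move: a1; rewrite -subr_eq0 opprK H eqxx.
Qed.

Lemma is_derive_powR t a : 0 < t ->
  is_derive t 1 (fun t => t `^ a) (a * t `^ (a - 1)).
Proof.
move=> t0; have tI : t \in `]0, +oo[ by rewrite in_itv/= andbT.
split; first exact: derivable_powR.
by rewrite -derive1E powR_derive1.
Qed.

Lemma powR_continuous_at t a : 0 < t -> {for t, continuous (fun t => t `^ a)}.
Proof.
move=> t0; apply/differentiable_continuous/derivable1_diffP.
by have [] := is_derive_powR a t0.
Qed.

Lemma norm_powR_continuous a : 0 <= a -> continuous (fun t => `|t| `^ a).
Proof.
move=> a0 t; have [->|t0] := eqVneq t 0; last first.
  apply: (continuous_comp (f := fun x : R => `|x|) (g := fun x => x `^ a)).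
    exact: norm_continuous.
  by apply: powR_continuous_at; rewrite normr_gt0.
have [->|an0] := eqVneq a 0.
  rewrite (_ : (fun t => _) = cst 1); first exact: cvg_cst.
  by apply/funext => x; rewrite powRr0.
apply/cvgrPdist_lt => e e0; rewrite normr0 powR0//.
exists (e `^ a^-1); first by rewrite /= powR_gt0.
move=> x /=; rewrite !sub0r !normrN [X in _ -> X < _]ger0_norm ?powR_ge0// => H.
have := @gt0_ltr_powR R a _ `|x| (e `^ a^-1).
rewrite lt_neqAle eq_sym an0 a0 -powRrM mulVf// powRr1 ?(ltW e0)//.
by apply => //; rewrite nnegrE ?powR_ge0.
Qed.

Lemma is_derive_norm t : t != 0 -> is_derive t 1 (fun t => `|t|) (Num.sg t).
Proof.
move=> t0; have [tn|tp|] := ltgtP t 0; last by move/eqP: t0.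
- apply: (@near_eq_is_derive _ _ _ (fun t => - t)).
    near=> s; rewrite ltr0_norm//.
    by near: s; exact: lt_nbhsl.
  by rewrite ltr0_sg//; apply: is_deriveN.
- apply: (@near_eq_is_derive _ _ _ id).
    near=> s; rewrite gtr0_norm//.
    by near: s; exact: lt_nbhsr.
  by rewrite gtr0_sg//; apply: is_derive_id.
Unshelve. all: by end_near. Qed.

(** At 0 the difference quotient is [|h| ^ b]. The signed power is thus derivable on the whole line,
    which covers the zeros of [u] and the set [{x = 0}]. *)
Lemma is_derive_spow t b : 0 <= b ->
  is_derive t 1 (fun t => `|t| `^ b * t) ((1 + b) * `|t| `^ b).
Proof.
move=> b0; have [->|t0] := eqVneq t 0.
  have cv : h^-1 *: (`|h *: (1 : R) + 0| `^ b * (h *: 1 + 0) - `|0 : R| `^ b * 0) @[h --> (0 : R)^'] --> (1 + b) * `|0 : R| `^ b.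
    have -> : (1 + b) * `|0 : R| `^ b = `|0 : R| `^ b.
      have [->|bn] := eqVneq b 0; first by rewrite addr0 mul1r.
      by rewrite normr0 powR0// mulr0.
    have : `|h| `^ b @[h --> (0 : R)^'] --> `|0 : R| `^ b.
      by apply: cvg_within_filter; exact: (norm_powR_continuous b0).
    move=> H; apply: (cvg_trans _ H); apply: near_eq_cvg; near=> h.
    rewrite mulr0 subr0 addr0 /GRing.scale/= mulr1 mulrCA mulVf ?mulr1//.
    by near: h; exact: nbhs_dnbhs_neq.
  split; first by apply/cvg_ex; eexists; exact: cv.
  exact/cvg_lim.
apply: is_derive_eq.
  apply: (is_derive_mulf _ (is_derive_id _ _)).
  apply: (is_derive_compf (fun s => s `^ b) (fun s => `|s|) (is_derive_norm t0)).
  by apply: is_derive_powR; rewrite normr_gt0.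
rewrite mulr1 mulrDl mul1r addrC; congr (_ + _).
rewrite -!mulrA -normrEsg.
have [->|bn] := eqVneq b 0; first by rewrite !mul0r.
by rewrite [X in _ * X]mulrC mulr_powRB1// lt_neqAle eq_sym bn.
Unshelve. all: by end_near. Qed.

Lemma is_derive_norm_powR t p : 2 <= p ->
  is_derive t 1 (fun t => `|t| `^ p) (p * (`|t| `^ (p - 2) * t)).
Proof.
move=> p2.
have p20 : 0 <= p - 2 by rewrite subr_ge0.
have -> : (fun t => `|t| `^ p) = (fun t => (`|t| `^ (p - 2) * t) * t).
  apply/funext => s; rewrite -mulrA -expr2 -real_normK ?num_real// expr2 mulrA.
  rewrite -!powRD1 ?normr_ge0//; first by congr powR; lra.
    by apply/eqP; lra.
  by apply/eqP; lra.
apply: is_derive_eq; first exact: (is_derive_mulf (is_derive_spow t p20) (is_derive_id _ _)).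
by rewrite /=; ring.
Qed.

(* [flatexp a t] is [t ^ a exp (- 1 / t)], flat at the origin. *)
Definition flatexp a t : R := if 0 < t then t `^ a * expR (- t^-1) else 0.

Lemma flatexp_ge0 a t : 0 <= flatexp a t.
Proof. by rewrite /flatexp; case: ifP => // _; rewrite mulr_ge0// ?powR_ge0 ?expR_ge0. Qed.

Lemma flatexp_le0 a t : t <= 0 -> flatexp a t = 0.
Proof. by rewrite /flatexp leNgt; case: ltP. Qed.

(** With an integer [n >= |a|], [exp (1 / t)] exceeds its Taylor term [t ^ (- n - 1) / (n + 1)!] and
    [t ^ a <= t ^ (- n)], so one power of [t] is left over. *)
Lemma flatexp_near0 a : exists C, forall t, `|t| <= 1 -> flatexp a t <= C * `|t|.
Proof.
pose n := (Num.truncn `|a|).+1.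
have na : `|a| <= n%:R by exact/ltW/truncnS_gt.
exists (n.+1`!%:R) => t t1; rewrite /flatexp; case: ifP => t0; last first.
  by rewrite mulr_ge0// ler0n.
rewrite (gtr0_norm t0) in t1 *.
have E := expR_ge1Dxn n (ltW (_ : 0 < t^-1)).
have {}E : t^-1 ^+ n.+1 / n.+1`!%:R <= expR t^-1.
  by rewrite (le_trans _ (E _)) ?invr_gt0// lerDr.
rewrite expRN -ler_pdivlMr ?invr_gt0 ?expR_gt0// invrK.
apply: le_trans (_ : n.+1`!%:R * t * (t^-1 ^+ n.+1 / n.+1`!%:R) <= _); last first.
  by rewrite ler_pM2l// mulr_gt0// ltr0n fact_gt0.
have -> : n.+1`!%:R * t * (t^-1 ^+ n.+1 / n.+1`!%:R) = t^-1 ^+ n.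
  have f0 : n.+1`!%:R != 0 :> R by rewrite pnatr_eq0 -lt0n fact_gt0.
  rewrite exprS; move: (t^-1 ^+ n) => w; field.
  by rewrite f0 gt_eqF.
rewrite exprVn -powR_invn ?(ltW t0)//; apply: ger_powR; rewrite ?t0//.
by rewrite lerNl (le_trans _ na)// -normrN ler_norm.
Qed.

(** The family over all real exponents is closed under derivation, so that this one formula yields
    derivatives of every order. At 0 the quotient is [flatexp (a - 1) h], which tends to 0 by
    [flatexp_near0]. *)
Lemma is_derive_flatexp a t :
  is_derive t 1 (flatexp a) (a * flatexp (a - 1) t + flatexp (a - 2) t).
Proof.
have [tn|tp|->] := ltgtP t 0.
- rewrite !flatexp_le0 ?(ltW tn)// mulr0 addr0.
  apply: (@near_eq_is_derive _ _ _ (cst 0)).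
  by near=> s; rewrite flatexp_le0//; apply: ltW; near: s; exact: lt_nbhsl.
- apply: (@near_eq_is_derive _ _ _ (fun t => t `^ a * expR (- t^-1))).
    near=> s; rewrite /flatexp ifT//; near: s; exact: lt_nbhsr.
  rewrite /flatexp tp.
  apply: is_derive_eq.
    apply: is_derive_mulf (is_derive_powR a tp) _.
    apply: (is_derive_compf expR (fun t => - t^-1)) (is_derive_expR _).
    apply: is_deriveN; apply: (@is_deriveV _ id); rewrite ?gt_eqF//.
  rewrite /GRing.scale/= mulr1 opprK mulrA; congr (_ + _); first by rewrite mulrA.
  rewrite powRB ?powR_mulrn// ?(ltW tp)//; last by rewrite (gt_eqF tp) implybT.
  by rewrite [RHS]mulrAC.
have [C HC] := flatexp_near0 (a - 1).
rewrite !flatexp_le0// mulr0 addr0.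
have cv : h^-1 *: (flatexp a (h *: (1 : R) + 0) - flatexp a 0) @[h --> (0:R)^'] --> (0 : R).
  apply/cvgrPdist_le => e e0; near=> h.
  have hn0 : h != 0 by near: h; exact: nbhs_dnbhs_neq.
  rewrite sub0r normrN (@flatexp_le0 _ 0)// subr0 addr0 /GRing.scale/= mulr1 normrM.
  have [h0|h0] := leP h 0.
    by rewrite flatexp_le0// normr0 mulr0 ltW.
  have -> : `|h^-1| * `|flatexp a h| = flatexp (a - 1) h.
    rewrite ger0_norm ?invr_ge0 ?(ltW h0)// ger0_norm ?flatexp_ge0//.
    rewrite /flatexp h0 mulrA powRB ?powRr1 ?(ltW h0)//; last by rewrite (gt_eqF h0) implybT.
    by rewrite [_^-1 * _]mulrC.
  apply: le_trans (HC _ _) _.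
    by near: h; apply: dnbhs0_le.
  rewrite (@le_trans _ _ ((`|C| + 1) * `|h|))//.
    by rewrite ler_wpM2r// (le_trans (ler_norm _))// lerDl.
  rewrite -ler_pdivlMl ?ltr_wpDl//.
  near: h; apply: dnbhs0_le; by rewrite mulr_gt0// invr_gt0 ltr_wpDl.
split; first by apply/cvg_ex; eexists; exact: cv.
exact/cvg_lim.
Unshelve. all: by end_near. Qed.

Lemma flatexp_continuous a : continuous (flatexp a).
Proof.
move=> t; apply/differentiable_continuous/derivable1_diffP.
by have [] := is_derive_flatexp a t.
Qed.

End OneDim.

Section PointwiseContinuity.
Context (R : realType) (V : topologicalType).
Implicit Types (f h : V -> R) (z : V).

Lemma continuous_at_sum m (f : 'I_m -> V -> R) z :
  (forall i, {for z, continuous (f i)}) ->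
  {for z, continuous (fun x => \sum_i f i x)}.
Proof. 
move=> cf; apply: cvg_big => [x|i _]; last exact: cf.
by apply: cvgD; [exact: cvg_fst|exact: cvg_snd].
Qed.

Lemma continuous_at_add f h z : {for z, continuous f} -> {for z, continuous h} ->
  {for z, continuous (fun x => f x + h x)}.
Proof. exact: cvgD. Qed.

Lemma continuous_at_mul f h z : {for z, continuous f} -> {for z, continuous h} ->
  {for z, continuous (fun x => f x * h x)}.
Proof. exact: cvgM. Qed.

Lemma continuous_at_mulc f (c : R) z : {for z, continuous f} ->
  {for z, continuous (fun x => c * f x)}.
Proof. exact: cvgMr. Qed.

Lemma continuous_at_sqr f z : {for z, continuous f} ->
  {for z, continuous (fun x => f x ^+ 2)}.
Proof. by move=> cf; exact: (continuous_at_mul cf cf). Qed.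

Lemma continuous_at_cst (c : R) z : {for z, continuous (fun _ : V => c)}.
Proof. exact: cvg_cst. Qed.

End PointwiseContinuity.

(** * Grushin geometry *)

Section Geometry.
Context (R : realType) (n k : nat) (g : R).
Hypothesis g0 : 0 <= g.
Local Notation space := 'rV[R]_(n + k).
Implicit Types z : space.

(** Powers of [|x|] are written through the polynomial [|x| ^ 2], which is differentiable on
    [{x = 0}], unlike [enorm]. *)
Definition xnorm2 z : R := \sum_(i < n) z 0 (lshift k i) ^+ 2.
Definition ynorm2 z : R := \sum_(j < k) z 0 (rshift n j) ^+ 2.
Definition rho_pow z : R := xnorm2 z `^ (1 + g) + ynorm2 z.
Local Notation q := xnorm2.
Local Notation r := ynorm2.
Local Notation N := rho_pow.
Local Notation ex i := (delta_mx 0 (lshift k i) : space).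
Local Notation ey j := (delta_mx 0 (rshift n j) : space).

Lemma xnorm2_ge0 z : 0 <= q z.
Proof. by apply: sumr_ge0 => i _; exact: sqr_ge0. Qed.

Lemma ynorm2_ge0 z : 0 <= r z.
Proof. by apply: sumr_ge0 => i _; exact: sqr_ge0. Qed.

Lemma rho_pow_ge0 z : 0 <= N z.
Proof. by rewrite addr_ge0 ?powR_ge0 ?ynorm2_ge0. Qed.

Lemma xnorm2_eq0 z : (q z == 0) = (lsubmx z == 0).
Proof.
rewrite psumr_eq0; last by move=> i _; exact: sqr_ge0.
apply/allP/eqP => [H|H i _].
  apply/rowP => i; rewrite !mxE; have := H i (mem_index_enum _).
  by rewrite sqrf_eq0 => /eqP.
by move/rowP/(_ i): H; rewrite !mxE => ->; rewrite expr0n /= eqxx.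
Qed.

Lemma ynorm2_eq0 z : (r z == 0) = (rsubmx z == 0).
Proof.
rewrite psumr_eq0; last by move=> i _; exact: sqr_ge0.
apply/allP/eqP => [H|H i _].
  apply/rowP => i; rewrite !mxE; have := H i (mem_index_enum _).
  by rewrite sqrf_eq0 => /eqP.
by move/rowP/(_ i): H; rewrite !mxE => ->; rewrite expr0n /= eqxx.
Qed.

Lemma g1_neq0 : 1 + g != 0.
Proof. by rewrite gt_eqF// ltr_pwDl. Qed.

Lemma rho_pow_eq0 z : (N z == 0) = (z == 0).
Proof.
rewrite /rho_pow paddr_eq0 ?powR_ge0 ?ynorm2_ge0// powR_eq0 g1_neq0 andbT.
rewrite xnorm2_eq0 ynorm2_eq0; apply/andP/eqP => [[/eqP l0 /eqP r0]|->].
  by rewrite -(hsubmxK z) l0 r0 row_mx0.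
by rewrite linear0 linear0.
Qed.

Lemma rho_pow_gt0 z : z != 0 -> 0 < N z.
Proof. by rewrite -rho_pow_eq0 lt_neqAle rho_pow_ge0 andbT eq_sym. Qed.

Lemma enorm_lsubmx_powR z a : enorm (lsubmx z) `^ (2 * a) = q z `^ a.
Proof.
rewrite powRrM powR_mulrn ?sqrtr_ge0// sqr_sqrtr.
  by congr powR; apply: eq_bigr => i _; rewrite mxE.
by apply: sumr_ge0 => i _; exact: sqr_ge0.
Qed.

Lemma enorm_lsubmx_powR_half z a : enorm (lsubmx z) `^ a = q z `^ (a / 2).
Proof. by rewrite -enorm_lsubmx_powR mulrC mulfVK. Qed.

Lemma enorm_rsubmx_sqr z : enorm (rsubmx z) ^+ 2 = r z.
Proof.
rewrite sqr_sqrtr; last by apply: sumr_ge0 => i _; exact: sqr_ge0.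
by apply: eq_bigr => i _; rewrite mxE.
Qed.

Lemma grushin_rhoE z : grushin_rho g z = N z `^ (2 + 2 * g)^-1.
Proof. by rewrite /grushin_rho enorm_lsubmx_powR enorm_rsubmx_sqr. Qed.

Lemma is_derive_coord m (w v : 'rV[R]_m) (l : 'I_m) :
  is_derive w v (fun x => x 0 l) (v 0 l).
Proof.
have cv : h^-1 *: ((h *: v + w) 0 l - w 0 l) @[h --> (0 : R)^'] --> v 0 l.
  apply: cvg_near_cst; near=> h.
  rewrite !mxE addrK /GRing.scale/= mulKf//.
  by near: h; exact: nbhs_dnbhs_neq.
split; first by apply/cvg_ex; eexists; exact: cv.
exact/cvg_lim.
Unshelve. all: by end_near. Qed.

Lemma is_derive_coord_sqr z v l :
  is_derive z v (fun z : space => z 0 l ^+ 2) (2 * z 0 l * v 0 l).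
Proof.
apply: is_derive_eq (is_derive_mulf (is_derive_coord z v l) (is_derive_coord z v l)) _.
ring.
Qed.

Lemma is_derive_xnorm2_x z i : is_derive z (ex i) q (2 * z 0 (lshift k i)).
Proof.
apply: is_derive_eq (is_derive_sumf (fun j => is_derive_coord_sqr _ _ _)) _.
rewrite (bigD1 i)//= mxE !eqxx mulr1 big1 ?addr0// => j ji.
by rewrite mxE eqxx (inj_eq (@lshift_inj _ _)) (negbTE ji) mulr0.
Qed.

Lemma is_derive_xnorm2_y z j : is_derive z (ey j) q 0.
Proof.
apply: is_derive_eq (is_derive_sumf (fun j => is_derive_coord_sqr _ _ _)) _.
by rewrite big1// => i _; rewrite mxE eqxx eq_lrshift mulr0.
Qed.

Lemma is_derive_ynorm2_x z i : is_derive z (ex i) r 0.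
Proof.
apply: is_derive_eq (is_derive_sumf (fun j => is_derive_coord_sqr _ _ _)) _.
by rewrite big1// => j _; rewrite mxE eqxx eq_rlshift mulr0.
Qed.

Lemma is_derive_ynorm2_y z j : is_derive z (ey j) r (2 * z 0 (rshift n j)).
Proof.
apply: is_derive_eq (is_derive_sumf (fun j => is_derive_coord_sqr _ _ _)) _.
rewrite (bigD1 j)//= mxE !eqxx mulr1 big1 ?addr0// => i ij.
by rewrite mxE eqxx (inj_eq (@rshift_inj _ _)) (negbTE ij) mulr0.
Qed.

(** As a signed power, the first term can be differentiated at [q z = 0] without a case
    distinction. *)
Lemma rho_pow_spow : N = fun z => `|q z| `^ g * q z + r z.
Proof.
apply/funext => z; rewrite ger0_norm ?xnorm2_ge0// -powRD1 ?xnorm2_ge0//.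
  by rewrite [g + 1]addrC.
by rewrite gt_eqF// (lt_le_trans _ g0)// ltrN10.
Qed.

Lemma is_derive_rho_pow_x z i :
  is_derive z (ex i) N (2 * (1 + g) * q z `^ g * z 0 (lshift k i)).
Proof.
rewrite rho_pow_spow; apply: is_derive_eq.
  apply: (is_derive_addf _ (is_derive_ynorm2_x z i)).
  exact: (is_derive_compf (fun t => `|t| `^ g * t) q
            (is_derive_xnorm2_x z i) (is_derive_spow _ g0)).
by rewrite addr0 ger0_norm ?xnorm2_ge0//; ring.
Qed.

Lemma is_derive_rho_pow_y z j :
  is_derive z (ey j) N (2 * z 0 (rshift n j)).
Proof.
rewrite rho_pow_spow; apply: is_derive_eq.
  apply: (is_derive_addf _ (is_derive_ynorm2_y z j)).
  exact: (is_derive_compf (fun t => `|t| `^ g * t) q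
            (is_derive_xnorm2_y z j) (is_derive_spow _ g0)).
by rewrite mulr0 add0r.
Qed.

Lemma xnorm2_continuous : continuous q.
Proof.
move=> z; apply: continuous_at_sum => i; apply: continuous_at_sqr.
exact: coord_continuous.
Qed.

Lemma ynorm2_continuous : continuous r.
Proof.
move=> z; apply: continuous_at_sum => i; apply: continuous_at_sqr.
exact: coord_continuous.
Qed.

Lemma xnorm2_powR_continuous a : 0 <= a -> continuous (fun z => q z `^ a).
Proof.
move=> a0; rewrite (_ : (fun z => _) = (fun z => `|q z| `^ a)).
  move=> z; apply: (continuous_comp (f := q) (g := fun t => `|t| `^ a)).
    exact: xnorm2_continuous.
  exact: norm_powR_continuous.
by apply/funext => z; rewrite ger0_norm// xnorm2_ge0.
Qed.

Lemma rho_pow_continuous : continuous N.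
Proof.
move=> z; apply: (@continuous_at_add _ _ (fun z => q z `^ (1 + g)) r).
  by apply: xnorm2_powR_continuous; rewrite addr_ge0.
exact: ynorm2_continuous.
Qed.

Lemma rho_pow_powR_continuous_at a z : z != 0 ->
  {for z, continuous (fun z => N z `^ a)}.
Proof.
move=> z0; apply: (continuous_comp (f := N) (g := fun t => t `^ a)).
  exact: rho_pow_continuous.
exact/powR_continuous_at/rho_pow_gt0.
Qed.

(** [q] is constant along [y], so [F] needs no regularity; this matters for [t ^ g] at [t = 0]. *)
Lemma is_derive_xnorm2_comp_y (F : R -> R) z j :
  is_derive z (ey j) (fun z => F (q z)) 0.
Proof.
have E (h : R) : q (h *: ey j + z) = q z.
  by apply: eq_bigr => i _; rewrite !mxE eqxx eq_lrshift mulr0 add0r.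
have H : (fun h : R => h^-1 *: ((((fun z => F (q z)) \o shift z) (h *: ey j) - F (q z)) : R)) =
  (fun h : R => h^-1 *: (((cst (F (q z)) \o shift z) (h *: ey j) - cst (F (q z)) z) : R)).
  by apply/funext => h /=; rewrite E.
have [dc dE] := is_derive_cst (F (q z)) z (ey j).
by split; rewrite /derivable /derive H.
Qed.

(** This is the derivative of [|x| ^ (2 g) x_i] in [x_i]. On [{x = 0}] the second term is 0 whatever
    the value of the power [g - 1], because [x_i = 0]. *)
Definition weight_x i z :=
  q z `^ g + 2 * g * (q z `^ (g - 1) * z 0 (lshift k i) ^+ 2).

Lemma coord_sqr_le z i : z 0 (lshift k i) ^+ 2 <= q z.
Proof.
by rewrite /xnorm2 (bigD1 i)//= lerDl sumr_ge0// => j _; exact: sqr_ge0.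
Qed.

Lemma xnorm2_coord0 z : q z = 0 -> forall i, z 0 (lshift k i) = 0.
Proof.
by move=> /eqP; rewrite xnorm2_eq0 => /eqP/rowP H l; have := H l; rewrite !mxE.
Qed.

Lemma xnorm2_powRB1 z : q z != 0 -> q z `^ (g - 1) * q z = q z `^ g.
Proof.
move=> qz; rewrite -[X in _ * X]powRr1 ?xnorm2_ge0// -powRD ?subrK//.
by rewrite qz implybT.
Qed.

Lemma sum_weight_x z : \sum_i weight_x i z = (n%:R + 2 * g) * q z `^ g.
Proof.
rewrite big_split/= sumr_const card_ord [RHS]mulrDl.
congr (_ + _); first by rewrite mulr_natl.
rewrite -mulr_sumr -mulr_sumr -/(q z).
have [->|gn] := eqVneq g 0; first by rewrite !(mulr0, mul0r).
congr (_ * _).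
have [qz|qn] := eqVneq (q z) 0; last by rewrite xnorm2_powRB1.
by rewrite qz mulr0 powR0.
Qed.

Lemma is_derive_field_x z i :
  is_derive z (ex i) (fun z => q z `^ g * z 0 (lshift k i)) (weight_x i z).
Proof.
have [qz|qz] := eqVneq (q z) 0; last first.
  apply: is_derive_eq.
    apply: (is_derive_mulf _ (is_derive_coord z (ex i) _)).
    apply: (is_derive_compf (fun t => t `^ g) q (is_derive_xnorm2_x z i)).
    by apply: is_derive_powR; rewrite lt_neqAle eq_sym qz xnorm2_ge0.
  by rewrite mxE !eqxx /weight_x /=; ring.
have x0 := xnorm2_coord0 qz.
(* Along this line the function is the signed power [|h| ^ (2 g) h]. *)
have E (h : R) : q (h *: ex i + z) = h ^+ 2.
  rewrite /xnorm2 (bigD1 i)//= !mxE !eqxx mulr1 x0 addr0 big1 ?addr0// => j ji.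
  by rewrite !mxE x0 eqxx (inj_eq (@lshift_inj _ _)) (negbTE ji) mulr0 addr0 expr0n.
have g20 : 0 <= 2 * g by rewrite mulr_ge0.
have [dc dE] := is_derive_spow (0 : R) g20.
have F : (fun h : R => h^-1 *: ((((fun z => q z `^ g * z 0 (lshift k i)) \o shift z) (h *: ex i)
     - q z `^ g * z 0 (lshift k i)) : R)) =
  (fun h : R => h^-1 *: ((((fun t : R => `|t| `^ (2 * g) * t) \o shift 0) (h *: (1 : R))
     - `|0 : R| `^ (2 * g) * 0) : R)).
  apply/funext => h /=; rewrite E x0 addr0 !mulr0 !mxE !eqxx x0 addr0 /GRing.scale/= mulr1.
  by rewrite powRrM powR_mulrn// real_normK// num_real.
split; first by rewrite /derivable F.
rewrite /derive F [LHS]dE /weight_x qz x0 expr0n/= !mulr0 addr0 normr0.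
have [->|gn] := eqVneq g 0; first by rewrite mulr0 addr0 mul1r.
by rewrite !powR0 ?mulr0// mulf_neq0.
Qed.

Lemma weight_x_continuous i : continuous (weight_x i).
Proof.
move=> z; apply: (@continuous_at_add _ _ (fun z => q z `^ g)).
  exact: xnorm2_powR_continuous.
have [gz|gn] := eqVneq g 0.
  have -> : (fun y : space => 2 * g * (q y `^ (g - 1) * y 0 (lshift k i) ^+ 2)) = (fun=> 0).
    by apply/funext => y; rewrite gz mulr0 mul0r.
  exact: continuous_at_cst.
apply: continuous_at_mulc.
have [qz|qz] := eqVneq (q z) 0; last first.
  apply: continuous_at_mul.
    apply: (continuous_comp (f := q) (g := fun t => t `^ (g - 1))).
      exact: xnorm2_continuous.
    by apply: powR_continuous_at; rewrite lt_neqAle eq_sym qz xnorm2_ge0.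
  by apply: continuous_at_sqr; exact: coord_continuous.
rewrite /prop_for /continuous_at (xnorm2_coord0 qz) expr0n/= mulr0.
have qg : q y `^ g @[y --> z] --> (0 : R).
  by have := @xnorm2_powR_continuous g g0 z; rewrite /continuous_at qz powR0.
(* From [x_i ^ 2 <= q] the second term is, up to [2 g], between 0 and [q ^ g], and [g] is nonzero
   here. *)
apply: (squeeze_cvgr _ (cvg_cst 0) qg); near=> y.
rewrite mulr_ge0 ?powR_ge0 ?sqr_ge0//=.
have [qy|qy] := eqVneq (q y) 0.
  by rewrite (xnorm2_coord0 qy) expr0n/= mulr0 powR_ge0.
by rewrite -(xnorm2_powRB1 qy) ler_wpM2l ?powR_ge0// coord_sqr_le.
Unshelve. all: by end_near. Qed.

End Geometry.

(** * Functions supported away from the origin *)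

Section Supported.
Context (R : realType) (m : nat).
Implicit Types (f h : 'rV[R]_m -> R) (z : 'rV[R]_m).

(** Vanishing near 0 absorbs negative powers of [rho_pow]: the product of a supported function with
    one that behaves well only off 0 is well behaved everywhere. *)
Definition supported f := (exists L, vanishes_outside L f) /\
  \forall z \near (0 : 'rV[R]_m), f z = 0.

Definition continuous_off0 f := forall z, z != 0 -> {for z, continuous f}.

Lemma vanishes_outside_le (L L' : R) f : L <= L' -> vanishes_outside L f ->
  vanishes_outside L' f.
Proof. by move=> LL' fL z i Hz; apply: (fL z i); exact: le_lt_trans Hz. Qed.

Lemma supportedMl f h : supported f -> supported (fun z => f z * h z).
Proof.
move=> [[L fL] f0]; split.
  by exists L => z i /fL ->; rewrite mul0r.
by apply: filterS f0 => z ->; rewrite mul0r.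
Qed.

Lemma supportedMr f h : supported h -> supported (fun z => f z * h z).
Proof.
move=> /(supportedMl f); rewrite (_ : (fun z => h z * f z) = (fun z => f z * h z))//.
by apply/funext => z; rewrite mulrC.
Qed.

Lemma supportedD f h : supported f -> supported h -> supported (fun z => f z + h z).
Proof.
move=> [[L fL] f0] [[L' hL] h0]; split.
  exists (Num.max L L') => z i; rewrite gt_max => /andP[/fL -> /hL ->].
  by rewrite addr0.
by apply: filterS2 f0 h0 => z -> ->; rewrite addr0.
Qed.

Lemma supported_comp (F : R -> R) f : F 0 = 0 -> supported f ->
  supported (fun z => F (f z)).
Proof.
move=> F0 [[L fL] f0]; split; first by exists L => z i /fL ->.
by apply: filterS f0 => z ->.
Qed.

Lemma supported_continuous f : supported f -> continuous_off0 f -> continuous f.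
Proof.
move=> [_ f0] cf z; have [->|] := eqVneq z 0; last exact: cf.
have fE : {near (0 : 'rV[R]_m), (fun=> 0) =1 f}.
  by apply: filterS f0 => y ->.
rewrite /continuous_at (nbhs_singleton f0).
apply: (cvg_trans (near_eq_cvg fE)); exact: cvg_cst.
Qed.

(** Continuity and bounded support travel with the vanishing of the integral; they give the
    integrability needed to add such functions. *)
Definition null_integral f :=
  [/\ continuous f, exists L, vanishes_outside L f & integral_rV f = 0%E].

Lemma null_integral_partial (i : 'I_m) f h : supported f -> supported h ->
  (forall z, z != 0 -> is_derive z (delta_mx 0 i) f (h z)) ->
  continuous_off0 h -> null_integral h.
Proof.
move=> [[L fL] f0] sh dfh ch; have [[L' hL] h0] := sh.
split; [exact: supported_continuous|by exists L'|].
have [LM L'M] : L <= Num.max L L' /\ L' <= Num.max L L' by rewrite !le_max !lexx orbT.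
apply: (@integral_partial_eq0 _ _ i f h (Num.max L L')).
- move=> z; have [->|] := eqVneq z 0; last exact: dfh.
  rewrite (nbhs_singleton h0).
  apply: (@near_eq_is_derive _ _ _ (cst 0)).
  by apply: filterS f0 => y ->.
- exact: supported_continuous.
- exact: vanishes_outside_le fL.
- exact: vanishes_outside_le hL.
Qed.

Lemma integral_rVD f h L : continuous f -> continuous h ->
  vanishes_outside L f -> vanishes_outside L h ->
  integral_rV (fun z => f z + h z) = (integral_rV f + integral_rV h)%E.
Proof.
move=> cf ch fL hL; rewrite /integral_rV.
under eq_integral do rewrite EFinD.
rewrite integralD//; [exact: (continuous_vanishing_integrable cf fL)|].
exact: (continuous_vanishing_integrable ch hL).
Qed.

Lemma null_integralD f h : null_integral f -> null_integral h ->
  null_integral (fun z => f z + h z).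
Proof.
move=> [cf [L fL] If] [ch [L' hL] Ih].
have [LM L'M] : L <= Num.max L L' /\ L' <= Num.max L L' by rewrite !le_max !lexx orbT.
have {}fL := vanishes_outside_le LM fL; have {}hL := vanishes_outside_le L'M hL.
split.
- by move=> z; apply: continuous_at_add; [exact: cf|exact: ch].
- by exists (Num.max L L') => z i Hz; rewrite (fL _ _ Hz) (hL _ _ Hz) addr0.
- by rewrite (integral_rVD cf ch fL hL) If Ih adde0.
Qed.

Lemma null_integralZ c f : null_integral f -> null_integral (fun z => c * f z).
Proof.
move=> [cf [L fL] If]; split.
- by move=> z; apply: continuous_at_mulc; exact: cf.
- by exists L => z i /fL ->; rewrite mulr0.
- rewrite /integral_rV; under eq_integral do rewrite EFinM.
  rewrite integralZl//; last exact: (continuous_vanishing_integrable cf fL).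
  by rewrite -/(integral_rV f) If mule0.
Qed.

Lemma null_integral_sum l (f : 'I_l -> 'rV[R]_m -> R) :
  (forall i, null_integral (f i)) -> null_integral (fun z => \sum_i f i z).
Proof.
elim: l f => [|l IH] f H.
  rewrite (_ : (fun z => _) = (fun=> 0)); last first.
    by apply/funext => z; rewrite big_ord0.
  split; first by move=> z; exact: continuous_at_cst.
    by exists 0 => z i.
  by rewrite /integral_rV integral0.
rewrite (_ : (fun z => _) = (fun z => f ord0 z + \sum_i f (lift ord0 i) z)).
  by apply: null_integralD => //; exact: IH.
by apply/funext => z; rewrite big_ord_recl.
Qed.

End Supported.

Section TestFunctions.
Context (R : realType) (m : nat).
Implicit Types (f u : 'rV[R]_m -> R) (z : 'rV[R]_m) (K : set 'rV[R]_m).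

Lemma closed_supported K f : closed K -> compact K -> ~ K 0 ->
  (forall z, ~ K z -> f z = 0) -> supported f.
Proof.
move=> clK cK K0 fK; split.
  have [M [_ HM]] := compact_bounded cK.
  exists (`|M| + 1) => z i Hz; apply: fK => Kz.
  have := HM (`|M| + 1) _ z Kz => /(_ (le_lt_trans (ler_norm _) _)).
  rewrite ltrDl => /(_ ltr01) H.
  have : `|z 0 i| <= `|z|.
    have /mapP[j Hj ->] : `|z 0 i| \in [seq `|z x.1 x.2| | x : 'I_1 * 'I_m].
      by apply/mapP; exists (0, i) => //=; rewrite mem_enum.
    by rewrite [leRHS]/Num.norm/= mx_normrE; apply/bigmax_geP; right => /=; exists j.
  by rewrite leNgt => /negP; apply; exact: le_lt_trans Hz.
have oK : open (~` K) by exact: closed_openC.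
by apply: filterS (open_nbhs_nbhs (conj oK K0)) => z /fK.
Qed.

Lemma partial_off K f (i : 'I_m) : closed K -> (forall z, ~ K z -> f z = 0) ->
  forall z, ~ K z -> partial i f z = 0.
Proof.
move=> clK fK z Kz; rewrite /partial.
have oK : open (~` K) by exact: closed_openC.
rewrite (@near_eq_derive _ _ _ f (cst 0)) ?derive_cst//.
by apply: filterS (open_nbhs_nbhs (conj oK Kz)) => y /fK.
Qed.

Lemma test_function_support u : test_function u ->
  [/\ supported u, forall i, supported (partial i u) &
      forall i j, supported (partial i (partial j u))].
Proof.
move=> [_ cK K0]; have clK : closed (support_closure u) by exact: closed_closure.
have uK z : ~ support_closure u z -> u z = 0.
  move=> H; apply/eqP/negPn/negP => uz; apply: H; exact: subset_closure.
have u1 i := @partial_off _ u i clK uK.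
have u2 i j := @partial_off _ (partial j u) i clK (@u1 j).
split=> [|i|i j]; apply: (closed_supported clK cK K0).
- exact: uK.
- exact: u1.
- exact: u2.
Qed.

Lemma test_function_smooth u : test_function u ->
  [/\ continuous u, forall i, continuous (partial i u),
      forall i j, continuous (partial i (partial j u)),
      forall i z, is_derive z (delta_mx 0 i) u (partial i u z) &
      forall i j z, is_derive z (delta_mx 0 i) (partial j u)
        (partial i (partial j u) z)].
Proof.
move=> [su _ _]; split.
- exact: (su [::]).1.
- by move=> i; exact: (su [:: i]).1.
- by move=> i j; exact: (su [:: i; j]).1.
- by move=> i z; apply: derivableP; exact: (su [::]).2.
- by move=> i j z; apply: derivableP; exact: (su [:: j]).2.
Qed.

End TestFunctions.

(** * Divergence of fields along the dilations *)

Section Divergence.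
Context (R : realType) (n k : nat) (g : R).
Hypothesis g0 : 0 <= g.
Local Notation space := 'rV[R]_(n + k).
Implicit Types z : space.
Local Notation q := (@xnorm2 R n k).
Local Notation N := (@rho_pow R n k g).
Local Notation Q := (grushin_dim n k g).
Local Notation ee l := (delta_mx 0 l : space).

Definition drho_pow (l : 'I_(n + k)) z : R :=
  match fintype.split l with
  | inl i => 2 * (1 + g) * q z `^ g * z 0 (lshift k i)
  | inr j => 2 * z 0 (rshift n j)
  end.

Lemma drho_pow_x i z :
  drho_pow (lshift k i) z = 2 * (1 + g) * q z `^ g * z 0 (lshift k i).
Proof. by rewrite /drho_pow -[lshift k i]/(unsplit (inl i)) unsplitK. Qed.

Lemma drho_pow_y j z : drho_pow (rshift n j) z = 2 * z 0 (rshift n j).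
Proof. by rewrite /drho_pow -[rshift n j]/(unsplit (inr j)) unsplitK. Qed.

Lemma is_derive_rho_pow z l : is_derive z (ee l) N (drho_pow l z).
Proof.
case: (split_ordP l) => [i ->|j ->].
  by rewrite drho_pow_x; exact: is_derive_rho_pow_x.
by rewrite drho_pow_y; exact: is_derive_rho_pow_y.
Qed.

Lemma is_derive_rho_pow_powR z l a : z != 0 ->
  is_derive z (ee l) (fun z => N z `^ a) (a * N z `^ (a - 1) * drho_pow l z).
Proof.
move=> z0; apply: (is_derive_compf (fun t => t `^ a) N (is_derive_rho_pow z l)).
exact/is_derive_powR/rho_pow_gt0.
Qed.

Lemma drho_pow_continuous l : continuous (drho_pow l).
Proof.
case: (split_ordP l) => [i ->|j ->] z.
  rewrite (_ : drho_pow _ = (fun z => 2 * (1 + g) * (q z `^ g * z 0 (lshift k i)))).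
    apply: (@continuous_at_mulc _ _ (fun z => q z `^ g * z 0 (lshift k i))).
    apply: (@continuous_at_mul _ _ (fun z => q z `^ g)); last exact: coord_continuous.
    exact: xnorm2_powR_continuous.
  by apply/funext => y; rewrite drho_pow_x !mulrA.
rewrite (_ : drho_pow _ = (fun z => 2 * z 0 (rshift n j))).
  apply: (@continuous_at_mulc _ _ (fun z => z 0 (rshift n j))).
  exact: coord_continuous.
by apply/funext => y; rewrite drho_pow_y.
Qed.

(* The field [Phi (|x| ^ (2 g) x, (1 + g) |x| ^ (2 g) y)] is a multiple of
   [Phi rho ^ (2 g + 1)] times the Grushin gradient of [rho]. *)
Lemma null_integral_radial (Phi : space -> R) (D : 'I_(n + k) -> space -> R) :
  supported Phi -> (forall l, supported (D l)) ->
  (forall l z, z != 0 -> is_derive z (ee l) Phi (D l z)) ->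
  continuous_off0 Phi -> (forall l, continuous_off0 (D l)) ->
  null_integral (fun z => q z `^ g * ((Q + 2 * g) * Phi z +
    (\sum_i z 0 (lshift k i) * D (lshift k i) z +
     (1 + g) * \sum_j z 0 (rshift n j) * D (rshift n j) z))).
Proof.
move=> sP sD dP cP cD.
have cq := @xnorm2_powR_continuous R n k g g0.
have Hx i : null_integral (fun z => D (lshift k i) z * (q z `^ g * z 0 (lshift k i)) +
    Phi z * weight_x g i z).
  apply: (@null_integral_partial _ _ (lshift k i)
     (fun z => Phi z * (q z `^ g * z 0 (lshift k i)))).
  - exact: supportedMl.
  - by apply: supportedD; exact: supportedMl.
  - by move=> z z0; apply: is_derive_mulf (dP _ _ z0) (is_derive_field_x _ _ _).
  - move=> z z0; apply: continuous_at_add; apply: continuous_at_mul.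
    + exact: cD.
    + by apply: continuous_at_mul; [exact: cq|exact: coord_continuous].
    + exact: cP.
    + exact: weight_x_continuous.
have Hy j : null_integral (fun z => D (rshift n j) z * (q z `^ g * z 0 (rshift n j)) +
    Phi z * q z `^ g).
  apply: (@null_integral_partial _ _ (rshift n j)
     (fun z => Phi z * (q z `^ g * z 0 (rshift n j)))).
  - exact: supportedMl.
  - by apply: supportedD; exact: supportedMl.
  - move=> z z0; apply: is_derive_mulf (dP _ _ z0) _.
    apply: is_derive_eq.
      exact: (is_derive_mulf (is_derive_xnorm2_comp_y (fun t => t `^ g) z j)
        (is_derive_coord z _ _)).
    by rewrite mxE !eqxx mul0r add0r mulr1.
  - move=> z z0; apply: continuous_at_add; apply: continuous_at_mul.
    + exact: cD.
    + by apply: continuous_at_mul; [exact: cq|exact: coord_continuous].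
    + exact: cP.
    + exact: cq.
have := null_integralD (null_integral_sum Hx) (null_integralZ (1 + g) (null_integral_sum Hy)).
congr null_integral; apply/funext => z.
rewrite !big_split/= -!mulr_sumr (sum_weight_x _ z) sumr_const card_ord -mulr_natl.
rewrite /grushin_dim.
under eq_bigr do rewrite mulrCA; rewrite -mulr_sumr.
under [X in (1 + g) * (X + _)]eq_bigr do rewrite mulrCA; rewrite -mulr_sumr.
under eq_bigr do rewrite mulrC.
under [X in (1 + g) * (_ * X + _)]eq_bigr do rewrite mulrC.
ring.
Qed.

End Divergence.

(** * The Rellich inequality *)

(** The two sides differ by [(p - 1) m E] times the assumed square. Here [m = |u| ^ (p - 2)],
    [E = N ^ e], [G = |x| ^ (2 g)], [Sx] and [Sy] are the squared partial gradients of [u], [Yx] and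
    [Yy] their products with [x] and [y], and [T1], [T2] the two divergences. The cross terms in
    [Yx] and [Yy] force the multiplier of [T2]; the terms in [u ^ 2] then match because
    [(Q + 2 g) + 2 (1 + g) (e - 1) = p c]. *)
Lemma rellich_algebra (R : realFieldType)
    (g c p a u m E Nv G qv rv Sx Sy Yx Yy Lu : R) :
  1 + g != 0 -> 1 <= p -> Nv != 0 -> 0 <= m -> 0 <= E -> G * qv + rv = Nv ->
  0 <= Sx + 2 * (c * u * (G / Nv)) * Yx + (c * u * (G / Nv)) ^+ 2 * qv +
    G * ((1 + g) ^+ 2 * Sy + 2 * (1 + g) * (c * u / Nv) * Yy +
         (c * u / Nv) ^+ 2 * rv) ->
  let Q := p * c + 2 + a in
  let e := - a / (2 + 2 * g) in
  let T1 := (p - 1) * m * E * (Sx + (1 + g) ^+ 2 * G * Sy) + m * u * E * Lu +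
    m * u * e * (E / Nv) * (2 * (1 + g) * G * (Yx + (1 + g) * Yy)) in
  let T2 := G * ((Q + 2 * g) * (m * u ^+ 2 * (E / Nv)) +
    (p * (m * u) * (E / Nv) * (Yx + (1 + g) * Yy) +
     m * u ^+ 2 * ((e - 1) * (E / Nv / Nv)) * (2 * (1 + g) * Nv))) in
  c * (c * (p - 1) + a) * (m * u ^+ 2 * (E / Nv) * G) +
    (- (2 * c * (p - 1) + a) / p * T2 - T1) <= - (m * u * E * Lu).
Proof.
move=> g1 p1 N0 m0 E0 hN sq; cbv zeta.
have p0 : p != 0 by rewrite gt_eqF// (lt_le_trans ltr01).
rewrite -subr_ge0.
set d := (X in 0 <= X).
have -> : d = (p - 1) * m * E * (Sx + 2 * (c * u * (G / Nv)) * Yx +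
    (c * u * (G / Nv)) ^+ 2 * qv +
    G * ((1 + g) ^+ 2 * Sy + 2 * (1 + g) * (c * u / Nv) * Yy +
         (c * u / Nv) ^+ 2 * rv)).
  have -> : rv = Nv - G * qv by rewrite -hN; ring.
  rewrite /d.
  have -> : 2 + 2 * g = 2 * (1 + g) by ring.
  by field; rewrite N0 p0 g1.
by rewrite mulr_ge0// !mulr_ge0// subr_ge0.
Qed.

Section Rellich.
Context (R : realType) (n k : nat) (g p : R).
Hypotheses (g0 : 0 <= g) (p2 : 2 <= p).
Local Notation space := 'rV[R]_(n + k).
Implicit Types z : space.
Local Notation q := (@xnorm2 R n k).
Local Notation N := (@rho_pow R n k g).
Local Notation Q := (grushin_dim n k g).
Local Notation ee l := (delta_mx 0 l : space).

Variable u : space -> R.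
Hypothesis tu : test_function u.
Local Notation psi t := (`|t| `^ (p - 2) * t).

Let p20 : 0 <= p - 2. Proof. by rewrite subr_ge0. Qed.

Lemma norm_powR_psi (t : R) : `|t| `^ p = `|t| `^ (p - 2) * t ^+ 2.
Proof.
rewrite -real_normK ?num_real// expr2 mulrA -!powRD1 ?normr_ge0//.
- by congr powR; ring.
- by rewrite gt_eqF// (lt_le_trans (ltrN10 _))// addr_ge0.
- by rewrite gt_eqF// (lt_le_trans (ltrN10 _)).
Qed.

(** The derivative along [l] of [|u| ^ (p - 2) u * partial l u * N ^ e]; for [e = - a / (2 + 2 g)]
    the last factor is [rho ^ (- a)]. *)
Definition energy_div e l z :=
  (1 + (p - 2)) * `|u z| `^ (p - 2) * partial l u z * (partial l u z * N z `^ e) +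
  psi (u z) * (partial l (partial l u) z * N z `^ e +
    partial l u z * (e * N z `^ (e - 1) * drho_pow g l z)).

(** [|x| ^ (2 g)] does not depend on [y] and passes through the [y]-derivatives, so this is the
    Grushin divergence of [|u| ^ (p - 2) u N ^ e] times the Grushin gradient of [u]. *)
Lemma null_integral_energy e :
  null_integral (fun z => \sum_i energy_div e (lshift k i) z +
    (1 + g) ^+ 2 * \sum_j q z `^ g * energy_div e (rshift n j) z).
Proof.
have [su su1 su2] := test_function_support tu.
have [cu cu1 cu2 du du1] := test_function_smooth tu.
have sT l : supported (energy_div e l).
  apply: supportedD; first by apply: supportedMr; exact: supportedMl.
  by apply: supportedMl; apply: supportedMr.
have sP l : supported (fun z => psi (u z) * (partial l u z * N z `^ e)).
  by apply: supportedMl; exact: supportedMr.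
have dP l z : z != 0 -> is_derive z (ee l)
    (fun z => psi (u z) * (partial l u z * N z `^ e)) (energy_div e l z).
  move=> z0; apply: is_derive_mulf.
    exact: (is_derive_compf (fun t => psi t) u (du l z) (is_derive_spow _ p20)).
  exact: (is_derive_mulf (du1 _ _ _) (is_derive_rho_pow_powR g0 _ _ z0)).
have cm z : {for z, continuous (fun z => `|u z| `^ (p - 2))}.
  apply: (continuous_comp (f := u) (g := fun t => `|t| `^ (p - 2))); first exact: cu.
  exact: norm_powR_continuous.
have cT l : continuous_off0 (energy_div e l).
  move=> z z0.
  have cN a := @rho_pow_powR_continuous_at R n k g g0 a z z0.
  apply: continuous_at_add; apply: continuous_at_mul.
  - apply: continuous_at_mul; last exact: cu1.
    by apply: continuous_at_mulc; exact: cm.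
  - by apply: continuous_at_mul; [exact: cu1|exact: cN].
  - by apply: continuous_at_mul; [exact: cm|exact: cu].
  - apply: continuous_at_add; apply: continuous_at_mul.
    + exact: cu2.
    + exact: cN.
    + exact: cu1.
    + apply: continuous_at_mul; first by apply: continuous_at_mulc; exact: cN.
      exact: drho_pow_continuous.
apply: null_integralD.
  apply: null_integral_sum => i.
  exact: (null_integral_partial (sP _) (sT _) (dP _) (cT _)).
apply: null_integralZ; apply: null_integral_sum => j.
apply: (@null_integral_partial _ _ (rshift n j)
  (fun z => q z `^ g * (psi (u z) * (partial (rshift n j) u z * N z `^ e)))).
- exact: supportedMr.
- exact: supportedMr.
- move=> z z0; apply: is_derive_eq.
    exact: (is_derive_mulf (is_derive_xnorm2_comp_y (fun t => t `^ g) z j) (dP _ _ z0)).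
  by rewrite mul0r add0r.
- move=> z z0; apply: continuous_at_mul; last exact: cT.
  exact: xnorm2_powR_continuous.
Qed.

(** The derivative along [l] of [|u| ^ p N ^ (e - 1)], which plays the part of [Phi] in
    [null_integral_radial]. *)
Definition mass_grad e l z :=
  p * psi (u z) * partial l u z * N z `^ (e - 1) +
  `|u z| `^ p * ((e - 1) * N z `^ (e - 1 - 1) * drho_pow g l z).

Lemma null_integral_mass e :
  null_integral (fun z => q z `^ g * ((Q + 2 * g) * (`|u z| `^ p * N z `^ (e - 1)) +
    (\sum_i z 0 (lshift k i) * mass_grad e (lshift k i) z +
     (1 + g) * \sum_j z 0 (rshift n j) * mass_grad e (rshift n j) z))).
Proof.
have [su su1 su2] := test_function_support tu.
have [cu cu1 cu2 du du1] := test_function_smooth tu.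
have p0 : p != 0 by rewrite gt_eqF// (lt_le_trans _ p2).
have sup : supported (fun z => `|u z| `^ p).
  by apply: (@supported_comp _ _ (fun t => `|t| `^ p)); rewrite ?normr0 ?powR0.
apply: (null_integral_radial g0) => //.
- exact: supportedMl.
- move=> l; apply: supportedD; last exact: supportedMl.
  by apply: supportedMl; apply: supportedMr.
- move=> l z z0; apply: is_derive_mulf; last exact: is_derive_rho_pow_powR.
  exact: (is_derive_compf (fun t => `|t| `^ p) u (du l z) (is_derive_norm_powR _ p2)).
- move=> z z0; apply: continuous_at_mul; last exact: rho_pow_powR_continuous_at.
  apply: (continuous_comp (f := u) (g := fun t => `|t| `^ p)); first exact: cu.
  by apply: norm_powR_continuous; rewrite (le_trans _ p2).
- move=> l z z0; have cN a := @rho_pow_powR_continuous_at R n k g g0 a z z0.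
  apply: continuous_at_add; apply: continuous_at_mul.
  - apply: continuous_at_mul; last exact: cu1.
    apply: continuous_at_mulc.
    apply: (continuous_comp (f := u) (g := fun t => psi t)); first exact: cu.
    apply/differentiable_continuous/derivable1_diffP.
    by have [] := is_derive_spow (u z) p20.
  - exact: cN.
  - apply: (continuous_comp (f := u) (g := fun t => `|t| `^ p)); first exact: cu.
    by apply: norm_powR_continuous; rewrite (le_trans _ p2).
  - apply: continuous_at_mul; last exact: drho_pow_continuous.
    by apply: continuous_at_mulc; exact: cN.
Qed.

End Rellich.

Lemma powR_expR (R : realType) (x a : R) : 0 < x -> x `^ a = expR (a * ln x).
Proof. by move=> x0; rewrite /powR gt_eqF. Qed.

Lemma young_powR (R : realType) (p A B : R) : 1 < p -> 0 <= A -> 0 <= B ->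
  A `^ (p - 1) * B <= (p - 1) / p * A `^ p + B `^ p / p.
Proof.
move=> p1 A0 B0.
have p0 : 0 < p by rewrite (lt_trans ltr01).
have p10 : 0 < p - 1 by rewrite subr_gt0.
have := @conjugate_powR R (A `^ (p - 1)) B (p / (p - 1)) p (powR_ge0 _ _) B0.
rewrite divr_gt0// => /(_ isT p0).
have -> : (p / (p - 1))^-1 + p^-1 = 1 by field; rewrite !gt_eqF.
move=> /(_ erefl); rewrite -powRrM.
have -> : (p - 1) * (p / (p - 1)) = p by field; rewrite !gt_eqF.
move=> /le_trans; apply; rewrite lerD2r le_eqVlt; apply/orP; left; apply/eqP.
by field; rewrite !gt_eqF.
Qed.

(** * The weights of both integrals as powers of [xnorm2] and [rho_pow] *)

Section Weights.
Context (R : realType) (n k : nat) (g : R).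
Hypothesis g0 : 0 <= g.
Local Notation space := 'rV[R]_(n + k).
Implicit Types (z : space) (u : space -> R).
Local Notation q := (@xnorm2 R n k).
Local Notation r := (@ynorm2 R n k).
Local Notation N := (@rho_pow R n k g).

Let g1 : 0 < 1 + g. Proof. by rewrite ltr_pwDl. Qed.
Let g2 : 0 < 2 + 2 * g. Proof. by rewrite -[X in X + _]mulr1 -mulrDr mulr_gt0. Qed.

Lemma partial_grushin_rho l z : z != 0 ->
  partial l (@grushin_rho R n k g) z =
  (2 + 2 * g)^-1 * N z `^ ((2 + 2 * g)^-1 - 1) * drho_pow g l z.
Proof.
move=> z0; rewrite /partial (_ : @grushin_rho R n k g = fun z => N z `^ (2 + 2 * g)^-1).
  by have [_ ->] := is_derive_rho_pow_powR g0 l (2 + 2 * g)^-1 z0.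
by apply/funext => y; exact: grushin_rhoE.
Qed.

Lemma xnorm2_powR1D z : q z `^ g * q z + r z = N z.
Proof. by rewrite -[X in X `^ g](ger0_norm (xnorm2_ge0 z)) -(congr1 (@^~ z) (rho_pow_spow n k g0)). Qed.

Lemma sum_xcoord_drho z :
  \sum_i z 0 (lshift k i) * drho_pow g (lshift k i) z = 2 * (1 + g) * (q z `^ g * q z).
Proof.
rewrite /xnorm2 !mulr_sumr; apply: eq_bigr => i _; rewrite drho_pow_x.
by rewrite /xnorm2; ring.
Qed.

Lemma sum_ycoord_drho z :
  \sum_j z 0 (rshift n j) * drho_pow g (rshift n j) z = 2 * r z.
Proof.
rewrite /ynorm2 !mulr_sumr; apply: eq_bigr => i _; rewrite drho_pow_y.
by ring.
Qed.

(** The [y]-part of the Grushin gradient carries [|x| ^ g], so both parts share the factor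
    [|x| ^ (2 g)] and the rest adds up to [N] by [xnorm2_powR1D]. In terms of [rho] the value is
    [|x| ^ (2 g) / rho ^ (2 g)]. *)
Lemma enorm_grushin_grad_rho z : z != 0 ->
  enorm (grushin_grad g (@grushin_rho R n k g) z) ^+ 2 =
  q z `^ g * N z `^ (- (g / (1 + g))).
Proof.
move=> z0; have N0 := rho_pow_gt0 g0 z0.
rewrite sqr_sqrtr; last by apply: sumr_ge0 => i _; exact: sqr_ge0.
rewrite big_split_ord /=.
have half : (q z `^ (g / 2)) ^+ 2 = q z `^ g.
  by rewrite -powR_mulrn ?powR_ge0// -powRrM mulfVK.
set s := (2 + 2 * g)^-1; set P := N z `^ (s - 1).
have -> : \sum_(i < n) grushin_grad g (@grushin_rho R n k g) z 0 (lshift k i) ^+ 2 =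
    (s * P) ^+ 2 * (2 * (1 + g)) ^+ 2 * (q z `^ g) ^+ 2 * q z.
  rewrite [in RHS]/xnorm2 mulr_sumr; apply: eq_bigr => i _.
  rewrite /grushin_grad row_mxEl mxE partial_grushin_rho// drho_pow_x -/s -/P; ring.
have -> : \sum_(i < k) grushin_grad g (@grushin_rho R n k g) z 0 (rshift n i) ^+ 2 =
    (s * P) ^+ 2 * (2 * (1 + g)) ^+ 2 * (q z `^ g) * r z.
  rewrite [in RHS]/ynorm2 mulr_sumr; apply: eq_bigr => i _.
  rewrite /grushin_grad row_mxEr !mxE partial_grushin_rho// drho_pow_y -/s -/P.
  rewrite enorm_lsubmx_powR_half -[q z `^ g]half; ring.
transitivity ((s * (2 * (1 + g))) ^+ 2 * (q z `^ g) * (P ^+ 2 * N z)).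
  by rewrite -[in RHS]xnorm2_powR1D; ring.
have -> : s * (2 * (1 + g)) = 1 by rewrite /s; field; rewrite gt_eqF.
rewrite expr1n mul1r; congr (_ * _).
rewrite /P -powR_mulrn ?powR_ge0// -powRrM -[X in _ * X]powRr1 ?(ltW N0)//.
rewrite -powRD ?(gt_eqF N0) ?implybT//; congr powR.
by rewrite /s; field; rewrite !gt_eqF.
Qed.

(** Off the origin this is [rho ^ (- a - 2) |grad rho| ^ 2]. *)
Definition mass_weight a z := q z `^ g * N z `^ (- (a + 2 + 2 * g) / (2 + 2 * g)).

(** Off [{x = 0}] this is [rho ^ (- p theta) |grad rho| ^ (- 2 (p - 1))]. *)
Definition op_weight p theta z :=
  N z `^ (- (p * theta) / (2 + 2 * g)) *
  (q z `^ g * N z `^ (- (g / (1 + g)))) `^ (- (p - 1)).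

Lemma rellich_lhsE p theta u z : z != 0 ->
  rellich_lhs g p theta u z = `|u z| `^ p * mass_weight (p * (theta + 2) - 2) z.
Proof.
move=> z0; have N0 := rho_pow_gt0 g0 z0.
rewrite /rellich_lhs enorm_grushin_grad_rho// grushin_rhoE -powRrM -powRN /mass_weight.
rewrite -mulrA; congr (_ * _); rewrite mulrCA; congr (_ * _).
rewrite -powRD ?(gt_eqF N0) ?implybT//; congr powR.
by field; rewrite !gt_eqF.
Qed.

Lemma rellich_rhsE p theta u z : z != 0 ->
  rellich_rhs g p theta u z = `|grushin_op g u z| `^ p * op_weight p theta z.
Proof.
move=> z0; have N0 := rho_pow_gt0 g0 z0.
rewrite /rellich_rhs grushin_rhoE -powRrM -powRN -mulrA; congr (_ * _).
rewrite /op_weight; congr (_ * _).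
  by congr powR; field; rewrite !gt_eqF.
rewrite -enorm_grushin_grad_rho// -mulrN powRrM powR_mulrn//.
exact: sqrtr_ge0.
Qed.

Lemma rellich_lhs_ge0 p theta u z : 0 <= rellich_lhs g p theta u z.
Proof. by rewrite /rellich_lhs mulr_ge0 ?sqr_ge0// divr_ge0 ?powR_ge0. Qed.

Lemma rellich_rhs_ge0 p theta u z : 0 <= rellich_rhs g p theta u z.
Proof. by rewrite /rellich_rhs mulr_ge0 ?powR_ge0// divr_ge0 ?powR_ge0. Qed.

Lemma mass_weight_ge0 a z : 0 <= mass_weight a z.
Proof. by rewrite mulr_ge0 ?powR_ge0. Qed.

Lemma op_weight_ge0 p theta z : 0 <= op_weight p theta z.
Proof. by rewrite mulr_ge0 ?powR_ge0. Qed.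

Lemma xnorm2_gt0 z : q z != 0 -> 0 < q z.
Proof. by move=> qz; rewrite lt_neqAle eq_sym qz xnorm2_ge0. Qed.

Lemma xnorm2_neq0 z : q z != 0 -> z != 0.
Proof. by apply: contra => /eqP ->; rewrite xnorm2_eq0 linear0. Qed.

(** The powers of [|grad rho|] cancel in this geometric mean. Matching the powers of [rho], that is
    [(a + 2) (p - 1) / p + theta = a], is what fixes [a = p (theta + 2) - 2]. *)
Lemma weight_interpolation p theta z : 1 < p -> q z != 0 ->
  mass_weight (p * (theta + 2) - 2) z `^ ((p - 1) / p) *
  op_weight p theta z `^ p^-1 =
  N z `^ (- (p * (theta + 2) - 2) / (2 + 2 * g)).
Proof.
move=> p1 qz; have q0 := xnorm2_gt0 qz.
have N0 := rho_pow_gt0 g0 (xnorm2_neq0 qz).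
rewrite /mass_weight /op_weight !(powR_expR _ q0) !(powR_expR _ N0).
rewrite -!expRD -!expRM -!expRD -expRM -expRD; congr expR.
by field; rewrite !gt_eqF// (lt_trans ltr01).
Qed.

End Weights.

(** * Pointwise inequality up to a divergence *)

Section Inequality.
Context (R : realType) (n k : nat) (g p theta : R).
Hypotheses (g0 : 0 <= g) (p2 : 2 <= p).
Local Notation space := 'rV[R]_(n + k).
Implicit Types (z : space) (u : space -> R).
Local Notation q := (@xnorm2 R n k).
Local Notation r := (@ynorm2 R n k).
Local Notation N := (@rho_pow R n k g).
Local Notation Q := (grushin_dim n k g).
Local Notation a := (p * (theta + 2) - 2).
Local Notation c := ((Q - p * (theta + 2)) / p).
Local Notation e := (- a / (2 + 2 * g)).
Local Notation psi t := (`|t| `^ (p - 2) * t).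

Let g1 : 0 < 1 + g. Proof. by rewrite ltr_pwDl. Qed.
Let g2 : 0 < 2 + 2 * g. Proof. by rewrite -[X in X + _]mulr1 -mulrDr mulr_gt0. Qed.
Let p0 : 0 < p. Proof. exact: lt_le_trans p2. Qed.
Let p1 : 1 < p. Proof. by rewrite (lt_le_trans _ p2)// ltr1n. Qed.

Lemma powRB1 (x b : R) : 0 < x -> x `^ (b - 1) = x `^ b / x.
Proof.
by move=> x0; rewrite powRB ?(gt_eqF x0) ?implybT// powRr1// ltW.
Qed.

Definition energy_field u z := \sum_i energy_div g p u e (lshift k i) z +
  (1 + g) ^+ 2 * \sum_j q z `^ g * energy_div g p u e (rshift n j) z.

Definition mass_field u z := q z `^ g *
  ((Q + 2 * g) * (`|u z| `^ p * N z `^ (e - 1)) +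
    (\sum_i z 0 (lshift k i) * mass_grad g p u e (lshift k i) z +
     (1 + g) * \sum_j z 0 (rshift n j) * mass_grad g p u e (rshift n j) z)).

Lemma mass_weightE z : z != 0 -> mass_weight g a z = q z `^ g * (N z `^ e / N z).
Proof.
move=> z0; have N0 := rho_pow_gt0 g0 z0.
rewrite /mass_weight; congr (_ * _); rewrite -powRB1//; congr powR.
by field; rewrite gt_eqF.
Qed.

Lemma energy_fieldE u z : z != 0 -> energy_field u z =
  (p - 1) * `|u z| `^ (p - 2) * N z `^ e *
    (\sum_i partial (lshift k i) u z ^+ 2 +
     (1 + g) ^+ 2 * q z `^ g * \sum_j partial (rshift n j) u z ^+ 2) +
  `|u z| `^ (p - 2) * u z * N z `^ e * grushin_op g u z +
  `|u z| `^ (p - 2) * u z * e * (N z `^ e / N z) *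
    (2 * (1 + g) * q z `^ g *
     (\sum_i z 0 (lshift k i) * partial (lshift k i) u z +
      (1 + g) * \sum_j z 0 (rshift n j) * partial (rshift n j) u z)).
Proof.
move=> z0; have N0 := rho_pow_gt0 g0 z0.
rewrite /energy_field /energy_div (powRB1 _ N0) /grushin_op enorm_lsubmx_powR.
set m := `|_| `^ _; set E := N z `^ e; set G := q z `^ g.
under eq_bigr do rewrite drho_pow_x -/G.
under [X in (1 + g) ^+ 2 * X]eq_bigr do rewrite drho_pow_y.
have -> : \sum_(i < n) ((1 + (p - 2)) * m * partial (lshift k i) u z * (partial (lshift k i) u z * E) +
   m * u z * (partial (lshift k i) (partial (lshift k i) u) z * E +
    partial (lshift k i) u z * (e * (E / N z) * (2 * (1 + g) * G * z 0 (lshift k i))))) =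
  (p - 1) * m * E * (\sum_i partial (lshift k i) u z ^+ 2) +
  m * u z * E * (\sum_i partial (lshift k i) (partial (lshift k i) u) z) +
  m * u z * e * (E / N z) * (2 * (1 + g) * G) * (\sum_i z 0 (lshift k i) * partial (lshift k i) u z).
  rewrite !mulr_sumr -!big_split/=; apply: eq_bigr => i _; ring.
have -> : \sum_(j < k) G * ((1 + (p - 2)) * m * partial (rshift n j) u z * (partial (rshift n j) u z * E) +
   m * u z * (partial (rshift n j) (partial (rshift n j) u) z * E +
    partial (rshift n j) u z * (e * (E / N z) * (2 * z 0 (rshift n j))))) =
  G * ((p - 1) * m * E * (\sum_j partial (rshift n j) u z ^+ 2) +
  m * u z * E * (\sum_j partial (rshift n j) (partial (rshift n j) u) z) +
  m * u z * e * (E / N z) * 2 * (\sum_j z 0 (rshift n j) * partial (rshift n j) u z)).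
  rewrite -mulr_sumr; congr (_ * _).
  rewrite !mulr_sumr -!big_split/=; apply: eq_bigr => i _; ring.
ring.
Qed.

Lemma mass_fieldE u z : z != 0 -> mass_field u z =
  q z `^ g * ((Q + 2 * g) * (`|u z| `^ (p - 2) * u z ^+ 2 * (N z `^ e / N z)) +
    (p * (`|u z| `^ (p - 2) * u z) * (N z `^ e / N z) *
     (\sum_i z 0 (lshift k i) * partial (lshift k i) u z +
      (1 + g) * \sum_j z 0 (rshift n j) * partial (rshift n j) u z) +
     `|u z| `^ (p - 2) * u z ^+ 2 * ((e - 1) * (N z `^ e / N z / N z)) *
     (2 * (1 + g) * N z))).
Proof.
move=> z0; have N0 := rho_pow_gt0 g0 z0.
rewrite /mass_field /mass_grad !(powRB1 _ N0) (norm_powR_psi p2).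
congr (_ * (_ + _)).
set m := `|_| `^ _; set E := N z `^ e; set G := q z `^ g.
have H l : z 0 l * (p * (m * u z) * partial l u z * (E / N z) +
      m * u z ^+ 2 * ((e - 1) * (E / N z / N z) * drho_pow g l z)) =
  p * (m * u z) * (E / N z) * (z 0 l * partial l u z) +
  m * u z ^+ 2 * ((e - 1) * (E / N z / N z)) * (z 0 l * drho_pow g l z) by ring.
under eq_bigr do rewrite H.
under [X in (1 + g) * X]eq_bigr do rewrite H.
rewrite !big_split/= -!mulr_sumr sum_xcoord_drho sum_ycoord_drho.
rewrite -(xnorm2_powR1D g0 z); ring.
Qed.

(** This is [|grad u + c u grad rho / rho| ^ 2] in coordinates: [grad rho / rho] has the components
    [|x| ^ (2 g) x / N] and [|x| ^ g y / N]. *)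
Lemma completed_square u z :
  0 <= \sum_i partial (lshift k i) u z ^+ 2 +
    2 * (c * u z * (q z `^ g / N z)) * (\sum_i z 0 (lshift k i) * partial (lshift k i) u z) +
    (c * u z * (q z `^ g / N z)) ^+ 2 * q z +
    q z `^ g * ((1 + g) ^+ 2 * (\sum_j partial (rshift n j) u z ^+ 2) +
      2 * (1 + g) * (c * u z / N z) * (\sum_j z 0 (rshift n j) * partial (rshift n j) u z) +
      (c * u z / N z) ^+ 2 * r z).
Proof.
apply: addr_ge0.
  set b := c * u z * _.
  rewrite (_ : _ + _ = \sum_i (partial (lshift k i) u z + b * z 0 (lshift k i)) ^+ 2).
    by apply: sumr_ge0 => i _; exact: sqr_ge0.
  by rewrite /xnorm2 !mulr_sumr -!big_split/=; apply: eq_bigr => i _; ring.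
apply: mulr_ge0; first exact: powR_ge0.
set b := c * u z / _.
rewrite (_ : _ + _ = \sum_j ((1 + g) * partial (rshift n j) u z + b * z 0 (rshift n j)) ^+ 2).
  by apply: sumr_ge0 => i _; exact: sqr_ge0.
by rewrite /ynorm2 !mulr_sumr -!big_split/=; apply: eq_bigr => i _; ring.
Qed.

Lemma pointwise_hardy u z : z != 0 ->
  c * (c * (p - 1) + a) * (`|u z| `^ p * mass_weight g a z) +
  (- (2 * c * (p - 1) + a) / p * mass_field u z - energy_field u z) <=
  - (psi (u z) * N z `^ e * grushin_op g u z).
Proof.
move=> z0; have N0 := rho_pow_gt0 g0 z0.
have := @rellich_algebra R g c p a (u z) (`|u z| `^ (p - 2)) (N z `^ e) (N z)
  (q z `^ g) (q z) (r z) _ _ _ _ (grushin_op g u z) _ _ _ _ _ _ (completed_square u z).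
rewrite !gt_eqF// !powR_ge0 (ltW p1) xnorm2_powR1D// => /(_ isT isT isT isT isT erefl).
(* [Q] enters the algebra only through this relation, which is the definition of [c]. *)
have QE : p * c + 2 + a = Q by field; rewrite gt_eqF.
cbv zeta; rewrite QE.
rewrite mass_weightE// mass_fieldE// energy_fieldE// (norm_powR_psi p2).
rewrite [q z `^ g * (N z `^ e / N z)]mulrC mulrA.
by rewrite !mulrA.
Qed.

(** [pointwise_hardy] is multiplied by [C ^ (p - 1)] and combined with Young's inequality; after
    multiplication by [p], the share [(p - 1) C ^ p] of the left-hand integrand is absorbed and
    exactly [C ^ p] remains. *)
Lemma pointwise_rellich u z : 0 <= c * (c * (p - 1) + a) -> q z != 0 ->
  (c * (c * (p - 1) + a)) `^ p * rellich_lhs g p theta u z +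
  p * (c * (c * (p - 1) + a)) `^ (p - 1) *
    (- (2 * c * (p - 1) + a) / p * mass_field u z - energy_field u z) <=
  rellich_rhs g p theta u z.
Proof.
move=> C0 qz; have z0 := xnorm2_neq0 qz.
rewrite rellich_lhsE// rellich_rhsE//.
set C := c * _ in C0 *; set F := _ - energy_field u z.
set W := mass_weight g a z; set V := op_weight g p theta z.
have W0 : 0 <= W := mass_weight_ge0 g a z.
have V0 : 0 <= V := op_weight_ge0 g p theta z.
have WV := weight_interpolation g0 theta p1 qz; rewrite -/W -/V in WV.
have := pointwise_hardy u z0; rewrite -/C -/W -/F => H.
clearbody C F W V.
(* Putting [C] into the first factor makes the two factors equal for the extremal function, so
   Young's inequality loses nothing there. *)
have := @young_powR R p (C * (`|u z| * W `^ p^-1)) (`|grushin_op g u z| * V `^ p^-1) p1.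
have uW0 : 0 <= `|u z| * W `^ p^-1 by exact: mulr_ge0 (powR_ge0 _ _).
have LV0 : 0 <= `|grushin_op g u z| * V `^ p^-1 by exact: mulr_ge0 (powR_ge0 _ _).
move=> /(_ (mulr_ge0 C0 uW0) LV0).
rewrite (powRM _ C0 uW0) (powRM _ C0 uW0) !powRM ?powR_ge0// -!powRrM mulVf ?gt_eqF//.
rewrite !powRr1// [p^-1 * (p - 1)]mulrC.
have -> : C `^ (p - 1) * (`|u z| `^ (p - 1) * W `^ ((p - 1) / p)) *
    (`|grushin_op g u z| * V `^ p^-1) =
    C `^ (p - 1) * (`|u z| `^ (p - 1) * `|grushin_op g u z| * (W `^ ((p - 1) / p) * V `^ p^-1)).
  by ring.
rewrite WV => Y.
have K0 : 0 <= C `^ (p - 1) := powR_ge0 _ _.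
have CC : C `^ (p - 1) * C = C `^ p by rewrite mulrC mulr_powRB1.
have pu : `|psi (u z)| = `|u z| `^ (p - 1).
  rewrite normrM (ger0_norm (powR_ge0 _ _)) -powRD1 ?normr_ge0//.
    by congr powR; ring.
  by rewrite gt_eqF// (lt_le_trans (ltrN10 _))// subr_ge0.
have H1 : C * (`|u z| `^ p * W) + F <= `|u z| `^ (p - 1) * `|grushin_op g u z| * N z `^ e.
  apply: (le_trans H); rewrite -pu mulrAC -normrM -mulNr.
  by rewrite ler_wpM2r ?powR_ge0// -[X in _ <= X]normrN; exact: ler_norm.
have H2 := ler_wpM2l K0 H1.
have H3 := le_trans H2 Y.
have {}H3 := ler_wpM2l (ltW p0) H3.
move: H3; rewrite [p * (_ + _)]mulrDr.
have -> : p * ((p - 1) / p * (C `^ p * (`|u z| `^ p * W))) = (p - 1) * (C `^ p * (`|u z| `^ p * W)).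
  by field; rewrite gt_eqF.
have -> : p * (`|grushin_op g u z| `^ p * V / p) = `|grushin_op g u z| `^ p * V.
  by field; rewrite gt_eqF.
rewrite -[X in X - 1]/p -CC => H3; lra.
Qed.

End Inequality.

Section IntegralRV.
Context (R : realType).

(** As [n > 0], the set [{x = 0}] lies in the hyperplane where the first coordinate is 0. *)
Lemma xnorm2_null_set n k : (0 < n)%N ->
  exists A : set ((n + k).-tuple R), [/\ measurable A, lebesgue_tuple R (n + k) A = 0%E &
    forall t, ~ A t -> @xnorm2 R n k (tuple_row t) != 0].
Proof.
case: n => // n _.
have [mA A0] := @lebesgue_tuple_hyperplane R (n + k).
exists [set t : (n.+1 + k).-tuple R | @thead (n + k) R t = 0]; split => // t /= t0.
apply/eqP => /xnorm2_coord0/(_ ord0); rewrite tuple_rowE => H; apply: t0.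
by rewrite -H /thead; congr tnth; apply/val_inj.
Qed.

Lemma le_integral_rV_off_xaxis n k (f h : 'rV[R]_(n + k) -> R) : (0 < n)%N ->
  (forall z, 0 <= f z) -> (forall z, 0 <= h z) ->
  (forall z, xnorm2 z != 0 -> f z <= h z) -> (integral_rV f <= integral_rV h)%E.
Proof.
move=> n0 f0 h0 fh; have [A [mA A0 qA]] := @xnorm2_null_set n k n0.
apply: (ge0_le_integral_off_null mA A0) => t; rewrite ?lee_fin//.
by move=> At; apply: fh; exact: qA.
Qed.

Lemma eq_integral_rV_off_xaxis n k (f h : 'rV[R]_(n + k) -> R) : (0 < n)%N ->
  (forall z, 0 <= f z) -> (forall z, 0 <= h z) ->
  (forall z, xnorm2 z != 0 -> f z = h z) -> integral_rV f = integral_rV h.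
Proof.
move=> n0 f0 h0 fh; apply/eqP; rewrite eq_le.
by apply/andP; split; apply: le_integral_rV_off_xaxis => // z /fh ->.
Qed.

Lemma integral_rVZ m (f : 'rV[R]_m -> R) (L c : R) : continuous f -> vanishes_outside L f ->
  integral_rV (fun z => c * f z) = (c%:E * integral_rV f)%E.
Proof.
move=> cf fL; rewrite /integral_rV; under eq_integral do rewrite EFinM.
by rewrite integralZl//; exact: (continuous_vanishing_integrable cf fL).
Qed.

(** Once a divergence has been added, the left integrand may change sign, whereas the comparison off
    a null set is for nonnegative functions; the positive part bridges the gap. *)
Lemma integral_rV_le_pos m (f : 'rV[R]_m -> R) :
  (integral_rV f <= integral_rV (fun z => Num.max (f z) 0%R))%E.
Proof.
rewrite /integral_rV [leLHS]integralE.
rewrite [X in (_ <= X)%E](_ : _ =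
   (\int[lebesgue_tuple R m]_t (fun t => (f (\row_i tnth t i))%:E)^\+ t)%E).
  by rewrite -[leRHS]sube0 leeB// integral_ge0.
by apply: eq_integral => t _; rewrite funeposE EFin_max.
Qed.

End IntegralRV.

Section RellichInequality.
Context (R : realType) (n k : nat) (g p theta : R).
Hypotheses (n0 : (0 < n)%N) (g0 : 0 <= g) (p2 : 2 <= p).
Local Notation space := 'rV[R]_(n + k).
Implicit Types (z : space) (u : space -> R).
Local Notation Q := (grushin_dim n k g).
Local Notation a := (p * (theta + 2) - 2).
Local Notation c := ((Q - p * (theta + 2)) / p).

Let p0 : 0 < p. Proof. exact: lt_le_trans p2. Qed.

Lemma mass_weight_continuous_off0 b : continuous_off0 (@mass_weight R n k g b).
Proof.
move=> z z0; apply: continuous_at_mul; first exact: xnorm2_powR_continuous.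
exact: rho_pow_powR_continuous_at.
Qed.

Lemma rellich_inequality u : test_function u ->
  0 <= c * (c * (p - 1) + a) ->
  (((c * (c * (p - 1) + a)) `^ p)%:E * integral_rV (rellich_lhs g p theta u) <=
   integral_rV (rellich_rhs g p theta u))%E.
Proof.
move=> tu C0.
have [su _ _] := test_function_support tu.
have [cu _ _ _ _] := test_function_smooth tu.
have pn0 : p != 0 by rewrite gt_eqF.
have u00 : u 0 = 0 := nbhs_singleton su.2.
have -> : rellich_lhs g p theta u = fun z => `|u z| `^ p * mass_weight g a z.
  apply/funext => z; have [->|z0] := eqVneq z 0; last exact: rellich_lhsE.
  by rewrite /rellich_lhs u00 normr0 powR0// !mul0r.
set l := fun z => _.
have sl : supported l.
  apply: supportedMl.
  by apply: (@supported_comp _ _ (fun t => `|t| `^ p)); rewrite ?normr0 ?powR0.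
have cl : continuous l.
  apply: supported_continuous => // z z0; apply: continuous_at_mul; last exact: mass_weight_continuous_off0.
  apply: (continuous_comp (f := u) (g := fun t => `|t| `^ p)); first exact: cu.
  by apply: norm_powR_continuous; rewrite ltW.
have [[L lL] _] := sl.
set e := - a / (2 + 2 * g).
have F1 := null_integral_energy g0 p2 tu e.
have F2 := null_integral_mass g0 p2 tu e.
set K := c * (c * (p - 1) + a).
have := null_integralZ (p * K `^ (p - 1))
  (null_integralD (null_integralZ (- (2 * c * (p - 1) + a) / p) F2) (null_integralZ (-1) F1)).
set F := fun z => _.
move=> [cF [L' FL] IF].
rewrite -(integral_rVZ _ cl lL).
have LM : L <= Num.max L L' by rewrite le_max lexx.
have LM' : L' <= Num.max L L' by rewrite le_max lexx orbT.
(* Only the sum with the divergence lies below the right-hand integrand, so [F], of integral 0, is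
   added first. *)
have -> : integral_rV (fun z => K `^ p * l z) = integral_rV (fun z => K `^ p * l z + F z).
  rewrite (@integral_rVD _ _ _ _ (Num.max L L')) ?IF ?adde0//.
  - by move=> z; apply: (@continuous_at_mulc _ _ l); exact: cl.
  - by apply: (vanishes_outside_le LM) => z i /lL ->; rewrite mulr0.
  - exact: vanishes_outside_le FL.
apply: le_trans (integral_rV_le_pos _) _.
apply: le_integral_rV_off_xaxis => // z; first by rewrite le_max lexx orbT.
  exact: rellich_rhs_ge0.
move=> qz; rewrite ge_max rellich_rhs_ge0 andbT.
have := pointwise_rellich g0 p2 u C0 qz.
rewrite rellich_lhsE ?xnorm2_neq0// -/K; apply: le_trans.
by rewrite lerD2l /F mulN1r.
Qed.

End RellichInequality.

(** * Functions of the homogeneous norm *)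

Section Composite.
Context (R : realType) (n k : nat) (g : R).
Hypothesis g0 : 0 <= g.
Local Notation space := 'rV[R]_(n + k).
Implicit Types (z : space).
Local Notation q := (@xnorm2 R n k).
Local Notation r := (@ynorm2 R n k).
Local Notation N := (@rho_pow R n k g).
Local Notation Q := (grushin_dim n k g).
Local Notation ex i := (delta_mx 0 (lshift k i) : space).
Local Notation ey j := (delta_mx 0 (rshift n j) : space).

Section General.
Variables A A1 A2 F F1 F2 : R -> R.
Hypotheses (dA : forall t : R, 0 < t -> is_derive t 1 A (A1 t))
  (dA1 : forall t : R, 0 < t -> is_derive t 1 A1 (A2 t))
  (dF : forall t : R, 0 < t -> is_derive t 1 F (F1 t))
  (dF1 : forall t : R, 0 < t -> is_derive t 1 F1 (F2 t))
  (A0 : forall t, 0 < t -> 0 < A t).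
Let M z := A (q z) + r z.
Let f z := F (M z).

Let M0 z : 0 < q z -> 0 < M z.
Proof. by move=> qz; rewrite ltr_pwDl ?A0 ?ynorm2_ge0. Qed.

Let dM_x z i : 0 < q z -> is_derive z (ex i) M (A1 (q z) * (2 * z 0 (lshift k i))).
Proof.
move=> qz; apply: is_derive_eq.
  apply: (is_derive_addf _ (is_derive_ynorm2_x z i)).
  exact: (is_derive_compf A q (is_derive_xnorm2_x z i) (dA qz)).
by rewrite addr0.
Qed.

Let dM_y z j : is_derive z (ey j) M (2 * z 0 (rshift n j)).
Proof.
apply: is_derive_eq.
  exact: (is_derive_addf (is_derive_xnorm2_comp_y A z j) (is_derive_ynorm2_y z j)).
by rewrite add0r.
Qed.

Let near_q z : 0 < q z -> \forall y \near z, 0 < q y.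
Proof.
by move=> qz; have := @xnorm2_continuous R n k z => /(_ _ (lt_nbhsr qz)).
Qed.

Let px z i : 0 < q z ->
  partial (lshift k i) f z = F1 (M z) * (A1 (q z) * (2 * z 0 (lshift k i))).
Proof.
move=> qz; rewrite /partial.
by have [_ ->] := is_derive_compf F M (dM_x i qz) (dF (M0 qz)).
Qed.

Let py z j : 0 < q z ->
  partial (rshift n j) f z = F1 (M z) * (2 * z 0 (rshift n j)).
Proof.
move=> qz; rewrite /partial.
by have [_ ->] := is_derive_compf F M (dM_y z j) (dF (M0 qz)).
Qed.

Let pxx z i : 0 < q z -> partial (lshift k i) (partial (lshift k i) f) z =
  F2 (M z) * (4 * A1 (q z) ^+ 2 * z 0 (lshift k i) ^+ 2) +
  F1 (M z) * (4 * A2 (q z) * z 0 (lshift k i) ^+ 2 + 2 * A1 (q z)).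
Proof.
move=> qz; rewrite /partial.
rewrite (@near_eq_derive _ _ _ _ (fun z => F1 (M z) * (A1 (q z) * (2 * z 0 (lshift k i))))).
  have [_ ->] := is_derive_mulf
    (is_derive_compf F1 M (dM_x i qz) (dF1 (M0 qz)))
    (is_derive_mulf (is_derive_compf A1 q (is_derive_xnorm2_x z i) (dA1 qz))
       (is_derive_mulcf 2 (is_derive_coord z (ex i) (lshift k i)))).
  by rewrite mxE !eqxx /=; ring.
by apply: filterS (near_q qz) => y qy; exact: px.
Qed.

Let pyy z j : 0 < q z -> partial (rshift n j) (partial (rshift n j) f) z =
  F2 (M z) * (4 * z 0 (rshift n j) ^+ 2) + F1 (M z) * 2.
Proof.
move=> qz; rewrite /partial.
rewrite (@near_eq_derive _ _ _ _ (fun z => F1 (M z) * (2 * z 0 (rshift n j)))).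
  have [_ ->] := is_derive_mulf
    (is_derive_compf F1 M (dM_y z j) (dF1 (M0 qz)))
    (is_derive_mulcf 2 (is_derive_coord z (ey j) (rshift n j))).
  by rewrite mxE !eqxx /=; ring.
by apply: filterS (near_q qz) => y qy; exact: py.
Qed.

(** A general [A] covers both [t ^ (1 + g)], which yields [rho_pow], and its flat modification in
    [rho_approx]. *)
Lemma grushin_op_comp z : 0 < q z ->
  grushin_op g (fun z => F (A (q z) + r z)) z =
  F2 (A (q z) + r z) * (4 * A1 (q z) ^+ 2 * q z + 4 * (1 + g) ^+ 2 * q z `^ g * r z) +
  F1 (A (q z) + r z) *
    (2 * n%:R * A1 (q z) + 4 * A2 (q z) * q z + 2 * k%:R * (1 + g) ^+ 2 * q z `^ g).
Proof.
move=> qz; rewrite /grushin_op enorm_lsubmx_powR -/f.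
rewrite (eq_bigr _ (fun i _ => pxx i qz)) (eq_bigr _ (fun j _ => pyy j qz)).
rewrite !big_split/= -!mulr_sumr big_split/= -!mulr_sumr -/(q z) -/(r z).
rewrite !sumr_const !card_ord /M; ring.
Qed.

End General.

(** The identity [|x| ^ (2 g) |x| ^ 2 + |y| ^ 2 = N] eliminates [x] and [y] up to the common factor
    [|x| ^ (2 g)], leaving an Euler operator in [N]. *)
Lemma grushin_op_radial (F F1 F2 : R -> R) z :
  (forall t : R, 0 < t -> is_derive t 1 F (F1 t)) ->
  (forall t : R, 0 < t -> is_derive t 1 F1 (F2 t)) -> q z != 0 ->
  grushin_op g (fun z => F (N z)) z =
  2 * (1 + g) * q z `^ g *
    (2 * (1 + g) * N z * F2 (N z) + (Q + 2 * g) * F1 (N z)).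
Proof.
move=> dF dF1 qz; have q0 := xnorm2_gt0 qz.
have dA (t : R) : 0 < t -> is_derive t 1 (fun t => t `^ (1 + g)) ((1 + g) * t `^ g).
  move=> t0; apply: is_derive_eq (is_derive_powR _ t0) _.
  by rewrite [1 + g - 1]addrAC subrr add0r.
have dA1 (t : R) : 0 < t ->
    is_derive t 1 (fun t => (1 + g) * t `^ g) ((1 + g) * (g * t `^ (g - 1))).
  by move=> t0; apply: is_derive_mulcf; exact: is_derive_powR.
rewrite (grushin_op_comp dA dA1 dF dF1 _ q0); last by move=> t; exact: powR_gt0.
rewrite -[_ + r z]/(N z).
rewrite (_ : 4 * ((1 + g) * (g * q z `^ (g - 1))) * q z =
   4 * ((1 + g) * (g * (q z `^ (g - 1) * q z)))); last by ring.
rewrite xnorm2_powRB1// /grushin_dim; move: (F1 (N z)) (F2 (N z)) => f1 f2.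
rewrite -(xnorm2_powR1D g0 z); ring.
Qed.

End Composite.

(** * The extremal power *)

Section Extremal.
Context (R : realType) (n k : nat) (g p theta : R).
Hypotheses (g0 : 0 <= g) (p2 : 2 <= p).
Local Notation space := 'rV[R]_(n + k).
Implicit Types (z : space).
Local Notation q := (@xnorm2 R n k).
Local Notation N := (@rho_pow R n k g).
Local Notation Q := (grushin_dim n k g).
Local Notation a := (p * (theta + 2) - 2).
Local Notation c := ((Q - p * (theta + 2)) / p).
Local Notation C0 := (c * (c * (p - 1) + a)).

Let p0 : 0 < p. Proof. exact: lt_le_trans p2. Qed.
Let g1 : 0 < 1 + g. Proof. by rewrite ltr_pwDl. Qed.
Let g2 : 0 < 2 + 2 * g. Proof. by rewrite -[X in X + _]mulr1 -mulrDr mulr_gt0. Qed.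

(** [rho ^ (- c) = N ^ s] satisfies [L N ^ s = - C0 |x| ^ (2 g) N ^ (s - 1)], since
    [2 (1 + g) s = - c] in the Euler operator; after that only exponents of [q] and [N] have to be
    compared. *)
Lemma extremal_pointwise (b : R) z : 0 <= C0 -> q z != 0 ->
  let v := fun z => b * grushin_rho g z `^ ((p * (theta + 2) - Q) / p) in
  C0 `^ p * rellich_lhs g p theta v z = rellich_rhs g p theta v z.
Proof.
move=> C00 qz; cbv zeta; have q0 := xnorm2_gt0 qz.
have z0 := xnorm2_neq0 qz; have N0 := rho_pow_gt0 g0 z0.
set s := - c / (2 + 2 * g).
have -> : (fun z => b * grushin_rho g z `^ ((p * (theta + 2) - Q) / p)) =
    (fun z => (fun t => b * t `^ s) (N z)).
  apply/funext => y; rewrite grushin_rhoE -powRrM; congr (_ * _ `^ _).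
  by rewrite /s; field; rewrite !gt_eqF.
rewrite rellich_lhsE// rellich_rhsE//.
have dF (t : R) : 0 < t -> is_derive t 1 (fun t => b * t `^ s) (b * (s * t `^ (s - 1))).
  by move=> t0; apply: is_derive_mulcf; exact: is_derive_powR.
have dF1 (t : R) : 0 < t -> is_derive t 1 (fun t => b * (s * t `^ (s - 1)))
    (b * (s * ((s - 1) * t `^ (s - 1 - 1)))).
  by move=> t0; do 2 apply: is_derive_mulcf; exact: is_derive_powR.
rewrite (grushin_op_radial g0 dF dF1 qz) (powRB1 _ N0).
have -> : 2 * (1 + g) * q z `^ g *
    (2 * (1 + g) * N z * (b * (s * ((s - 1) * (N z `^ (s - 1) / N z)))) +
     (Q + 2 * g) * (b * (s * N z `^ (s - 1)))) =
   - (C0 * b) * (q z `^ g * N z `^ (s - 1)).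
  by rewrite /s; field; rewrite !gt_eqF.
have -> : `|- (C0 * b) * (q z `^ g * N z `^ (s - 1))| =
    C0 * (`|b| * (q z `^ g * N z `^ (s - 1))).
  rewrite mulNr normrN (normrM (C0 * b)) (normrM C0) (normrM (q z `^ g)).
  by rewrite !(ger0_norm (powR_ge0 _ _)) (ger0_norm C00) !mulrA.
rewrite (normrM b) (ger0_norm (powR_ge0 _ _)).
rewrite (powRM _ C00) ?mulr_ge0 ?powR_ge0// -[in RHS]mulrA; congr (_ * _).
rewrite !powRM ?mulr_ge0 ?powR_ge0//.
rewrite -!mulrA; congr (_ * _).
rewrite /mass_weight /op_weight !(powR_expR _ q0) !(powR_expR _ N0).
rewrite -!expRM -!expRD -!expRM -!expRD; congr expR.
by rewrite /s; field; rewrite !gt_eqF.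
Qed.

End Extremal.

(** * Convergence of integrals with a common bound and support *)

Section BoundedConvergence.
Context (R : realType) (m : nat).
Implicit Types f : 'rV[R]_m -> R.

Definition rv_measurable f := measurable_fun [set: m.-tuple R] (f \o @tuple_row R m).

Lemma rv_measurable_comp (F : R -> R) f : measurable_fun setT F -> rv_measurable f ->
  rv_measurable (fun z => F (f z)).
Proof. by move=> mF mf; exact: (measurableT_comp mF mf). Qed.

Lemma rv_measurable_continuous f : continuous f -> rv_measurable f.
Proof. exact: measurable_continuous_row. Qed.

Lemma rv_measurableM f h : rv_measurable f -> rv_measurable h ->
  rv_measurable (fun z => f z * h z).
Proof. exact: measurable_funM. Qed.

Lemma rv_measurableD f h : rv_measurable f -> rv_measurable h ->
  rv_measurable (fun z => f z + h z).
Proof. exact: measurable_funD. Qed.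

Lemma rv_measurable_cst (c : R) : rv_measurable (fun=> c).
Proof. exact: measurable_cst. Qed.

Definition rv_integral f : R := fine (integral_rV f).

Lemma bounded_rv_integralE f L M : rv_measurable f -> vanishes_outside L f ->
  (forall z, `|f z| <= M) -> integral_rV f = (rv_integral f)%:E.
Proof.
move=> mf fL fM; have If := bounded_rV_integrable mf fL fM.
rewrite /rv_integral fineK//.
exact: (integrable_fin_num _ If).
Qed.

Lemma bounded_convergence (f_ : nat -> 'rV[R]_m -> R) f (L M : R) :
  (forall j, rv_measurable (f_ j)) -> (forall j, vanishes_outside L (f_ j)) ->
  (forall j z, `|f_ j z| <= M) -> (forall z, f_ j z @[j --> \oo] --> f z) ->
  [/\ rv_measurable f, vanishes_outside L f, forall z, `|f z| <= M &
   rv_integral (f_ j) @[j --> \oo] --> rv_integral f].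
Proof.
move=> mf fL fM cf.
have mlim : rv_measurable f.
  apply: (@measurable_fun_cvg _ _ _ setT (fun j => f_ j \o @tuple_row R m)) => //.
  by move=> t _; exact: cf.
have lL : vanishes_outside L f.
  move=> z i Hz; have := cf z; rewrite (_ : f_^~ z = (fun=> 0)).
    by move/cvg_lim => <-//; rewrite lim_cst.
  by apply/funext => j; exact: (fL j z i).
have lM z : `|f z| <= M.
  have /= H := cvg_norm (cf z).
  by apply: cvgr_to_le (H _) _; apply: nearW => j; exact: fM.
split => //.
have [mC lC] := @lebesgue_tuple_cube R m 0 `|L| (normr_ge0 _).
set C := [set t | _] in mC lC.
have iC : (lebesgue_tuple R m).-integrable setT (fun t => (M%:E * (\1_C t)%:E)%E).
  apply: integrableZl => //; apply/integrableP; split; first exact/measurable_EFinP.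
  rewrite (eq_integral (fun t => (\1_C t)%:E)); last first.
    by move=> t _; rewrite gee0_abs// lee_fin.
  by rewrite integral_indic// setIT [X in (X < _)%E]lC ltry.
have cE t : (f_ j (tuple_row t))%:E @[j --> \oo] --> (f (tuple_row t))%:E.
  by apply: cvg_EFin; [exact: nearW|exact: cf].
have D2 (t : m.-tuple R) j :
    (`|(f_ j (tuple_row t))%:E| <= M%:E * (\1_C t)%:E)%E.
  rewrite lee_fin indicE; have [tC|/negP tC] := boolP (t \in C); first by rewrite mulr1.
  have [i Hi] : exists i, ~ (`|tnth t i - (0 : 'rV[R]_m) 0 i| <= `|L|).
    by apply/existsNP => H; apply: tC; rewrite inE.
  rewrite (fL j _ i) ?normr0 ?mulr0// tuple_rowE; move/negP: Hi.
  by rewrite mxE subr0 -ltNge; apply: le_lt_trans; exact: ler_norm.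
have [_ _ H] := @dominated_convergence _ _ R (lebesgue_tuple R m) setT measurableT
  (fun j => EFin \o f_ j \o @tuple_row R m) (EFin \o f \o @tuple_row R m) _
  (fun j => (measurable_EFinP _ _).2 (mf j)) ((measurable_EFinP _ _).2 mlim)
  (aeW _ (fun t _ => cE t)) iC (aeW _ (fun t j _ => D2 t j)).
by apply: fine_cvg; rewrite -(bounded_rv_integralE mlim lL lM).
Qed.

End BoundedConvergence.

(** * The dilation-invariant integral and its scaling *)

Section Radial.
Context (R : realType) (n k : nat) (g : R).
Hypotheses (n0 : (0 < n)%N) (g0 : 0 <= g).
Local Notation space := 'rV[R]_(n + k).
Implicit Types (z : space).
Local Notation q := (@xnorm2 R n k).
Local Notation r := (@ynorm2 R n k).
Local Notation N := (@rho_pow R n k g).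
Local Notation Q := (grushin_dim n k g).

Let g1 : 0 < 1 + g. Proof. by rewrite ltr_pwDl. Qed.
Let g2 : 0 < 2 + 2 * g. Proof. by rewrite -[X in X + _]mulr1 -mulrDr mulr_gt0. Qed.

Lemma rv_measurable_powR (f : space -> R) b : rv_measurable f ->
  rv_measurable (fun z => f z `^ b).
Proof. by move=> mf; exact: (rv_measurable_comp (@measurable_powR R b) mf). Qed.

Lemma rv_measurable_norm (f : space -> R) : rv_measurable f ->
  rv_measurable (fun z => `|f z|).
Proof. by move=> mf; apply: (rv_measurable_comp _ mf); exact: normr_measurable. Qed.

Lemma rv_measurable_xnorm2 : rv_measurable q.
Proof. by apply: rv_measurable_continuous; exact: xnorm2_continuous. Qed.

Lemma rv_measurable_rho_pow : rv_measurable N.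
Proof. by apply: rv_measurable_continuous; exact: rho_pow_continuous. Qed.

Lemma rv_measurable_mass_weight b : rv_measurable (@mass_weight R n k g b).
Proof.
apply: rv_measurableM; apply: rv_measurable_powR.
  exact: rv_measurable_xnorm2.
exact: rv_measurable_rho_pow.
Qed.

Lemma grushin_dim_gt0 : 0 < Q.
Proof. by rewrite ltr_pwDl ?ltr0n// mulr_ge0// ltW. Qed.

(** Because [B >= 1], passing to the square of the coordinate and to the power [1 + g] only
    increases it. This bounds the sublevel sets of [N]. *)
Lemma rho_pow_coord_lt (B : R) z l : 1 <= B -> B < `|z 0 l| -> B < N z.
Proof.
move=> B1 Bz; have B2 : B < z 0 l ^+ 2.
  rewrite -real_normK ?num_real// expr2 (lt_le_trans Bz)// ler_peMl//.
  by rewrite (le_trans B1)// ltW.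
case: (split_ordP l) => [i li|j lj].
  rewrite li in B2; have qB := lt_le_trans B2 (coord_sqr_le z i).
  rewrite (lt_le_trans qB)// (@le_trans _ _ (q z `^ (1 + g)))//.
    by apply: le1r_powR; rewrite ?lerDl// (le_trans B1)// ltW.
  by rewrite lerDl ynorm2_ge0.
rewrite lj in B2; rewrite (lt_le_trans B2)// (@le_trans _ _ (r z))//.
  by rewrite /ynorm2 (bigD1 j)//= lerDl sumr_ge0// => i _; exact: sqr_ge0.
by rewrite lerDr powR_ge0.
Qed.

Lemma rho_pow0 : N 0 = 0.
Proof. by apply/eqP; rewrite rho_pow_eq0. Qed.

Lemma rho_pow_near0 (d : R) : 0 < d -> \forall z \near (0 : space), N z < d.
Proof.
move=> d0; have := @rho_pow_continuous R n k g g0 0 => /(_ [set x | x < d]).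
by apply; rewrite rho_pow0; exact: lt_nbhsl.
Qed.

(** For the parameter [Q - 2] the weight is [rho ^ (- Q) |grad rho| ^ 2], so
    [rv_integral (radial xi)] is the [J (xi)] of the overview. *)
Definition radial (xi : R -> R) z : R := xi (ln (N z)) * mass_weight g (Q - 2) z.

Definition vanishes_beyond (L : R) (xi : R -> R) := forall x, L < `|x| -> xi x = 0.

Lemma log_rho_pow_supported (xi : R -> R) (b L : R) : vanishes_beyond L xi -> b != 0 ->
  supported (fun z => xi (ln (N z)) * N z `^ b).
Proof.
move=> xiL b0; split.
  exists (1 + expR L) => z l /rho_pow_coord_lt H.
  have {}H : 1 + expR L < N z by apply: H; rewrite lerDl expR_ge0.
  have N0 : 0 < N z by rewrite (lt_trans _ H)// ltr_pwDl// expR_ge0.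
  rewrite xiL ?mul0r//; apply: (lt_le_trans _ (ler_norm _)).
  by rewrite -ltr_expR lnK// (lt_trans _ H)// ltrDr.
apply: filterS (rho_pow_near0 (expR_gt0 (- L))) => z Hz.
(* At the origin [ln 0 = 0] by convention and [xi 0] may be nonzero; the product vanishes because of
   [0 ^ b = 0], whence the condition on [b]. *)
have [->|z0] := eqVneq z 0; first by rewrite rho_pow0 powR0// mulr0.
rewrite xiL ?mul0r// -normrN; apply: (lt_le_trans _ (ler_norm _)).
by rewrite ltrNr -ltr_expR lnK// posrE rho_pow_gt0.
Qed.

Lemma log_rho_pow_continuous_off0 (xi : R -> R) : continuous xi ->
  continuous_off0 (fun z => xi (ln (N z))).
Proof.
move=> cxi z z0.
apply: (continuous_comp (f := fun z => ln (N z)) (g := xi)); last exact: cxi.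
apply: (continuous_comp (f := N) (g := @ln R)); first exact: rho_pow_continuous.
by apply: continuous_ln; exact: rho_pow_gt0.
Qed.

Lemma mass_exponent_neq0 : - (Q - 2 + 2 + 2 * g) / (2 + 2 * g) != 0.
Proof.
apply: mulf_neq0; last by rewrite invr_eq0 gt_eqF.
rewrite subrK oppr_eq0 gt_eqF//.
by rewrite ltr_pwDl ?grushin_dim_gt0// mulr_ge0.
Qed.

Lemma radial_supported xi L : vanishes_beyond L xi -> supported (radial xi).
Proof.
move=> xiL; rewrite (_ : radial xi = fun z => q z `^ g *
   (xi (ln (N z)) * N z `^ (- (Q - 2 + 2 + 2 * g) / (2 + 2 * g)))).
  apply: supportedMr; apply: log_rho_pow_supported xiL _; exact: mass_exponent_neq0.
by apply/funext => z; rewrite /radial /mass_weight mulrCA.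
Qed.

Lemma radial_continuous xi L : continuous xi -> vanishes_beyond L xi ->
  continuous (radial xi).
Proof.
move=> cxi xiL; apply: supported_continuous (radial_supported xiL) _ => z z0.
apply: continuous_at_mul; first exact: log_rho_pow_continuous_off0.
exact: mass_weight_continuous_off0.
Qed.

Lemma radial_integralE xi L : continuous xi -> vanishes_beyond L xi ->
  integral_rV (radial xi) = (rv_integral (radial xi))%:E.
Proof.
move=> cxi xiL; have cr := radial_continuous cxi xiL.
have [[L' rL] _] := radial_supported xiL.
have [M rM] := continuous_vanishing_bounded cr rL.
exact: (bounded_rv_integralE (rv_measurable_continuous cr) rL rM).
Qed.

(** The field is the generator of the dilations times [chi (ln N) N ^ b |x| ^ (2 g)]. The exponent
    [b] gives [N ^ b |x| ^ (2 g)] the degree [- Q]; the generator with such a weight is divergence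
    free, and only the derivative of [chi] survives. *)
Lemma null_integral_log (chi dchi : R -> R) L :
  (forall x : R, is_derive x 1 chi (dchi x)) -> continuous dchi ->
  vanishes_beyond L chi -> vanishes_beyond L dchi ->
  null_integral (radial dchi).
Proof.
move=> dc cdc chiL dchiL.
have bn0 := mass_exponent_neq0; set b := _ / _ in bn0.
have cchi : continuous chi.
  by move=> x; apply/differentiable_continuous/derivable1_diffP; have [] := dc x.
pose D l z := dchi (ln (N z)) * ((N z)^-1 * drho_pow g l z) * N z `^ b +
  chi (ln (N z)) * (b * N z `^ (b - 1) * drho_pow g l z).
have cN z e : z != 0 -> {for z, continuous (fun z => N z `^ e)}.
  by move=> z0; exact: rho_pow_powR_continuous_at.
have bn1 : b - 1 != 0.
  rewrite subr_eq0 lt_eqF// (@lt_trans _ _ 0)// /b.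
  rewrite pmulr_llt0 ?invr_gt0// subrK oppr_lt0.
  by rewrite ltr_pwDl ?grushin_dim_gt0// mulr_ge0.
have := @null_integral_radial R n k g g0 (fun z => chi (ln (N z)) * N z `^ b) D.
have H1 : supported (fun z => chi (ln (N z)) * N z `^ b).
  exact: log_rho_pow_supported chiL _.
have H2 l : supported (D l).
  apply: supportedD.
    rewrite (_ : (fun z => _) = fun z => ((N z)^-1 * drho_pow g l z) * (dchi (ln (N z)) * N z `^ b)).
      by apply: supportedMr; exact: log_rho_pow_supported dchiL _.
    by apply/funext => z; rewrite mulrAC mulrC.
  rewrite (_ : (fun z => _) = fun z => (b * drho_pow g l z) * (chi (ln (N z)) * N z `^ (b - 1))).
    by apply: supportedMr; exact: log_rho_pow_supported chiL _.
  by apply/funext => z; ring.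
have H3 l z : z != 0 -> is_derive z (delta_mx 0 l) (fun z => chi (ln (N z)) * N z `^ b) (D l z).
  move=> z0; apply: is_derive_mulf; last exact: is_derive_rho_pow_powR.
  apply: (is_derive_compf chi (fun z => ln (N z)) _ (dc _)).
  apply: (is_derive_compf (@ln R) N (is_derive_rho_pow g0 z l)).
  by apply: is_derive1_ln; exact: rho_pow_gt0.
have H4 : continuous_off0 (fun z => chi (ln (N z)) * N z `^ b).
  move=> z z0; apply: continuous_at_mul; last exact: cN.
  exact: log_rho_pow_continuous_off0.
have H5 l : continuous_off0 (D l).
  move=> z z0; apply: continuous_at_add; apply: continuous_at_mul.
  - apply: continuous_at_mul; first exact: log_rho_pow_continuous_off0.
    apply: continuous_at_mul; last exact: drho_pow_continuous.
    rewrite (_ : (fun z => (N z)^-1) = (fun z => N z `^ (-1))); first exact: cN.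
    by apply/funext => y; rewrite powR_inv1// rho_pow_ge0.
  - exact: cN.
  - exact: log_rho_pow_continuous_off0.
  - apply: continuous_at_mul; last exact: drho_pow_continuous.
    by apply: continuous_at_mulc; exact: cN.
(* [N] is homogeneous of degree [2 (1 + g)], so this number is the derivative of [ln N] along the
   dilations. *)
move=> /(_ H1 H2 H3 H4 H5) /(null_integralZ (2 * (1 + g))^-1).
congr null_integral; apply/funext => z.
have [->|z0] := eqVneq z 0.
  rewrite (nbhs_singleton (radial_supported dchiL).2).
  rewrite (nbhs_singleton H1.2) mulr0 add0r !big1 ?mulr0 ?addr0 ?mulr0// => i _;
    by rewrite (nbhs_singleton (H2 _).2) mulr0.
have N0 := rho_pow_gt0 g0 z0.
rewrite /D /radial /mass_weight -/b (powRB1 _ N0).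
set x := dchi _; set y := chi _; set P := N z `^ b; set G := q z `^ g.
have E l : z 0 l * (x * ((N z)^-1 * drho_pow g l z) * P +
    y * (b * (P / N z) * drho_pow g l z)) =
   (x * P / N z + y * b * P / N z) * (z 0 l * drho_pow g l z) by ring.
under eq_bigr do rewrite E.
under [X in (1 + g) * X]eq_bigr do rewrite E.
rewrite -!mulr_sumr sum_xcoord_drho sum_ycoord_drho -/G.
have -> : r z = N z - G * q z by rewrite -(xnorm2_powR1D g0 z) -/G; ring.
rewrite /b; field; rewrite !gt_eqF//.
Qed.

End Radial.

Section Primitive.
Context (R : realType).
Local Notation mu := (@lebesgue_measure R).

Lemma continuous_vanishing_integrable1 (xi : R -> R) (L : R) : continuous xi ->
  vanishes_beyond L xi -> mu.-integrable setT (EFin \o xi).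
Proof.
move=> cxi xiL.
have I1 : mu.-integrable `[- L, L] (EFin \o xi).
  apply: continuous_compact_integrable; first exact: segment_compact.
  exact: continuous_subspaceT.
rewrite integrable_mkcond in I1 => //.
apply: eq_integrable I1 => // x _; rewrite patchE; case: ifPn => //.
rewrite notin_setE/= in_itv/= => /negP; rewrite -ler_norml -ltNge => /xiL /= ->//.
Qed.

Lemma compact_primitive (xi : R -> R) (L : R) : continuous xi -> vanishes_beyond L xi ->
  exists X : R -> R, exists T : R, [/\ forall x : R, is_derive x 1 X (xi x),
    forall x, x < - L -> X x = 0 & forall x, L < x -> X x = T].
Proof.
move=> cxi xiL; have I := continuous_vanishing_integrable1 cxi xiL.
pose X (x : R) : R := (\int[mu]_(t in `]-oo, x]) xi t)%R.
exists X, (\int[mu]_t xi t)%R; split => x.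
- have [] := @continuous_FTC1 R xi -oo%O x (x + 1) _ _ _ (cxi x).
  + by rewrite ltrDl.
  + exact: integrableS I.
  + by rewrite ltNyr.
  + by move=> dX X'; split => //; rewrite -derive1E.
- move=> xL; rewrite /X /Rintegral integral0_eq// => t /=; rewrite in_itv/= => tx.
  rewrite xiL// -normrN (lt_le_trans _ (ler_norm _))// ltrNr.
  exact: le_lt_trans xL.
- move=> xL; rewrite /X /Rintegral; congr fine; rewrite integral_mkcond.
  apply: eq_integral => t _; rewrite patchE; case: ifPn => //.
  rewrite notin_setE/= in_itv/= => /negP; rewrite -ltNge => xt.
  by rewrite xiL// (lt_le_trans _ (ler_norm _))// (lt_trans xL).
Qed.

End Primitive.

Section RadialScaling.
Context (R : realType) (n k : nat) (g : R).
Hypotheses (n0 : (0 < n)%N) (g0 : 0 <= g).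
Local Notation space := 'rV[R]_(n + k).
Local Notation rad := (@radial R n k g).

(* The difference of the two integrands is the divergence of the field
   [chi (ln rho_pow)] times the dilation field, where [chi x = X (kap x) - X x] for
   a primitive [X] of [xi]; [X] need not have compact support, but [chi] does. *)
Lemma radial_integral_scale (xi : R -> R) (L kap : R) : continuous xi -> 0 <= L ->
  vanishes_beyond L xi -> 0 < kap -> kap <= 1 ->
  kap * rv_integral (rad (fun x => xi (kap * x))) = rv_integral (rad xi).
Proof.
move=> cxi L0 xiL k0 k1.
have [X [T [dX X0 XT]]] := compact_primitive cxi xiL.
pose L' := L / kap.
have LL' : L <= L' by rewrite ler_pdivlMr// ler_piMr.
have kL x : L' < x -> L < kap * x by rewrite ltr_pdivrMr// mulrC.
have ckap : continuous (fun x => xi (kap * x)).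
  by move=> x; apply: (continuous_comp (f := fun x => kap * x)); [exact: mulrl_continuous|exact: cxi].
have vkap : vanishes_beyond L' (fun x => xi (kap * x)).
  by move=> x /kL H; apply: xiL; rewrite normrM (gtr0_norm k0).
have vxi : vanishes_beyond L' xi by move=> x H; apply: xiL; exact: le_lt_trans H.
pose chi x := X (kap * x) + - X x.
pose dchi x := kap * xi (kap * x) + -1 * xi x.
have dc (x : R) : is_derive x 1 chi (dchi x).
  have D1 : is_derive x 1 (fun x => X (kap * x)) (xi (kap * x) * (kap * 1)).
    exact: (is_derive_compf X (fun x => kap * x)
      (is_derive_mulcf kap (is_derive_id x 1)) (dX _)).
  have D2 : is_derive x 1 (fun x => - X x) (- xi x) by exact: is_deriveN.
  apply: (is_derive_eq (is_derive_addf D1 D2)).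
  by rewrite /dchi mulr1 mulN1r [_ * kap]mulrC.
have cdc : continuous dchi.
  move=> x; apply: (@continuous_at_add _ _ (fun x => kap * xi (kap * x))
    (fun x => -1 * xi x)).
    by apply: (@continuous_at_mulc _ _ (fun x => xi (kap * x))); exact: ckap.
  by apply: (@continuous_at_mulc _ _ xi); exact: cxi.
(* Beyond [L' = L / kap >= L] both terms of [chi] have reached the same constant, [T] on the right
   and 0 on the left. *)
have vc : vanishes_beyond L' chi.
  move=> x; have [x0|x0] := ltP 0 x.
    rewrite gtr0_norm// => H; rewrite /chi (XT _ (kL _ H)) (XT x) ?subrr//.
    exact: le_lt_trans H.
  rewrite ler0_norm// => H.
  rewrite /chi (X0 (kap * x)) ?(X0 x) ?subrr//.
    by rewrite ltrNr; exact: le_lt_trans H.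
  by rewrite ltrNr -mulrN; exact: kL.
have vdc : vanishes_beyond L' dchi.
  by move=> x H; rewrite /dchi (vkap x H) (vxi x H) !mulr0 addr0.
have [_ _ E] := @null_integral_log R n k g n0 g0 chi dchi L' dc cdc vc vdc.
have c1 := @radial_continuous R n k g n0 g0 _ _ ckap vkap.
have c2 := @radial_continuous R n k g n0 g0 _ _ cxi vxi.
have [[M1 v1] _] := @radial_supported R n k g n0 g0 _ _ vkap.
have [[M2 v2] _] := @radial_supported R n k g n0 g0 _ _ vxi.
have M1M : M1 <= Num.max M1 M2 by rewrite le_max lexx.
have M2M : M2 <= Num.max M1 M2 by rewrite le_max lexx orbT.
have E2 : rad dchi = (fun z => kap * rad (fun x => xi (kap * x)) z + -1 * rad xi z).
  by apply/funext => z; rewrite /radial /dchi mulrDl !mulrA.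
move: E; rewrite E2 (@integral_rVD _ _ _ _ (Num.max M1 M2)).
- rewrite (integral_rVZ _ c1 v1) (integral_rVZ _ c2 v2).
  rewrite (@radial_integralE R n k g n0 g0 _ _ ckap vkap) (@radial_integralE R n k g n0 g0 _ _ cxi vxi).
  by rewrite -!EFinM -EFinD => -[] /eqP; rewrite mulN1r subr_eq0 => /eqP.
- by move=> z; apply: (@continuous_at_mulc _ _ (rad _)); exact: c1.
- by move=> z; apply: (@continuous_at_mulc _ _ (rad _)); exact: c2.
- by apply: (vanishes_outside_le M1M) => z i /v1 ->; rewrite mulr0.
- by apply: (vanishes_outside_le M2M) => z i /v2 ->; rewrite mulr0.
Qed.

Lemma radial_integral_gt0 (xi : R -> R) (L : R) : continuous xi ->
  vanishes_beyond L xi -> (forall x, 0 <= xi x) -> 0 < xi 0 ->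
  0 < rv_integral (rad xi).
Proof.
move=> cxi xiL xi0 xi00.
have cr := @radial_continuous R n k g n0 g0 _ _ cxi xiL.
(* A point with [|x| = 1] and [y = 0], hence [ln N = 0]: the weight is 1 there and the integrand
   equals [xi 0]. By continuity it exceeds half of this on a cube of positive measure. *)
pose z1 : space := delta_mx 0 (lshift k (Ordinal n0)).
have r0 z : 0 <= rad xi z by rewrite mulr_ge0// mass_weight_ge0.
have q1 : xnorm2 z1 = 1.
  rewrite /xnorm2 (bigD1 (Ordinal n0))//= mxE !eqxx expr1n big1 ?addr0// => i ii.
  by rewrite mxE eqxx (inj_eq (@lshift_inj _ _)) (negbTE ii) expr0n.
have rz1 : ynorm2 z1 = 0.
  by apply: big1 => i _; rewrite mxE eqxx eq_rlshift expr0n.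
have rad1 : 0 < rad xi z1.
  by rewrite /radial /mass_weight /rho_pow q1 rz1 !(powR1, addr0, ln1, mulr1).
have h2 : 0 < rad xi z1 / 2 by rewrite divr_gt0.
have [e /= e0 He] : nbhs_ball z1 [set z | rad xi z1 / 2 < rad xi z].
  apply/nbhs_ballP; have := cr z1 => /(_ [set x | rad xi z1 / 2 < x]); apply.
  by apply: lt_nbhsr; rewrite ltr_pdivrMr// ltr_pMr// ltr1n.
(* Half of the radius, to fit a closed cube into the open ball. *)
have e20 : 0 < e / 2 by rewrite divr_gt0.
have [mC lC] := @lebesgue_tuple_cube R (n + k) z1 (e / 2) (ltW e20).
set C := [set t | _] in mC lC.
rewrite -lte_fin -(@radial_integralE R n k g n0 g0 _ _ cxi xiL).
apply: (@lt_le_trans _ _ (\int[lebesgue_tuple R (n + k)]_t ((rad xi z1 / 2)%:E * (\1_C t)%:E))%E).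
  rewrite ge0_integralZl_EFin//; [|exact/measurable_EFinP|exact: ltW].
  rewrite integral_indic// setIT [X in (_ < _ * X)%E]lC -EFinM lte_fin mulr_gt0//.
  by rewrite exprn_gt0// mulrn_wgt0.
apply: ge0_le_integral => //.
- by move=> t _; rewrite -EFinM lee_fin mulr_ge0// ltW.
- by apply/measurable_EFinP; apply: measurable_funM.
- apply/measurable_EFinP; exact: (rv_measurable_continuous cr).
- move=> t _; rewrite -EFinM lee_fin indicE; have [tC|tC] := boolP (t \in C); last first.
    by rewrite mulr0.
  rewrite mulr1; apply: ltW; apply: He; split => // a i; rewrite (ord1 a).
  move: tC; rewrite inE => /(_ i) H; rewrite -ball_normE/= distrC mxE.
  by apply: (le_lt_trans H); rewrite ltr_pdivrMr// ltr_pMr// ltr1n.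
Qed.

End RadialScaling.

Section ExtremalIntegral.
Context (R : realType) (n k : nat) (g p theta : R).
Hypotheses (n0 : (0 < n)%N) (g0 : 0 <= g) (p2 : 2 <= p).
Local Notation space := 'rV[R]_(n + k).
Local Notation Q := (grushin_dim n k g).
Local Notation a := (p * (theta + 2) - 2).
Local Notation c := ((Q - p * (theta + 2)) / p).
Local Notation C0 := (c * (c * (p - 1) + a)).

(** Nothing is claimed about finiteness: the equality is one of extended reals, obtained from
    nonnegativity and measurability alone. *)
Lemma extremal_integral (b : R) : 0 <= C0 ->
  let v := fun z : space => b * grushin_rho g z `^ ((p * (theta + 2) - Q) / p) in
  ((C0 `^ p)%:E * integral_rV (rellich_lhs g p theta v) =
   integral_rV (rellich_rhs g p theta v))%E.
Proof.
move=> C00; cbv zeta; set v := fun z => _.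
have l0 z : 0 <= rellich_lhs g p theta v z := rellich_lhs_ge0 g p theta v z.
pose l z := `|v z| `^ p * mass_weight g a z.
have ll z : 0 <= l z by rewrite mulr_ge0 ?powR_ge0// mass_weight_ge0.
have El : integral_rV (rellich_lhs g p theta v) = integral_rV l.
  apply: eq_integral_rV_off_xaxis => // z qz.
  by rewrite rellich_lhsE// xnorm2_neq0.
have Er : integral_rV (rellich_rhs g p theta v) = integral_rV (fun z => C0 `^ p * l z).
  apply: eq_integral_rV_off_xaxis => // z.
  - exact: rellich_rhs_ge0.
  - by rewrite mulr_ge0 ?powR_ge0.
  - move=> qz; rewrite -(@extremal_pointwise _ _ _ _ _ _ g0 p2 b z C00 qz).
    by rewrite rellich_lhsE// xnorm2_neq0.
rewrite El Er /integral_rV; under [RHS]eq_integral do rewrite EFinM.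
rewrite ge0_integralZl_EFin//.
- by move=> t _; rewrite lee_fin.
- apply/measurable_EFinP; apply: (@rv_measurableM R (n + k) (fun z => `|v z| `^ p)).
    apply: rv_measurable_powR; apply: rv_measurable_norm.
    apply: rv_measurableM; first exact: rv_measurable_cst.
    apply: rv_measurable_powR.
    rewrite (_ : @grushin_rho R n k g = fun z => rho_pow g z `^ (2 + 2 * g)^-1).
      by apply: rv_measurable_powR; exact: rv_measurable_rho_pow.
    by apply/funext => z; exact: grushin_rhoE.
  exact: rv_measurable_mass_weight.
- exact: powR_ge0.
Qed.

End ExtremalIntegral.

(** * Sharpness of the constant *)

Section Cutoff.
Context (R : realType).
Implicit Types (x t i j a kap : R).

(** [cutoff 0 0] is [exp (- 1 / (1 + x) - 1 / (1 - x))] on the interval from -1 to 1. The exponents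
    [i] and [j] serve to make the family closed under derivation up to linear combinations. *)
Definition cutoff i j x : R := flatexp i (1 + x) * flatexp j (1 - x).

Lemma cutoff_eq0 i j x : 1 <= `|x| -> cutoff i j x = 0.
Proof.
rewrite /cutoff; have [x0|x0] := leP 0 x.
  by rewrite ger0_norm// => x1; rewrite (@flatexp_le0 _ j) ?mulr0// subr_le0.
rewrite ltr0_norm// lerNr => x1.
by rewrite flatexp_le0 ?mul0r// -lerBrDl sub0r.
Qed.

Definition dcutoff i j x : R := i * cutoff (i - 1) j x + cutoff (i - 2) j x -
  (j * cutoff i (j - 1) x + cutoff i (j - 2) x).

Lemma dcutoff_eq0 i j x : 1 <= `|x| -> dcutoff i j x = 0.
Proof. by move=> x1; rewrite /dcutoff !cutoff_eq0// !(mulr0, addr0, subr0). Qed.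

Lemma is_derive_cutoff i j x : is_derive x 1 (cutoff i j) (dcutoff i j x).
Proof.
have D1 : is_derive x 1 (fun x => 1 + x) (0 + 1) by apply: is_derive_addf.
have D2 : is_derive x 1 (fun x => 1 - x) (0 + - 1) by apply: is_derive_addf.
apply: is_derive_eq.
  exact: (is_derive_mulf (is_derive_compf (flatexp i) _ D1 (is_derive_flatexp _ _))
    (is_derive_compf (flatexp j) _ D2 (is_derive_flatexp _ _))).
by rewrite /dcutoff /cutoff; ring.
Qed.

Definition ddcutoff i j x : R := i * dcutoff (i - 1) j x + dcutoff (i - 2) j x -
  (j * dcutoff i (j - 1) x + dcutoff i (j - 2) x).

Lemma ddcutoff_eq0 i j x : 1 <= `|x| -> ddcutoff i j x = 0.
Proof. by move=> x1; rewrite /ddcutoff !dcutoff_eq0// !(mulr0, addr0, subr0). Qed.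

Lemma is_derive_dcutoff i j x : is_derive x 1 (dcutoff i j) (ddcutoff i j x).
Proof.
have B i' j' := is_derive_cutoff i' j' x.
exact: (is_derive_addf (is_derive_addf (is_derive_mulcf i (B _ _)) (B _ _))
  (is_deriveN (is_derive_addf (is_derive_mulcf j (B _ _)) (B _ _)))).
Qed.

Lemma is_derive_continuous (f f' : R -> R) :
  (forall x : R, is_derive x 1 f (f' x)) -> continuous f.
Proof.
move=> df x; apply/differentiable_continuous/derivable1_diffP.
by have [] := df x.
Qed.

Lemma cutoff_continuous i j : continuous (cutoff i j).
Proof. exact/is_derive_continuous/is_derive_cutoff. Qed.

Lemma dcutoff_continuous i j : continuous (dcutoff i j).
Proof. exact/is_derive_continuous/is_derive_dcutoff. Qed.

Lemma ddcutoff_continuous i j : continuous (ddcutoff i j).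
Proof.
have c i' j' := @dcutoff_continuous i' j'.
move=> x; apply: (@continuous_at_add _ _ (fun x => i * dcutoff (i - 1) j x + dcutoff (i - 2) j x)
  (fun x => - (j * dcutoff i (j - 1) x + dcutoff i (j - 2) x))).
  by apply: (@continuous_at_add _ _ (fun x => i * dcutoff (i - 1) j x)); [
    apply: (@continuous_at_mulc _ _ (dcutoff (i - 1) j))|]; exact: c.
apply: cvgN.
by apply: (@continuous_at_add _ _ (fun x => j * dcutoff i (j - 1) x)); [
    apply: (@continuous_at_mulc _ _ (dcutoff i (j - 1)))|]; exact: c.
Qed.

(** For [f] vanishing where [|x| >= 1], this lives on the band from [exp (- 1 / kap)] to
    [exp (1 / kap)], which fills the half-line as [kap -> 0]. *)
Definition logcut kap a (f : R -> R) t : R :=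
  if 0 < t then t `^ a * f (kap * ln t) else 0.

Lemma logcut_eq0 kap a f t : (forall x, 1 <= `|x| -> f x = 0) -> 0 < kap ->
  t <= expR (- kap^-1) \/ expR kap^-1 <= t -> logcut kap a f t = 0.
Proof.
move=> f0 k0 H; rewrite /logcut; case: ifP => // t0.
rewrite f0 ?mulr0// normrM gtr0_norm// mulrC -ler_pdivrMr// div1r.
case: H => H.
  rewrite -normrN (le_trans _ (ler_norm _))// lerNr.
  by rewrite -ler_expR lnK// posrE.
rewrite (le_trans _ (ler_norm _))//.
by rewrite -ler_expR lnK// posrE.
Qed.

(** The logarithm contributes [1 / t], so both terms carry the exponent [a - 1]. At [t <= 0] the
    function vanishes in a whole neighbourhood, the band starting at [exp (- 1 / kap)]. *)
Lemma is_derive_logcut kap a (f f' : R -> R) t : 0 < kap ->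
  (forall x : R, is_derive x 1 f (f' x)) ->
  (forall x, 1 <= `|x| -> f x = 0) -> (forall x, 1 <= `|x| -> f' x = 0) ->
  is_derive t 1 (logcut kap a f)
    (a * logcut kap (a - 1) f t + kap * logcut kap (a - 1) f' t).
Proof.
move=> k0 df f0 f'0; have [t0|t0] := leP t 0.
  have te : t < expR (- kap^-1) by rewrite (le_lt_trans t0)// expR_gt0.
  rewrite !logcut_eq0//; try by left; exact: ltW.
  rewrite !(mulr0, addr0).
  apply: (@near_eq_is_derive _ _ _ (cst 0)).
  near=> s; rewrite logcut_eq0//; left; apply: ltW.
  by near: s; exact: lt_nbhsl.
have H := is_derive_mulf (is_derive_powR a t0)
  (is_derive_compf f (fun t => kap * ln t)
    (is_derive_mulcf kap (is_derive1_ln t0)) (df _)).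
apply: is_derive_eq (near_eq_is_derive _ H) _.
  by near=> s; rewrite /logcut ifT//; near: s; exact: lt_nbhsr.
rewrite /logcut t0 (powRB1 _ t0); field.
by rewrite gt_eqF.
Unshelve. all: by end_near. Qed.

(** The derivative of the cutoff is expanded so that only functions [logcut kap _ (cutoff _ _)]
    occur, as the constructor [SmBump] of [smooth_expr] requires. *)
Lemma is_derive_logcutoff kap a i j t : 0 < kap ->
  is_derive t 1 (logcut kap a (cutoff i j))
  (a * logcut kap (a - 1) (cutoff i j) t + kap *
   (i * logcut kap (a - 1) (cutoff (i - 1) j) t + logcut kap (a - 1) (cutoff (i - 2) j) t -
    (j * logcut kap (a - 1) (cutoff i (j - 1)) t + logcut kap (a - 1) (cutoff i (j - 2)) t))).
Proof.
move=> k0; have d := is_derive_cutoff i j.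
apply: is_derive_eq (is_derive_logcut a t k0 d (@cutoff_eq0 i j) (@dcutoff_eq0 i j)) _.
congr (_ + _ * _); rewrite /logcut /dcutoff; case: ifP => _; last by rewrite !(mulr0, addr0, subr0).
by ring.
Qed.

Lemma logcutoff_continuous kap a i j : 0 < kap -> continuous (logcut kap a (cutoff i j)).
Proof. by move=> k0; apply: is_derive_continuous => x; exact: is_derive_logcutoff. Qed.

End Cutoff.

(** * Smooth approximation of [rho_pow] and the resulting test functions *)

Section SmoothApproximation.
Context (R : realType) (n k : nat) (g del kap : R).
Hypothesis kap0 : 0 < kap.
Local Notation space := 'rV[R]_(n + k).
Implicit Types (z : space).
Local Notation q := (@xnorm2 R n k).
Local Notation r := (@ynorm2 R n k).
Local Notation ee l := (delta_mx 0 l : space).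

(* [rho_pow] made smooth across [x = 0]: here [|x| ^ (2 (1 + g))] is multiplied
   by [exp (- del / |x| ^ 2)]. *)
Definition rho_approx z : R := del `^ (1 + g) * flatexp (1 + g) (q z / del) + r z.

(* A class of functions closed under partial derivatives, hence consisting of
   smooth functions, that contains the test functions. *)
Inductive smooth_expr : (space -> R) -> Prop :=
| SmCst c : smooth_expr (fun=> c)
| SmCoord l : smooth_expr (fun z => z 0 l)
| SmAdd f h : smooth_expr f -> smooth_expr h -> smooth_expr (fun z => f z + h z)
| SmMul f h : smooth_expr f -> smooth_expr h -> smooth_expr (fun z => f z * h z)
| SmFlat a : smooth_expr (fun z => flatexp a (q z / del))
| SmBump a i j : smooth_expr (fun z => logcut kap a (cutoff i j) (rho_approx z)).

Definition dxnorm2 (l : 'I_(n + k)) z : R :=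
  match fintype.split l with inl _ => 2 * z 0 l | inr _ => 0 end.

Definition dynorm2 (l : 'I_(n + k)) z : R :=
  match fintype.split l with inl _ => 0 | inr _ => 2 * z 0 l end.

Lemma is_derive_xnorm2 z l : is_derive z (ee l) q (dxnorm2 l z).
Proof.
rewrite /dxnorm2; case: (split_ordP l) => [i ->|j ->].
  exact: is_derive_xnorm2_x.
exact: is_derive_xnorm2_y.
Qed.

Lemma is_derive_ynorm2 z l : is_derive z (ee l) r (dynorm2 l z).
Proof.
rewrite /dynorm2; case: (split_ordP l) => [i ->|j ->].
  exact: is_derive_ynorm2_x.
exact: is_derive_ynorm2_y.
Qed.

Lemma smooth_dxnorm2 l : smooth_expr (dxnorm2 l).
Proof.
rewrite /dxnorm2; case: fintype.split => _; last exact: SmCst.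
by apply: SmMul; [exact: SmCst|exact: SmCoord].
Qed.

Lemma smooth_dynorm2 l : smooth_expr (dynorm2 l).
Proof.
rewrite /dynorm2; case: fintype.split => _; first exact: SmCst.
by apply: SmMul; [exact: SmCst|exact: SmCoord].
Qed.

Lemma is_derive_xnorm2_del z l : is_derive z (ee l) (fun z => q z / del) (dxnorm2 l z * del^-1).
Proof.
have := is_derive_mulcf del^-1 (is_derive_xnorm2 z l).
rewrite mulrC; rewrite (_ : (fun x => del^-1 * q x) = (fun x => q x / del))//.
by apply/funext => y; rewrite mulrC.
Qed.

Lemma is_derive_rho_approx z l : is_derive z (ee l) rho_approx
  (del `^ (1 + g) * (((1 + g) * flatexp (1 + g - 1) (q z / del) +
     flatexp (1 + g - 2) (q z / del)) * (dxnorm2 l z * del^-1)) + dynorm2 l z).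
Proof.
apply: is_derive_addf (is_derive_ynorm2 z l).
apply: is_derive_mulcf.
exact: (is_derive_compf (flatexp (1 + g)) (fun z => q z / del)
  (is_derive_xnorm2_del z l) (is_derive_flatexp _ _)).
Qed.

Lemma xnorm2_div_continuous : continuous (fun z => q z / del).
Proof.
move=> z; apply: (@continuous_at_mul _ _ q (fun=> del^-1)).
  exact: xnorm2_continuous.
exact: continuous_at_cst.
Qed.

Lemma rho_approx_continuous : continuous rho_approx.
Proof.
move=> z; apply: (@continuous_at_add _ _ (fun z => del `^ (1 + g) * flatexp (1 + g) (q z / del)) r).
  apply: (@continuous_at_mulc _ _ (fun z => flatexp (1 + g) (q z / del))).
  apply: (continuous_comp (f := fun z => q z / del) (g := flatexp (1 + g))).
    exact: xnorm2_div_continuous.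
  exact: flatexp_continuous.
exact: ynorm2_continuous.
Qed.

Lemma smooth_expr_derive f : smooth_expr f -> continuous f /\
  forall l, exists f', smooth_expr f' /\ forall z, is_derive z (ee l) f (f' z).
Proof.
elim=> {f} [c|l'|f h _ [cf df] _ [ch dh]|f h sf [cf df] sh [ch dh]|a|a i j].
- split=> [z|l]; first exact: continuous_at_cst.
  by exists (fun=> 0); split => [|z]; [exact: SmCst|exact: is_derive_cst].
- split=> [z|l]; first exact: coord_continuous.
  by exists (fun=> ee l 0 l'); split => [|z]; [exact: SmCst|exact: is_derive_coord].
- split=> [z|l].
    by apply: (@continuous_at_add _ _ f h); [exact: cf|exact: ch].
  have [f' [sf' Df]] := df l; have [h' [sh' Dh]] := dh l.
  exists (fun z => f' z + h' z); split; first exact: SmAdd.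
  by move=> z; exact: is_derive_addf.
- split=> [z|l].
    by apply: (@continuous_at_mul _ _ f h); [exact: cf|exact: ch].
  have [f' [sf' Df]] := df l; have [h' [sh' Dh]] := dh l.
  exists (fun z => f' z * h z + f z * h' z); split; last by move=> z; exact: is_derive_mulf.
  by apply: SmAdd; exact: SmMul.
- split=> [z|l].
    apply: (continuous_comp (f := fun z => q z / del) (g := flatexp a)).
      exact: xnorm2_div_continuous.
    exact: flatexp_continuous.
  exists (fun z => (a * flatexp (a - 1) (q z / del) + flatexp (a - 2) (q z / del)) *
    (dxnorm2 l z * del^-1)); split.
    apply: SmMul; last by apply: SmMul; [exact: smooth_dxnorm2|exact: SmCst].
    apply: SmAdd; last exact: SmFlat.
    by apply: SmMul; [exact: SmCst|exact: SmFlat].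
  move=> z; exact: (is_derive_compf (flatexp a) (fun z => q z / del)
    (is_derive_xnorm2_del z l) (is_derive_flatexp _ _)).
- split=> [z|l].
    apply: (continuous_comp (f := rho_approx) (g := logcut kap a (cutoff i j))).
      exact: rho_approx_continuous.
    exact: logcutoff_continuous.
  eexists; split; last first.
    move=> z; exact: (is_derive_compf (logcut kap a (cutoff i j)) rho_approx
      (is_derive_rho_approx z l) (is_derive_logcutoff a i j _ kap0)).
  apply: SmMul.
    apply: SmAdd.
      by apply: SmMul; [exact: SmCst|exact: SmBump].
    apply: SmMul; first exact: SmCst.
    apply: SmAdd.
      apply: SmAdd; last exact: SmBump.
      by apply: SmMul; [exact: SmCst|exact: SmBump].
    rewrite (_ : (fun z => - _) = (fun z => -1 * (j * logcut kap (a - 1) (cutoff i (j - 1)) (rho_approx z) +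
         logcut kap (a - 1) (cutoff i (j - 2)) (rho_approx z)))).
      apply: SmMul; first exact: SmCst.
      apply: SmAdd; last exact: SmBump.
      by apply: SmMul; [exact: SmCst|exact: SmBump].
    by apply/funext => z; rewrite mulN1r.
  apply: SmAdd; last exact: smooth_dynorm2.
  apply: SmMul; first exact: SmCst.
  apply: SmMul.
    apply: SmAdd; last exact: SmFlat.
    by apply: SmMul; [exact: SmCst|exact: SmFlat].
  by apply: SmMul; [exact: smooth_dxnorm2|exact: SmCst].
Qed.

Lemma smooth_expr_smooth f : smooth_expr f -> smooth f.
Proof.
move=> sf s; have : smooth_expr (foldr (@partial R (n + k)) f s).
  elim: s => //= l s /smooth_expr_derive[_ /(_ l)[f' [sf' Df]]].
  rewrite (_ : partial _ _ = f')//; apply/funext => z; rewrite /partial.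
  by have [_ ->] := Df z.
move=> /smooth_expr_derive[cf Df]; split => // l z.
by have [f' [_ /(_ z)[]]] := Df l.
Qed.

End SmoothApproximation.

Section FlatProfile.
Context (R : realType) (g : R).
Hypothesis g0 : 0 <= g.
Implicit Types (t s del : R).

(** For [A t = t ^ (1 + g) exp (- del / t)] one has [A' = t ^ g flat1 (del / t)] and
    [A'' = t ^ (g - 1) flat2 (del / t)]. Since [del] occurs only in [s = del / t], bounds for
    [s >= 0] are uniform in [del]; [s = 0] gives the derivatives of [t ^ (1 + g)]. *)
Definition flat1 s : R := expR (- s) * (1 + g + s).
Definition flat2 s : R := expR (- s) * ((1 + g) * g + 2 * g * s + s ^+ 2).

Lemma flat_profileE del t : 0 < del -> 0 <= t ->
  del `^ (1 + g) * flatexp (1 + g) (t / del) = t `^ (1 + g) * expR (- (del / t)).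
Proof.
move=> d0; rewrite le_eqVlt => /predU1P[<-|t0].
  rewrite mul0r flatexp_le0// mulr0 powR0 ?mul0r//.
  by rewrite gt_eqF// ltr_pwDl.
rewrite /flatexp divr_gt0// mulrA -powRM ?ltW//; last by rewrite divr_gt0.
by rewrite invf_div mulrCA divff ?mulr1// gt_eqF.
Qed.

Lemma is_derive_flat_exp del t : 0 < t ->
  is_derive t 1 (fun t => expR (- (del / t))) (expR (- (del / t)) * (del / t ^+ 2)).
Proof.
move=> t0.
have D : is_derive t 1 (fun t => - del * t^-1) (- del * (- t ^- 2 *: (1 : R))).
  apply: is_derive_mulcf; apply: (@is_deriveV _ id).
  by rewrite gt_eqF.
have := is_derive_compf expR _ D (is_derive_expR _).
rewrite (_ : (fun x => expR (- del * x^-1)) = (fun t => expR (- (del / t)))).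
  by move=> H; apply: is_derive_eq H _; rewrite mulNr /GRing.scale/= mulr1 mulrNN.
by apply/funext => x; rewrite mulNr.
Qed.

Lemma is_derive_flat_profile del t : 0 < del -> 0 < t ->
  is_derive t 1 (fun t => del `^ (1 + g) * flatexp (1 + g) (t / del))
    (t `^ g * flat1 (del / t)).
Proof.
move=> d0 t0.
have H := is_derive_mulf (is_derive_powR (1 + g) t0) (is_derive_flat_exp del t0).
apply: is_derive_eq (near_eq_is_derive _ H) _.
  by near=> s; rewrite flat_profileE// ltW//; near: s; exact: lt_nbhsr.
have -> : t `^ (1 + g - 1) = t `^ g by congr powR; ring.
have -> : t `^ (1 + g) = t `^ g * t.
  by rewrite -powRD1 ?(ltW t0) 1?[g + 1]addrC// gt_eqF// (lt_le_trans _ g0)// ltrN10.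
by rewrite /flat1; field; rewrite gt_eqF.
Unshelve. all: by end_near. Qed.

Lemma is_derive_flat_profile1 del t : 0 < t ->
  is_derive t 1 (fun t => t `^ g * flat1 (del / t))
    (t `^ (g - 1) * flat2 (del / t)).
Proof.
move=> t0.
have D : is_derive t 1 (fun t => del / t) (del * (- t ^- 2 *: (1 : R))).
  apply: is_derive_mulcf; apply: (@is_deriveV _ id).
  by rewrite gt_eqF.
have D1 : is_derive t 1 (fun t => 1 + g + del / t) (0 + del * (- t ^- 2 *: (1 : R))).
  exact: (is_derive_addf (is_derive_cst (1 + g) t 1) D).
apply: is_derive_eq (is_derive_mulf (is_derive_powR g t0)
  (is_derive_mulf (is_derive_flat_exp del t0) D1)) _.
have -> : t `^ g = t `^ (g - 1) * t.
  rewrite -[X in _ * X]powRr1 ?(ltW t0)// -powRD ?subrK//.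
  by rewrite (gt_eqF t0) implybT.
rewrite /flat1 /flat2 /GRing.scale/=; field.
by rewrite gt_eqF.
Qed.

Lemma flat1_continuous : continuous flat1.
Proof.
move=> s; apply: (@continuous_at_mul _ _ (fun s => expR (- s)) (fun s => 1 + g + s)).
  by apply: (continuous_comp (f := fun s => - s)); [exact: continuousN|exact: continuous_expR].
by apply: cvgD; [exact: cvg_cst|exact: cvg_id].
Qed.

Lemma flat2_continuous : continuous flat2.
Proof.
move=> s; apply: (@continuous_at_mul _ _ (fun s => expR (- s))).
  by apply: (continuous_comp (f := fun s => - s)); [exact: continuousN|exact: continuous_expR].
apply: (@continuous_at_add _ _ (fun s => (1 + g) * g + 2 * g * s) (fun s => s ^+ 2)).
  by apply: cvgD; [exact: cvg_cst|exact: mulrl_continuous].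
by apply: (@continuous_at_sqr _ _ id); exact: cvg_id.
Qed.

Lemma flat1_le s : 0 <= s -> `|flat1 s| <= 2 + g.
Proof.
move=> s0; have s1 : 0 <= 1 + g + s by rewrite !addr_ge0.
rewrite ger0_norm ?mulr_ge0 ?expR_ge0// /flat1 expRN mulrC ler_pdivrMr ?expR_gt0//.
have := expR_ge1Dx s => H.
apply: le_trans (_ : (2 + g) * (1 + s) <= _); last by rewrite ler_wpM2l// addr_ge0.
have gs := mulr_ge0 g0 s0.
have -> : (2 + g) * (1 + s) = 2 + g + 2 * s + g * s by ring.
by move: (g * s) gs => gs gs0; lra.
Qed.

Lemma flat2_le s : 0 <= s -> `|flat2 s| <= (1 + g) * g + 2 * g + 2.
Proof.
move=> s0.
have p0 : 0 <= (1 + g) * g + 2 * g * s + s ^+ 2.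
  by rewrite !addr_ge0 ?mulr_ge0 ?sqr_ge0 ?addr_ge0.
rewrite ger0_norm ?mulr_ge0 ?expR_ge0// /flat2 expRN mulrC ler_pdivrMr ?expR_gt0//.
have H1 := expR_ge1Dx s.
have := expR_ge1Dxn 1 s0; rewrite (_ : 2`!%:R = 2)// => H2.
have H3 : 1 <= expR s by rewrite (le_trans _ H1)// lerDl.
have H4 : s <= expR s by rewrite (le_trans _ H1)// lerDr.
have H5 : s ^+ 2 <= 2 * expR s.
  by rewrite -ler_pdivrMl// mulrC (le_trans _ H2)// lerDr.
have := ler_wpM2l (mulr_ge0 (addr_ge0 ler01 g0) g0) H3.
have := ler_wpM2l (mulr_ge0 (ler0n R 2) g0) H4.
rewrite !mulrDl; lra.
Qed.

End FlatProfile.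

Section TestFunctionApprox.
Context (R : realType) (n k : nat) (g : R).
Hypothesis g0 : 0 <= g.
Local Notation space := 'rV[R]_(n + k).
Implicit Types (z : space) (del kap : R).
Local Notation q := (@xnorm2 R n k).
Local Notation r := (@ynorm2 R n k).
Local Notation N := (@rho_pow R n k g).
Local Notation M del := (@rho_approx R n k g del).

Lemma rho_approxE del z : 0 < del ->
  M del z = q z `^ (1 + g) * expR (- (del / q z)) + r z.
Proof. by move=> d0; rewrite /rho_approx flat_profileE// xnorm2_ge0. Qed.

Lemma rho_approx_le del z : 0 < del -> M del z <= N z.
Proof.
move=> d0; rewrite rho_approxE// lerD2r ler_piMr ?powR_ge0// expR_le1 oppr_le0.
by rewrite divr_ge0 ?xnorm2_ge0// ltW.
Qed.

(** If an [x]-coordinate exceeds this number, then [q z >= 1 >= del], so the factor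
    [exp (- del / q)] costs at most [exp 1]; hence the product. The added 1 keeps the radius at
    least 1. *)
Definition support_radius kap : R := 1 + expR 1 * expR kap^-1.

Lemma support_radius_ge1 kap : 1 <= support_radius kap.
Proof. by rewrite lerDl mulr_ge0 ?expR_ge0. Qed.

Lemma rho_approx_coord_lt del kap z l : 0 < del -> del <= 1 ->
  support_radius kap < `|z 0 l| -> expR kap^-1 < M del z.
Proof.
move=> d0 d1 Bz; have B1 := support_radius_ge1 kap; set B := support_radius kap in B1 Bz.
have e1 : 1 <= expR 1 :> R by rewrite -[X in X <= _]expR0 ler_expR.
have Bk : expR 1 * expR kap^-1 < B by rewrite ltrDr.
have Bk' : expR kap^-1 < B by rewrite (le_lt_trans _ Bk)// ler_peMl// expR_ge0.
have B2 : B < z 0 l ^+ 2.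
  rewrite -real_normK ?num_real// expr2 (lt_le_trans Bz)// ler_peMl//.
  by rewrite (le_trans B1)// ltW.
rewrite rho_approxE//.
case: (split_ordP l) => [i li|j lj].
  rewrite li in B2; have qB := lt_le_trans B2 (coord_sqr_le z i).
  have q1 : 1 <= q z by rewrite (le_trans B1)// ltW.
  apply: (@lt_le_trans _ _ (q z `^ (1 + g) * expR (- (del / q z)))); last first.
    by rewrite lerDl ynorm2_ge0.
  apply: (@lt_le_trans _ _ (q z * expR (- 1))).
    by rewrite expRN ltr_pdivlMr ?expR_gt0// mulrC (lt_trans Bk).
  apply: ler_pM; rewrite ?expR_ge0 ?xnorm2_ge0//.
    by apply: le1r_powR; rewrite ?lerDl.
  rewrite ler_expR lerN2 ler_pdivrMr ?mul1r ?(lt_le_trans ltr01)//.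
  exact: le_trans q1.
rewrite lj in B2; rewrite (lt_trans Bk')// (lt_le_trans B2)// (@le_trans _ _ (r z))//.
  by rewrite /ynorm2 (bigD1 j)//= lerDl sumr_ge0// => i _; exact: sqr_ge0.
by rewrite lerDr mulr_ge0 ?powR_ge0 ?expR_ge0.
Qed.

Lemma rho_approx0 del : M del 0 = 0.
Proof.
have q0 : q 0 = 0 by apply/eqP; rewrite xnorm2_eq0 linear0.
have r0 : r 0 = 0 by apply/eqP; rewrite ynorm2_eq0 linear0.
by rewrite /rho_approx q0 r0 mul0r flatexp_le0// mulr0 addr0.
Qed.

Lemma test_function_approx del kap a : 0 < del -> del <= 1 -> 0 < kap ->
  test_function (fun z => logcut kap a (cutoff 0 0) (M del z)).
Proof.
move=> d0 d1 k0; set u := fun z => _.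
(* The preimage of the band of [logcut]: closed by continuity, bounded by [rho_approx_coord_lt], and
   without the origin, where [M del] is 0. *)
pose K : set space := [set z | expR (- kap^-1) <= M del z] `&`
  [set z | M del z <= expR kap^-1].
have clK : closed K.
  apply: closedI.
    apply: (@closed_comp _ _ (M del) [set x | expR (- kap^-1) <= x]).
      by move=> z _; exact: rho_approx_continuous.
    exact: closed_ge.
  apply: (@closed_comp _ _ (M del) [set x | x <= expR kap^-1]).
    by move=> z _; exact: rho_approx_continuous.
  exact: closed_le.
have uK : [set z | u z != 0] `<=` K.
  move=> z /= uz; split; rewrite /= leNgt; apply: contra uz => H;
    by apply/eqP; apply: logcut_eq0 => //; [exact: cutoff_eq0|
       (left + right); exact: ltW].
have sK : support_closure u `<=` K.
  by rewrite ((closure_id K).1 clK); exact: closure_subset.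
split.
- by apply: (smooth_expr_smooth (g := g) (del := del) (kap := kap)) => //; exact: SmBump.
- apply: bounded_closed_compact; last exact: closed_closure.
  exists (support_radius kap); split => [|x Bx z /sK[_ /= zK]]; first exact: num_real.
  have B0 : 0 <= support_radius kap := le_trans ler01 (support_radius_ge1 _).
  rewrite [leLHS]/Num.norm/= mx_normrE; apply/bigmax_leP; split => /=.
    by rewrite (le_trans B0)// ltW.
  move=> [i j] _ /=; rewrite (ord1 i) leNgt; apply/negP => H.
  have := rho_approx_coord_lt d0 d1 (lt_trans Bx H).
  by rewrite ltNge zK.
- by move=> /sK[/=]; rewrite rho_approx0 leNgt expR_gt0.
Qed.

End TestFunctionApprox.

Section LogCutoff.
Context (R : realType).
Implicit Types (t a kap x : R) (f : R -> R).

(** A power is monotone one way or the other according to the sign of [a]; the sum of the end values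
    covers both. *)
Lemma powR_le_ends lo hi a x : 0 < lo -> lo <= x -> x <= hi ->
  x `^ a <= lo `^ a + hi `^ a.
Proof.
move=> lo0 lox xhi; have x0 := lt_le_trans lo0 lox; have hi0 := lt_le_trans x0 xhi.
have [a0|a0] := leP 0 a.
  by rewrite (@le_trans _ _ (hi `^ a)) ?lerDr ?powR_ge0// ge0_ler_powR// nnegrE ltW.
rewrite (@le_trans _ _ (lo `^ a)) ?lerDl ?powR_ge0//.
rewrite !powR_expR// ler_expR ler_nM2l// ler_ln//.
Qed.

Lemma vanishing_bounded f L : continuous f -> vanishes_beyond L f ->
  exists M, forall x, `|f x| <= M.
Proof.
move=> cf fL; have [L0|L0] := ltP L 0.
  by exists 0 => x; rewrite fL ?normr0// (lt_le_trans L0).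
have LL : - L <= L by rewrite (le_trans _ L0)// oppr_le0.
have cn : {within `[- L, L], continuous (fun x => `|f x|)}.
  apply: continuous_subspaceT => x.
  apply: (continuous_comp (f := f) (g := fun x : R => `|x|)); first exact: cf.
  exact: norm_continuous.
have [c _ H] := EVT_max LL cn.
exists `|f c| => x; have [xL|xL] := leP `|x| L; last by rewrite (fL x xL) normr0.
by apply: H; rewrite in_itv/= -ler_norml.
Qed.

Lemma logcut_continuous kap a f : 0 < kap -> continuous f ->
  (forall x, 1 <= `|x| -> f x = 0) -> continuous (logcut kap a f).
Proof.
move=> k0 cf f0 t; have [t0|t0] := leP t 0.
  have te : t < expR (- kap^-1) by rewrite (le_lt_trans t0)// expR_gt0.
  have N : \forall s \near t, 0 = logcut kap a f s.
    by near=> s; rewrite logcut_eq0//; left; apply: ltW; near: s; exact: lt_nbhsl.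
  rewrite /prop_for /continuous_at -(nbhs_singleton N).
  by apply: cvg_trans (near_eq_cvg N) _; exact: cvg_cst.
have N : \forall s \near t, s `^ a * f (kap * ln s) = logcut kap a f s.
  by near=> s; rewrite /logcut ifT//; near: s; exact: lt_nbhsr.
rewrite /prop_for /continuous_at -(nbhs_singleton N).
apply: cvg_trans (near_eq_cvg N) _.
apply: (@continuous_at_mul _ _ (fun s => s `^ a) (fun s => f (kap * ln s))).
  exact: powR_continuous_at.
apply: (continuous_comp (f := fun s => kap * ln s) (g := f)); last exact: cf.
apply: (@continuous_at_mulc _ _ (@ln R)).
exact: continuous_ln.
Unshelve. all: by end_near. Qed.

End LogCutoff.

Section LogProfile.
Context (R : realType) (kap s : R).
Hypothesis k0 : 0 < kap.
Local Notation b := (@cutoff R 0 0).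
Local Notation b1 := (@dcutoff R 0 0).
Local Notation b2 := (@ddcutoff R 0 0).
Implicit Types (t : R).

Definition profile := logcut kap s b.
Definition profile1 t : R := s * logcut kap (s - 1) b t + kap * logcut kap (s - 1) b1 t.
Definition profile2 t : R :=
  s * ((s - 1) * logcut kap (s - 1 - 1) b t + kap * logcut kap (s - 1 - 1) b1 t) +
  kap * ((s - 1) * logcut kap (s - 1 - 1) b1 t + kap * logcut kap (s - 1 - 1) b2 t).

Lemma is_derive_profile t : is_derive t 1 profile (profile1 t).
Proof.
apply: is_derive_logcut => //.
- exact: is_derive_cutoff.
- exact: cutoff_eq0.
- exact: dcutoff_eq0.
Qed.

Lemma is_derive_profile1 t : is_derive t 1 profile1 (profile2 t).
Proof.
apply: is_derive_addf; apply: is_derive_mulcf; apply: is_derive_logcut => //.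
- exact: is_derive_cutoff.
- exact: cutoff_eq0.
- exact: dcutoff_eq0.
- exact: is_derive_dcutoff.
- exact: dcutoff_eq0.
- exact: ddcutoff_eq0.
Qed.

Lemma profile_eq0 t : t <= expR (- kap^-1) \/ expR kap^-1 <= t -> profile t = 0.
Proof. by apply: logcut_eq0 => //; exact: cutoff_eq0. Qed.

Lemma profile1_eq0 t : t <= expR (- kap^-1) \/ expR kap^-1 <= t -> profile1 t = 0.
Proof.
move=> H; rewrite /profile1 !logcut_eq0 ?mulr0 ?addr0//; [exact: dcutoff_eq0|exact: cutoff_eq0].
Qed.

Lemma profile2_eq0 t : t <= expR (- kap^-1) \/ expR kap^-1 <= t -> profile2 t = 0.
Proof.
have c0 := @cutoff_eq0 R 0 0; have c1 := @dcutoff_eq0 R 0 0; have c2 := @ddcutoff_eq0 R 0 0.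
by move=> H; rewrite /profile2 !logcut_eq0 ?(mulr0, addr0).
Qed.

Lemma profile_continuous : continuous profile.
Proof. exact/is_derive_continuous/is_derive_profile. Qed.

Lemma profile1_continuous : continuous profile1.
Proof. exact/is_derive_continuous/is_derive_profile1. Qed.

Lemma profile2_continuous : continuous profile2.
Proof.
have c0 a : continuous (logcut kap a b).
  by apply: logcut_continuous k0 _ _; [exact: cutoff_continuous|exact: cutoff_eq0].
have c1 a : continuous (logcut kap a b1).
  by apply: logcut_continuous k0 _ _; [exact: dcutoff_continuous|exact: dcutoff_eq0].
have c2 a : continuous (logcut kap a b2).
  by apply: logcut_continuous k0 _ _; [exact: ddcutoff_continuous|exact: ddcutoff_eq0].
move=> t; apply: (@continuous_at_add _ _
  (fun t => s * ((s - 1) * logcut kap (s - 1 - 1) b t + kap * logcut kap (s - 1 - 1) b1 t))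
  (fun t => kap * ((s - 1) * logcut kap (s - 1 - 1) b1 t + kap * logcut kap (s - 1 - 1) b2 t))).
  apply: (@continuous_at_mulc _ _ (fun t => (s - 1) * logcut kap (s - 1 - 1) b t + kap * logcut kap (s - 1 - 1) b1 t)).
  apply: (@continuous_at_add _ _ (fun t => (s - 1) * logcut kap (s - 1 - 1) b t)
     (fun t => kap * logcut kap (s - 1 - 1) b1 t)).
    by apply: (@continuous_at_mulc _ _ (logcut kap (s - 1 - 1) b)); exact: c0.
  by apply: (@continuous_at_mulc _ _ (logcut kap (s - 1 - 1) b1)); exact: c1.
apply: (@continuous_at_mulc _ _ (fun t => (s - 1) * logcut kap (s - 1 - 1) b1 t + kap * logcut kap (s - 1 - 1) b2 t)).
apply: (@continuous_at_add _ _ (fun t => (s - 1) * logcut kap (s - 1 - 1) b1 t)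
     (fun t => kap * logcut kap (s - 1 - 1) b2 t)).
  by apply: (@continuous_at_mulc _ _ (logcut kap (s - 1 - 1) b1)); exact: c1.
by apply: (@continuous_at_mulc _ _ (logcut kap (s - 1 - 1) b2)); exact: c2.
Qed.

Let vanishing (f : R -> R) :
  (forall t, t <= expR (- kap^-1) \/ expR kap^-1 <= t -> f t = 0) ->
  vanishes_beyond (expR kap^-1) f.
Proof.
move=> f0 t; have [t0|t0] := leP t 0.
  by move=> _; apply: f0; left; rewrite (le_trans t0)// expR_ge0.
by rewrite gtr0_norm// => /ltW tk; apply: f0; right.
Qed.

Lemma profile_bounded : exists B, forall t, [/\ `|profile t| <= B,
  `|profile1 t| <= B & `|profile2 t| <= B].
Proof.
have [B0 H0] := vanishing_bounded profile_continuous (vanishing profile_eq0).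
have [B1 H1] := vanishing_bounded profile1_continuous (vanishing profile1_eq0).
have [B2 H2] := vanishing_bounded profile2_continuous (vanishing profile2_eq0).
exists (Num.max B0 (Num.max B1 B2)) => t.
by rewrite !le_max H0 H1 H2 !orbT.
Qed.

End LogProfile.

(** * The limit [del -> 0] *)

Section TestFunctionLimit.
Context (R : realType) (n k : nat) (g kap s : R).
Hypotheses (g0 : 0 <= g) (k0 : 0 < kap).
Local Notation space := 'rV[R]_(n + k).
Implicit Types (z : space) (del : R).
Local Notation q := (@xnorm2 R n k).
Local Notation r := (@ynorm2 R n k).
Local Notation N := (@rho_pow R n k g).
Local Notation F := (profile kap s).
Local Notation F1 := (profile1 kap s).
Local Notation F2 := (profile2 kap s).

(* Equals [rho_approx g del] for [0 < del] and [rho_pow g] for [del = 0]. *)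
Definition rho_interp del z : R := q z `^ (1 + g) * expR (- (del / q z)) + r z.
Local Notation M := rho_interp.

(** Off [{x = 0}] and for [del > 0] this is [L] of the approximating function, divided by
    [|x| ^ (2 g)]. The formula keeps its meaning at [del = 0], so that convergence of the integrands
    is continuity in [del]. *)
Definition op_factor del z : R :=
  F2 (M del z) * (4 * flat1 g (del / q z) ^+ 2 * (q z `^ g * q z) + 4 * (1 + g) ^+ 2 * r z) +
  F1 (M del z) *
    (2 * n%:R * flat1 g (del / q z) + 4 * flat2 g (del / q z) + 2 * k%:R * (1 + g) ^+ 2).

Lemma grushin_op_approx del z : 0 < del -> q z != 0 ->
  grushin_op g (fun z => F (rho_approx g del z)) z = q z `^ g * op_factor del z.
Proof.
move=> d0 qz; have q0 := xnorm2_gt0 qz.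
have dA (t : R) : 0 < t -> is_derive t 1
    (fun t => del `^ (1 + g) * flatexp (1 + g) (t / del)) (t `^ g * flat1 g (del / t)).
  exact: is_derive_flat_profile.
have dA1 (t : R) : 0 < t -> is_derive t 1 (fun t => t `^ g * flat1 g (del / t))
    (t `^ (g - 1) * flat2 g (del / t)).
  exact: is_derive_flat_profile1.
have dF (t : R) : 0 < t -> is_derive t 1 F (F1 t) by move=> _; exact: is_derive_profile.
have dF1 (t : R) : 0 < t -> is_derive t 1 F1 (F2 t) by move=> _; exact: is_derive_profile1.
have A0 (t : R) : 0 < t -> 0 < del `^ (1 + g) * flatexp (1 + g) (t / del).
  move=> t0; have -> := flat_profileE g0 d0 (ltW t0).
  by apply: mulr_gt0; [exact: powR_gt0|exact: expR_gt0].
rewrite (@grushin_op_comp R n k g _ _ _ _ _ _ dA dA1 dF dF1 A0 z q0) -[_ + r z]/(rho_approx g del z).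
rewrite rho_approxE// -/(M del z) /op_factor.
have -> : 4 * (q z `^ (g - 1) * flat2 g (del / q z)) * q z =
   4 * flat2 g (del / q z) * q z `^ g.
  by rewrite -(xnorm2_powRB1 g qz); ring.
move: (F1 _) (F2 _) (flat1 _ _) (flat2 _ _) => f1 f2 e1 e2; ring.
Qed.

Lemma rho_interp_continuous_del z : continuous (fun del => M del z).
Proof.
move=> del; apply: (@continuous_at_add _ _ (fun del => q z `^ (1 + g) * expR (- (del / q z)))
  (fun=> r z)); last exact: continuous_at_cst.
apply: (@continuous_at_mulc _ _ (fun del => expR (- (del / q z)))).
apply: (continuous_comp (f := fun del => - (del / q z)) (g := @expR R)); last exact: continuous_expR.
apply: cvgN; apply: cvgMl; exact: cvg_id.
Qed.

Lemma op_factor_continuous_del z : continuous (fun del => op_factor del z).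
Proof.
have cF (f : R -> R) : continuous f -> continuous (fun del : R => f (M del z)).
  move=> cf del; apply: (continuous_comp (f := fun del => M del z) (g := f)); last exact: cf.
  exact: rho_interp_continuous_del.
have ce (f : R -> R) : continuous f -> continuous (fun del : R => f (del / q z)).
  move=> cf del; apply: (continuous_comp (f := fun del => del / q z) (g := f)); last exact: cf.
  apply: cvgMl; exact: cvg_id.
have c1 := ce _ (@flat1_continuous R g).
have c2 := ce _ (@flat2_continuous R g).
have cF1 := cF _ (profile1_continuous (s := s) k0).
have cF2 := cF _ (profile2_continuous (s := s) k0).
move=> del; apply: (@continuous_at_add _ _
  (fun del => F2 (M del z) * (4 * flat1 g (del / q z) ^+ 2 * (q z `^ g * q z) + 4 * (1 + g) ^+ 2 * r z))
  (fun del => F1 (M del z) *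
    (2 * n%:R * flat1 g (del / q z) + 4 * flat2 g (del / q z) + 2 * k%:R * (1 + g) ^+ 2))).
  apply: (@continuous_at_mul _ _ (fun del => F2 (M del z))); first exact: cF2.
  apply: (@continuous_at_add _ _ (fun del => 4 * flat1 g (del / q z) ^+ 2 * (q z `^ g * q z)));
    last exact: continuous_at_cst.
  apply: (@continuous_at_mul _ _ (fun del => 4 * flat1 g (del / q z) ^+ 2));
    last exact: continuous_at_cst.
  apply: (@continuous_at_mulc _ _ (fun del => flat1 g (del / q z) ^+ 2)).
  by apply: (@continuous_at_sqr _ _ (fun del => flat1 g (del / q z))); exact: c1.
apply: (@continuous_at_mul _ _ (fun del => F1 (M del z))); first exact: cF1.
apply: (@continuous_at_add _ _ (fun del => 2 * n%:R * flat1 g (del / q z) + 4 * flat2 g (del / q z)));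
    last exact: continuous_at_cst.
apply: (@continuous_at_add _ _ (fun del => 2 * n%:R * flat1 g (del / q z))
  (fun del => 4 * flat2 g (del / q z))).
  by apply: (@continuous_at_mulc _ _ (fun del => flat1 g (del / q z))); exact: c1.
by apply: (@continuous_at_mulc _ _ (fun del => flat2 g (del / q z))); exact: c2.
Qed.

Lemma rv_measurable_div_xnorm2 del : rv_measurable (fun z => del / q z).
Proof.
rewrite (_ : (fun z => _) = (fun z => del * q z `^ (-1))).
  apply: rv_measurableM; first exact: rv_measurable_cst.
  by apply: rv_measurable_powR; exact: rv_measurable_xnorm2.
by apply/funext => z; rewrite powR_inv1// xnorm2_ge0.
Qed.

Lemma rv_measurable_continuous_comp (f : R -> R) (h : space -> R) : continuous f ->
  rv_measurable h -> rv_measurable (fun z => f (h z)).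
Proof. by move=> cf; apply: rv_measurable_comp; exact: continuous_measurable_fun. Qed.

Lemma rv_measurable_rho_interp del : rv_measurable (M del).
Proof.
apply: (@rv_measurableD R (n + k) (fun z => q z `^ (1 + g) * expR (- (del / q z))) r); last first.
  by apply: rv_measurable_continuous; exact: ynorm2_continuous.
apply: (@rv_measurableM R (n + k) (fun z => q z `^ (1 + g))).
  by apply: rv_measurable_powR; exact: rv_measurable_xnorm2.
apply: (@rv_measurable_continuous_comp (fun t => expR (- t))); last exact: rv_measurable_div_xnorm2.
by move=> t; apply: (continuous_comp (f := fun s => - s)); [exact: continuousN|exact: continuous_expR].
Qed.

Lemma rv_measurable_op_factor del : rv_measurable (op_factor del).
Proof.
have mF (f : R -> R) : continuous f -> rv_measurable (fun z => f (M del z)).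
  by move=> cf; apply: rv_measurable_continuous_comp cf _; exact: rv_measurable_rho_interp.
have me (f : R -> R) : continuous f -> rv_measurable (fun z => f (del / q z)).
  by move=> cf; apply: rv_measurable_continuous_comp cf _; exact: rv_measurable_div_xnorm2.
have m1 := me _ (@flat1_continuous R g).
have m2 := me _ (@flat2_continuous R g).
have mq := @rv_measurable_xnorm2 R n k.
have mr : rv_measurable r by apply: rv_measurable_continuous; exact: ynorm2_continuous.
have mc c : rv_measurable (fun _ : space => c) by exact: rv_measurable_cst.
apply: rv_measurableD; apply: rv_measurableM.
- exact: mF (profile2_continuous (s := s) k0).
- apply: rv_measurableD; apply: rv_measurableM => //.
    by apply: rv_measurableM => //; exact: (rv_measurableM m1 m1).
  by apply: rv_measurableM => //; exact: rv_measurable_powR.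
- exact: mF (profile1_continuous (s := s) k0).
- by apply: rv_measurableD => //; apply: rv_measurableD; exact: rv_measurableM.
Qed.

Local Notation B := (support_radius kap).

Lemma rho_interpE del z : 0 < del -> M del z = rho_approx g del z.
Proof. by move=> d0; rewrite rho_approxE. Qed.

Lemma band_coord_le del z l : 0 < del -> del <= 1 -> M del z < expR kap^-1 ->
  `|z 0 l| <= B.
Proof.
move=> d0 d1; rewrite rho_interpE// => H; rewrite leNgt; apply/negP.
by move=> /(rho_approx_coord_lt g0 d0 d1); rewrite ltNge ltW.
Qed.

Lemma band_norms_le del z : 0 < del -> del <= 1 -> M del z < expR kap^-1 ->
  [/\ q z <= B, r z <= B & N z <= B `^ (1 + g) + B].
Proof.
move=> d0 d1 H.
have e1 : 1 <= expR 1 :> R by rewrite -[X in X <= _]expR0 ler_expR.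
have eB : expR kap^-1 <= B.
  by rewrite (@le_trans _ _ (expR 1 * expR kap^-1)) ?lerDr// ler_peMl// expR_ge0.
have rB : r z <= B.
  rewrite (le_trans _ eB)// (le_trans _ (ltW H))// lerDr.
  by rewrite mulr_ge0 ?powR_ge0 ?expR_ge0.
suff qB : q z <= B.
  split => //; apply: lerD => //.
  by apply: ge0_ler_powR; rewrite ?nnegrE ?xnorm2_ge0 ?addr_ge0//.
have [q1|q1] := leP (q z) 1; first by rewrite (le_trans q1)// support_radius_ge1.
apply: (@le_trans _ _ (expR 1 * expR kap^-1)); last by rewrite lerDr.
rewrite -ler_pdivrMl ?expR_gt0// -expRN mulrC (le_trans _ (ltW H))//.
rewrite -[leLHS]addr0 lerD ?ynorm2_ge0// ler_pM ?expR_ge0 ?xnorm2_ge0//.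
  by apply: le1r_powR; rewrite ?lerDl// ltW.
by rewrite ler_expR lerN2 ler_pdivrMr ?mul1r ?(lt_trans ltr01)// (le_trans d1)// ltW.
Qed.

(** Serves both sides of the inequality, with [profile] and [op_factor] as [G]: each vanishes off
    the band, which lies in a cube independent of [del]. *)
Lemma band_convergence (G : R -> space -> R) (p e C : R) : 0 < p ->
  (forall del, rv_measurable (G del)) ->
  (forall z, continuous (fun del => G del z)) ->
  (forall del z, M del z <= expR (- kap^-1) \/ expR kap^-1 <= M del z -> G del z = 0) ->
  (forall del z, 0 < del -> del <= 1 -> M del z < expR kap^-1 -> `|G del z| <= C) ->
  let w del z := `|G del z| `^ p * (q z `^ g * N z `^ e) in
  (forall j, integral_rV (w j.+1%:R^-1) = (rv_integral (w j.+1%:R^-1))%:E) /\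
  rv_integral (w j.+1%:R^-1) @[j --> \oo] --> rv_integral (w 0).
Proof.
move=> p0 mG cG G0 GC w.
pose lo := expR (- kap^-1); pose hi := B `^ (1 + g) + B.
have lo0 : 0 < lo := expR_gt0 _.
(* As [e] may be negative, [N] must also stay away from 0: on the band [lo < M <= N]. *)
pose W := `|C| `^ p * (B `^ g * (lo `^ e + hi `^ e)).
have W0 : 0 <= W by rewrite !mulr_ge0 ?addr_ge0 ?powR_ge0.
have w0 del z : 0 <= w del z by rewrite !mulr_ge0 ?powR_ge0.
have Gw del z : G del z = 0 -> w del z = 0.
  by move=> Gz; rewrite /w Gz normr0 powR0 ?mul0r// gt_eqF.
have mw del : rv_measurable (w del).
  apply: (@rv_measurableM R (n + k) (fun z => `|G del z| `^ p)).
    by apply: rv_measurable_powR; exact: rv_measurable_norm.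
  apply: (@rv_measurableM R (n + k) (fun z => q z `^ g)); apply: rv_measurable_powR.
    exact: rv_measurable_xnorm2.
  exact: rv_measurable_rho_pow.
have d0 j : 0 < j.+1%:R^-1 :> R by rewrite invr_gt0 ltr0n.
have d1 j : j.+1%:R^-1 <= 1 :> R by rewrite invf_le1 ?ltr0n// ler1n.
have wB j : vanishes_outside B (w j.+1%:R^-1).
  move=> z l Bz; apply: Gw; apply: G0; right; rewrite leNgt; apply/negP.
  by move=> /(band_coord_le l (d0 j) (d1 j)); rewrite leNgt Bz.
have wW j z : `|w j.+1%:R^-1 z| <= W.
  have [H|H] := leP (expR kap^-1) (M j.+1%:R^-1 z); first by rewrite Gw ?normr0// G0//; right.
  have [H'|H'] := leP (M j.+1%:R^-1 z) lo; first by rewrite Gw ?normr0// G0//; left.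
  have [qB rB NB] := band_norms_le (d0 j) (d1 j) H.
  rewrite ger0_norm//; apply: ler_pM; rewrite ?mulr_ge0 ?powR_ge0//.
    apply: ge0_ler_powR; rewrite ?nnegrE ?normr_ge0 ?(ltW p0)//.
    by rewrite (le_trans _ (ler_norm _))// GC.
  apply: ler_pM; rewrite ?powR_ge0//.
    by apply: ge0_ler_powR; rewrite ?nnegrE ?xnorm2_ge0// (le_trans (xnorm2_ge0 z)).
  apply: powR_le_ends => //; rewrite (le_trans (ltW H'))// rho_interpE//.
  exact: rho_approx_le.
have cw z : w j.+1%:R^-1 z @[j --> \oo] --> w 0 z.
  apply: (@continuous_cvg _ _ _ _ _ (fun j : nat => j.+1%:R^-1 : R) (fun del => w del z) 0).
    apply: (@continuous_at_mul _ _ (fun del => `|G del z| `^ p)); last exact: continuous_at_cst.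
    apply: (continuous_comp (f := fun del => G del z) (g := fun t => `|t| `^ p)); first exact: cG.
    by apply: norm_powR_continuous; exact: ltW.
  exact: cvg_harmonic.
split => [j|]; first exact: bounded_rv_integralE (mw _) (wB j) (wW j).
by have [] := bounded_convergence (fun j => mw _) wB wW cw.
Qed.

Lemma op_factor_eq0 del z :
  M del z <= expR (- kap^-1) \/ expR kap^-1 <= M del z -> op_factor del z = 0.
Proof. by move=> H; rewrite /op_factor profile1_eq0// profile2_eq0// !mul0r addr0. Qed.

Lemma op_factor_bounded : exists C, forall del z, 0 < del -> del <= 1 ->
  M del z < expR kap^-1 -> `|op_factor del z| <= C.
Proof.
have [A HA] := profile_bounded s k0.
have A0 : 0 <= A by have [H _ _] := HA 0; rewrite (le_trans _ H).
pose c1 := 2 + g; pose c2 := (1 + g) * g + 2 * g + 2.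
exists (A * (4 * c1 ^+ 2 * (B `^ g * B) + 4 * (1 + g) ^+ 2 * B) +
  A * (2 * n%:R * c1 + 4 * c2 + 2 * k%:R * (1 + g) ^+ 2)) => del z d0 d1 H.
have [qB rB _] := band_norms_le d0 d1 H.
have [_ H1 H2] := HA (M del z).
have s0 : 0 <= del / q z by rewrite divr_ge0 ?xnorm2_ge0// ltW.
have E1 := flat1_le g0 s0; have E2 := flat2_le g0 s0.
rewrite /op_factor; move: (flat1 _ _) (flat2 _ _) (F1 _) (F2 _) E1 E2 H1 H2.
move=> x1 x2 y1 y2 E1 E2 H1 H2.
have X1 : `|4 * x1 ^+ 2 * (q z `^ g * q z)| <= 4 * c1 ^+ 2 * (B `^ g * B).
  rewrite (normrM (4 * x1 ^+ 2)) (normrM 4) normrX (normrM (q z `^ g)).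
  rewrite (ger0_norm (ler0n R 4)) (ger0_norm (powR_ge0 _ _)) (ger0_norm (xnorm2_ge0 z)).
  have X2 : `|x1| ^+ 2 <= c1 ^+ 2 by rewrite ler_pXn2r// nnegrE// addr_ge0.
  have X3 : q z `^ g <= B `^ g.
    by apply: ge0_ler_powR; rewrite ?nnegrE ?xnorm2_ge0// (le_trans (xnorm2_ge0 z)).
  apply: ler_pM; rewrite ?mulr_ge0 ?sqr_ge0 ?powR_ge0 ?xnorm2_ge0//.
    exact: ler_wpM2l.
  by apply: ler_pM; rewrite ?powR_ge0 ?xnorm2_ge0.
have g4 : 0 <= 4 * (1 + g) ^+ 2 by rewrite mulr_ge0// sqr_ge0.
have X2 : `|4 * (1 + g) ^+ 2 * r z| <= 4 * (1 + g) ^+ 2 * B.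
  by rewrite (normrM (4 * _)) (ger0_norm g4) (ger0_norm (ynorm2_ge0 z)) ler_wpM2l.
have X3 : `|2 * n%:R * x1| <= 2 * n%:R * c1.
  by rewrite (normrM (2 * _)) ger0_norm ?mulr_ge0// ler_wpM2l// mulr_ge0.
have X4 : `|4 * x2| <= 4 * c2 by rewrite (normrM 4) ger0_norm// ler_wpM2l.
have X5 : `|2 * k%:R * (1 + g) ^+ 2| <= 2 * k%:R * (1 + g) ^+ 2.
  by rewrite ger0_norm// !mulr_ge0// addr_ge0.
rewrite (le_trans (ler_normD _ _))//; apply: lerD.
  rewrite normrM; apply: ler_pM => //.
  by rewrite (le_trans (ler_normD _ _))// lerD.
rewrite normrM; apply: ler_pM => //.
by rewrite (le_trans (ler_normD _ _))// lerD// (le_trans (ler_normD _ _))// lerD.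
Qed.

End TestFunctionLimit.

(** * The limit [kap -> 0] and the optimal constant *)

Section Optimality.
Context (R : realType) (n k : nat) (g p theta : R).
Hypotheses (n0 : (0 < n)%N) (g0 : 0 <= g) (p2 : 2 <= p).
Local Notation space := 'rV[R]_(n + k).
Implicit Types (z : space) (kap x : R).
Local Notation q := (@xnorm2 R n k).
Local Notation r := (@ynorm2 R n k).
Local Notation N := (@rho_pow R n k g).
Local Notation Q := (grushin_dim n k g).
Local Notation a := (p * (theta + 2) - 2).
Local Notation c := ((Q - p * (theta + 2)) / p).
Local Notation C0 := (c * (c * (p - 1) + a)).
Local Notation b := (@cutoff R 0 0).
Local Notation b1 := (@dcutoff R 0 0).
Local Notation b2 := (@ddcutoff R 0 0).
Local Notation rad := (@radial R n k g).
Local Notation s := (- c / (2 + 2 * g)).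
Local Notation nu := (- (p * theta) / (2 + 2 * g) + g * (p - 1) / (1 + g)).

Let p0 : 0 < p. Proof. exact: lt_le_trans p2. Qed.
Let pow0 : 0 `^ p = 0. Proof. by rewrite powR0// gt_eqF. Qed.
Let g1 : 0 < 1 + g. Proof. by rewrite ltr_pwDl. Qed.
Let g2 : 0 < 2 + 2 * g. Proof. by rewrite -[X in X + _]mulr1 -mulrDr mulr_gt0. Qed.

(* [L (F o rho_pow) = |x| ^ (2 g) * rho_pow ^ (s - 1) * log_operator kap (kap * ln rho_pow)]
   for [F t = t ^ s * cutoff 0 0 (kap * ln t)]. *)
Definition log_operator (kap x : R) : R := - C0 * b x +
  kap * (4 * (1 + g) ^+ 2 * (2 * s - 1) + 2 * (1 + g) * (Q + 2 * g)) * b1 x +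
  kap ^+ 2 * (4 * (1 + g) ^+ 2) * b2 x.

Lemma rho_interp0 z : rho_interp g 0 z = N z.
Proof. by rewrite /rho_interp mul0r oppr0 expR0 mulr1. Qed.

(** The powers of [N] combine to that of [radial] because [p c + a + 2 = Q]. *)
Lemma lhs_limitE kap z : 0 < kap ->
  `|profile kap s (rho_interp g 0 z)| `^ p *
    (q z `^ g * N z `^ (- (a + 2 + 2 * g) / (2 + 2 * g))) =
  rad (fun x => `|b (kap * x)| `^ p) z.
Proof.
move=> k0; rewrite rho_interp0.
have [->|z0] := eqVneq z 0.
  rewrite rho_pow0// /profile /logcut ltxx normr0 pow0 mul0r.
  rewrite /radial /mass_weight rho_pow0// [X in _ * (_ * X)]powR0 ?mulr0//.
  exact: mass_exponent_neq0.
have N0 := rho_pow_gt0 g0 z0.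
rewrite /profile /logcut N0 normrM (ger0_norm (powR_ge0 _ _)) powRM ?powR_ge0 ?normr_ge0//.
rewrite /radial /mass_weight -mulrA mulrCA; congr (_ * _).
rewrite mulrCA; congr (_ * _).
rewrite !(powR_expR _ N0) -expRM -expRD; congr expR.
by field; rewrite !gt_eqF.
Qed.

(** Again [p (s - 1) + nu = - (Q + 2 g) / (2 + 2 g)]: both sides of the inequality acquire the same
    invariant weight. *)
Lemma rhs_limitE kap z : 0 < kap ->
  `|op_factor g kap s 0 z| `^ p * (q z `^ g * N z `^ nu) =
  rad (fun x => `|log_operator kap (kap * x)| `^ p) z.
Proof.
move=> k0.
have [->|z0] := eqVneq z 0.
  rewrite op_factor_eq0//; last by left; rewrite rho_interp0 rho_pow0// expR_ge0.
  rewrite normr0 pow0 mul0r.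
  rewrite /radial /mass_weight rho_pow0// [X in _ * (_ * X)]powR0 ?mulr0//.
  exact: mass_exponent_neq0.
have N0 := rho_pow_gt0 g0 z0.
have -> : op_factor g kap s 0 z = N z `^ (s - 1) * log_operator kap (kap * ln (N z)).
  rewrite /op_factor rho_interp0 mul0r /flat1 /flat2 oppr0 expR0.
  rewrite /profile1 /profile2 /logcut N0 (powRB1 (s - 1) N0) /log_operator.
  have -> : q z `^ g * q z = N z - r z by rewrite -(xnorm2_powR1D g0 z); ring.
  rewrite /grushin_dim; field.
  by rewrite !gt_eqF.
rewrite normrM (ger0_norm (powR_ge0 _ _)) powRM ?powR_ge0 ?normr_ge0//.
rewrite /radial /mass_weight -mulrA mulrCA; congr (_ * _).
rewrite mulrCA; congr (_ * _).
rewrite !(powR_expR _ N0) -expRM -expRD; congr expR.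
by field; rewrite !gt_eqF.
Qed.

Lemma log_operator_continuous kap : continuous (log_operator kap).
Proof.
move=> x; apply: (@continuous_at_add _ _ (fun x => - C0 * b x +
  kap * (4 * (1 + g) ^+ 2 * (2 * s - 1) + 2 * (1 + g) * (Q + 2 * g)) * b1 x)).
  apply: (@continuous_at_add _ _ (fun x => - C0 * b x)).
    by apply: (@continuous_at_mulc _ _ b); exact: cutoff_continuous.
  by apply: (@continuous_at_mulc _ _ b1); exact: dcutoff_continuous.
by apply: (@continuous_at_mulc _ _ b2); exact: ddcutoff_continuous.
Qed.

Lemma log_operator_continuous_kap x : continuous (fun kap => log_operator kap x).
Proof.
move=> kap; apply: (@continuous_at_add _ _ (fun kap => - C0 * b x +
  kap * (4 * (1 + g) ^+ 2 * (2 * s - 1) + 2 * (1 + g) * (Q + 2 * g)) * b1 x)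
  (fun kap => kap ^+ 2 * (4 * (1 + g) ^+ 2) * b2 x)).
  apply: (@continuous_at_add _ _ (fun=> - C0 * b x)).
    exact: continuous_at_cst.
  by apply: cvgMl; apply: cvgMl; exact: cvg_id.
by apply: cvgMl; apply: cvgMl; apply: (@continuous_at_sqr _ _ id); exact: cvg_id.
Qed.

Lemma log_operator_eq0 kap x : 1 <= `|x| -> log_operator kap x = 0.
Proof.
by move=> x1; rewrite /log_operator cutoff_eq0// dcutoff_eq0// ddcutoff_eq0// !mulr0 !addr0.
Qed.

Lemma log_operator_bounded : exists B, forall kap x, 0 <= kap -> kap <= 1 ->
  `|log_operator kap x| <= B.
Proof.
have V (f : R -> R) : (forall x, 1 <= `|x| -> f x = 0) -> vanishes_beyond 1 f.
  by move=> f0 x /ltW; exact: f0.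
have [B0 H0] := vanishing_bounded (@cutoff_continuous R 0 0) (V _ (@cutoff_eq0 R 0 0)).
have [B1 H1] := vanishing_bounded (@dcutoff_continuous R 0 0) (V _ (@dcutoff_eq0 R 0 0)).
have [B2 H2] := vanishing_bounded (@ddcutoff_continuous R 0 0) (V _ (@ddcutoff_eq0 R 0 0)).
rewrite /log_operator; set w1 := _ + 2 * (1 + g) * _; set w2 := 4 * _.
exists (`|- C0| * B0 + `|w1| * B1 + `|w2| * B2) => kap x k0 k1.
rewrite (le_trans (ler_normD _ _))//; apply: lerD.
  rewrite (le_trans (ler_normD _ _))//; apply: lerD; first by rewrite normrM ler_wpM2l.
  rewrite (normrM (kap * w1)) (normrM kap) (ger0_norm k0).
  by apply: ler_pM; rewrite ?mulr_ge0// ler_piMl.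
rewrite (normrM (kap ^+ 2 * w2)) (normrM (kap ^+ 2)) (ger0_norm (sqr_ge0 kap)).
by apply: ler_pM; rewrite ?mulr_ge0 ?sqr_ge0// ler_piMl// exprn_ile1.
Qed.

Lemma rellich_lhs_profile kap del z : 0 < del -> q z != 0 ->
  rellich_lhs g p theta (fun z => profile kap s (rho_approx g del z)) z =
  `|profile kap s (rho_interp g del z)| `^ p *
    (q z `^ g * N z `^ (- (a + 2 + 2 * g) / (2 + 2 * g))).
Proof.
move=> d0 qz; rewrite (rellich_lhsE g0 p theta _ (xnorm2_neq0 qz)).
by rewrite (rho_interpE g0 z d0).
Qed.

(** The factor [|x| ^ (2 g p)] coming from [L] meets [|x| ^ (- 2 g (p - 1))] in the weight, and
    [q ^ g] remains; [nu] collects the powers of [N]. *)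
Lemma rellich_rhs_profile kap del z : 0 < kap -> 0 < del -> q z != 0 ->
  rellich_rhs g p theta (fun z => profile kap s (rho_approx g del z)) z =
  `|op_factor g kap s del z| `^ p * (q z `^ g * N z `^ nu).
Proof.
move=> k0 d0 qz; have z0 := xnorm2_neq0 qz; have q0 := xnorm2_gt0 qz.
have N0 := rho_pow_gt0 g0 z0.
rewrite (rellich_rhsE g0 p theta _ z0) (@grushin_op_approx R n k g kap s g0 k0 _ _ d0 qz).
rewrite normrM (ger0_norm (powR_ge0 _ _)); move: (op_factor _ _ _ _ _) => X.
rewrite powRM ?powR_ge0 ?normr_ge0//.
rewrite mulrAC mulrC; congr (_ * _).
rewrite /op_weight powRM ?powR_ge0// !(powR_expR _ q0) !(powR_expR _ N0).
rewrite -!expRM -!expRD; congr expR.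
by field; rewrite !gt_eqF.
Qed.

Variable K : R.
Hypothesis HK : forall u, test_function u ->
  (K%:E * integral_rV (rellich_lhs g p theta u) <=
     integral_rV (@rellich_rhs R n k g p theta u))%E.

(** The assumption on [K] is used for [del = 1 / (j + 1)]. Both integrals are finite there, so it
    becomes an inequality of reals that passes to the limit. *)
Lemma rellich_constant_radial kap : 0 < kap ->
  K * rv_integral (rad (fun x => `|b (kap * x)| `^ p)) <=
  rv_integral (rad (fun x => `|log_operator kap (kap * x)| `^ p)).
Proof.
move=> k0.
have cM := @rho_interp_continuous_del R n k g.
have mF del : rv_measurable (fun z => profile kap s (rho_interp g del z) : R).
  by apply: rv_measurable_continuous_comp; [exact: profile_continuous|exact: rv_measurable_rho_interp].
have cF (z : space) : continuous (fun del => profile kap s (rho_interp g del z)).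
  move=> del; apply: (continuous_comp (f := fun del => rho_interp g del z) (g := profile kap s)).
    exact: cM.
  exact: profile_continuous.
have F0 del (z : space) : rho_interp g del z <= expR (- kap^-1) \/ expR kap^-1 <= rho_interp g del z ->
    profile kap s (rho_interp g del z) = 0 by exact: profile_eq0.
have [A HA] := profile_bounded s k0.
have FA del (z : space) : 0 < del -> del <= 1 -> rho_interp g del z < expR kap^-1 ->
  `|profile kap s (rho_interp g del z)| <= A by have [] := HA (rho_interp g del z).
have [D HD] := @op_factor_bounded R n k g kap s g0 k0.
pose l del z := `|profile kap s (rho_interp g del z)| `^ p *
  (q z `^ g * N z `^ (- (a + 2 + 2 * g) / (2 + 2 * g))).
pose h del z := `|op_factor g kap s del z| `^ p * (q z `^ g * N z `^ nu).
have [El cl] : (forall j, integral_rV (l j.+1%:R^-1) = (rv_integral (l j.+1%:R^-1))%:E) /\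
    rv_integral (l j.+1%:R^-1) @[j --> \oo] --> rv_integral (l 0).
  exact: (@band_convergence R n k g kap g0 _ p _ A p0 mF cF F0 FA).
have [Er cr] : (forall j, integral_rV (h j.+1%:R^-1) = (rv_integral (h j.+1%:R^-1))%:E) /\
    rv_integral (h j.+1%:R^-1) @[j --> \oo] --> rv_integral (h 0).
  exact: (@band_convergence R n k g kap g0 _ p nu D p0
    (@rv_measurable_op_factor R n k g kap s k0) (@op_factor_continuous_del R n k g kap s k0)
    (@op_factor_eq0 R n k g kap s k0) HD).
have l0E : l 0 = rad (fun x => `|b (kap * x)| `^ p).
  by apply/funext => z; exact: lhs_limitE.
have h0E : h 0 = rad (fun x => `|log_operator kap (kap * x)| `^ p).
  by apply/funext => z; exact: rhs_limitE.
rewrite l0E in cl; rewrite h0E in cr.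
apply: (ler_cvg_to (cvgMr (a := K) cl) cr).
apply: nearW => j; set del : R := _^-1.
have d0 : 0 < del by rewrite invr_gt0 ltr0n.
have d1 : del <= 1 by rewrite invf_le1 ?ltr0n// ler1n.
have := HK (@test_function_approx R n k g g0 del kap s d0 d1 k0).
have -> : integral_rV (rellich_lhs g p theta (fun z : space => logcut kap s b (rho_approx g del z))) =
    integral_rV (l del).
  apply: eq_integral_rV_off_xaxis => // z.
  - exact: rellich_lhs_ge0.
  - by rewrite !mulr_ge0 ?powR_ge0.
  - by move=> qz; exact: rellich_lhs_profile.
have -> : integral_rV (rellich_rhs g p theta (fun z : space => logcut kap s b (rho_approx g del z))) =
    integral_rV (h del).
  apply: eq_integral_rV_off_xaxis => // z.
  - exact: rellich_rhs_ge0.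
  - by rewrite !mulr_ge0 ?powR_ge0.
  - by move=> qz; exact: rellich_rhs_profile.
by rewrite El Er -EFinM lee_fin.
Qed.

(** After multiplication by [kap] the scaling law removes [kap] from the arguments; it survives only
    in the coefficients of [log_operator], where it can tend to 0. *)
Lemma rellich_constant_log_operator kap : 0 < kap -> kap <= 1 ->
  K * rv_integral (rad (fun x => `|b x| `^ p)) <=
  rv_integral (rad (fun x => `|log_operator kap x| `^ p)).
Proof.
move=> k0 k1; have := ler_wpM2l (ltW k0) (rellich_constant_radial k0).
have cn (f : R -> R) : continuous f -> continuous (fun x => `|f x| `^ p).
  move=> cf x; apply: (continuous_comp (f := f) (g := fun t => `|t| `^ p)); first exact: cf.
  by apply: norm_powR_continuous; exact: ltW.
have vn (f : R -> R) : (forall x, 1 <= `|x| -> f x = 0) -> vanishes_beyond 1 (fun x => `|f x| `^ p).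
  by move=> f0 x /ltW/f0 ->; rewrite normr0.
have S (f : R -> R) : continuous f -> (forall x, 1 <= `|x| -> f x = 0) ->
    kap * rv_integral (rad (fun x => `|f (kap * x)| `^ p)) = rv_integral (rad (fun x => `|f x| `^ p)).
  by move=> cf f0; exact: (@radial_integral_scale R n k g n0 g0 _ 1 kap (cn _ cf) ler01 (vn _ f0)).
rewrite mulrCA (S b) ?(S (log_operator kap))//.
- exact: log_operator_continuous.
- exact: log_operator_eq0.
- exact: cutoff_continuous.
- exact: cutoff_eq0.
Qed.

Lemma radial_convergence (xi_ : nat -> R -> R) (xi : R -> R) (B : R) :
  (forall j, continuous (xi_ j)) -> (forall j, vanishes_beyond 1 (xi_ j)) ->
  (forall j x, `|xi_ j x| <= B) -> (forall x, xi_ j x @[j --> \oo] --> xi x) ->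
  rv_integral (rad (xi_ j)) @[j --> \oo] --> rv_integral (rad xi).
Proof.
move=> cxi vxi xiB lxi.
have B0 : 0 <= B by rewrite (le_trans _ (xiB 0%N 0)).
(* At least 1 on [[-1, 1]], so [B] times it dominates every [xi_ j]; being continuous, unlike an
   indicator, it falls under the lemmas on [radial]. *)
pose tent (x : R) : R := Num.max 0 (2 - `|x|).
have ct : continuous tent.
  move=> x; apply: (@continuous_max _ _ (fun=> 0) (fun x => 2 - `|x|)); first exact: cvg_cst.
  apply: (@continuous_at_add _ _ (fun=> 2) (fun x => - `|x|)); first exact: continuous_at_cst.
  by apply: cvgN; exact: norm_continuous.
have vt : vanishes_beyond 2 tent.
  by move=> x x2; rewrite /tent max_l// subr_le0 ltW.
have [[L vL] _] := @radial_supported R n k g n0 g0 _ _ vt.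
have [M bM] := continuous_vanishing_bounded (@radial_continuous R n k g n0 g0 _ _ ct vt) vL.
have dom j z : `|rad (xi_ j) z| <= B * rad tent z.
  rewrite /radial normrM (ger0_norm (mass_weight_ge0 _ _ _)) mulrA.
  apply: ler_wpM2r; first exact: mass_weight_ge0.
  move: (ln _) => x; have [x1|x1] := leP `|x| 1; last by rewrite vxi// normr0 mulr_ge0// le_max lexx.
  rewrite (le_trans (xiB j x))// ler_peMr// /tent le_max; apply/orP; right.
  by rewrite lerBrDr addrC -lerBrDr (le_trans x1)// lerBrDr.
have H1 j : rv_measurable (rad (xi_ j)).
  by apply: rv_measurable_continuous; exact: (@radial_continuous R n k g n0 g0 _ _ (cxi j) (vxi j)).
have H2 j : vanishes_outside L (rad (xi_ j)).
  move=> z l /vL tz; apply/eqP; rewrite -normr_le0 (le_trans (dom j z))//.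
  by rewrite tz mulr0.
have H3 j z : `|rad (xi_ j) z| <= B * M.
  rewrite (le_trans (dom j z))// ler_wpM2l//.
  by rewrite (le_trans (ler_norm _))// bM.
have H4 z : rad (xi_ j) z @[j --> \oo] --> rad xi z by apply: cvgMl; exact: lxi.
by have [] := bounded_convergence H1 H2 H3 H4.
Qed.

Lemma rellich_constant_optimal : 0 <= C0 -> K <= C0 `^ p.
Proof.
move=> C00.
have cn (f : R -> R) : continuous f -> continuous (fun x => `|f x| `^ p).
  move=> cf x; apply: (continuous_comp (f := f) (g := fun t => `|t| `^ p)); first exact: cf.
  by apply: norm_powR_continuous; exact: ltW.
have vn (f : R -> R) : (forall x, 1 <= `|x| -> f x = 0) -> vanishes_beyond 1 (fun x => `|f x| `^ p).
  by move=> f0 x /ltW/f0 ->; rewrite normr0.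
have cb := cn _ (@cutoff_continuous R 0 0); have vb := vn _ (@cutoff_eq0 R 0 0).
have J0 : 0 < rv_integral (rad (fun x => `|b x| `^ p)).
  apply: (@radial_integral_gt0 R n k g n0 g0 _ _ cb vb); first by move=> x; exact: powR_ge0.
  apply: powR_gt0; rewrite normr_gt0 gt_eqF// /cutoff addr0 subr0 /flatexp ltr01.
  by rewrite !mulr_gt0 ?powR_gt0 ?expR_gt0.
have k0 j : 0 < j.+1%:R^-1 :> R by rewrite invr_gt0 ltr0n.
have k1 j : j.+1%:R^-1 <= 1 :> R by rewrite invf_le1 ?ltr0n// ler1n.
have [B HB] := log_operator_bounded.
have B0 : 0 <= B by rewrite (le_trans _ (HB 0 0 _ _)).
have := @radial_convergence (fun j x => `|log_operator j.+1%:R^-1 x| `^ p)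
  (fun x => `|log_operator 0 x| `^ p) (B `^ p).
have H1 j : continuous (fun x => `|log_operator j.+1%:R^-1 x| `^ p).
  by apply: cn; exact: log_operator_continuous.
have H2 j : vanishes_beyond 1 (fun x => `|log_operator j.+1%:R^-1 x| `^ p).
  by apply: vn; exact: log_operator_eq0.
have H3 (j : nat) x : `| `|log_operator j.+1%:R^-1 x| `^ p| <= B `^ p.
  rewrite (ger0_norm (powR_ge0 _ _)); apply: ge0_ler_powR; rewrite ?nnegrE ?(ltW p0)//.
  by apply: HB => //; exact: ltW.
have H4 (x : R) : `|log_operator j.+1%:R^-1 x| `^ p @[j --> \oo] --> `|log_operator 0 x| `^ p.
  apply: (@continuous_cvg _ _ _ _ _ (fun j : nat => j.+1%:R^-1 : R)
    (fun kap => `|log_operator kap x| `^ p) 0); last exact: cvg_harmonic.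
  apply: (continuous_comp (f := fun kap => log_operator kap x) (g := fun t => `|t| `^ p)).
    exact: log_operator_continuous_kap.
  by apply: norm_powR_continuous; exact: ltW.
move=> /(_ H1 H2 H3 H4) cJ.
(* At [kap = 0] only [- C0 b] is left of [log_operator], and [C0 >= 0] removes the absolute value.
   Dividing by the positive [J (|b| ^ p)] then gives the bound on [K]. *)
have E0 : rv_integral (rad (fun x => `|log_operator 0 x| `^ p)) =
    C0 `^ p * rv_integral (rad (fun x => `|b x| `^ p)).
  have -> : rad (fun x => `|log_operator 0 x| `^ p) = fun z => C0 `^ p * rad (fun x => `|b x| `^ p) z.
    apply/funext => z; rewrite /radial mulrA; congr (_ * _).
    rewrite /log_operator expr0n/= !mul0r !addr0 mulNr normrN normrM (ger0_norm C00).
    by apply: powRM => //; exact: normr_ge0.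
  have [[L vL] _] := @radial_supported R n k g n0 g0 _ _ vb.
  rewrite /rv_integral (integral_rVZ _ (@radial_continuous R n k g n0 g0 _ _ cb vb) vL).
  by rewrite (@radial_integralE R n k g n0 g0 _ _ cb vb).
rewrite -(ler_pM2r J0) -E0.
apply: (ler_cvg_to (cvg_cst _) cJ); apply: nearW => j.
by apply: rellich_constant_log_operator.
Qed.

End Optimality.

Theorem corollary4p4 (R : realType) (n k : nat) (hn : (0 < n)%N)
    (g p theta : R) (hg : 0 <= g) (hp : 2 <= p)
    (hC : 0 <= (grushin_dim n k g - p * (theta + 2)) *
               (p * theta + grushin_dim n k g * (p - 1)))
    (hQ : k <> 0%N ->
          2 * g * (p - 1) + (1 + g) * k%:R < grushin_dim n k g) :
  let Q := grushin_dim n k g in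
  let C := ((Q - p * (theta + 2)) * (p * theta + Q * (p - 1)) / p ^+ 2) `^ p in
  let lhs (u : 'rV[R]_(n + k) -> R) := rellich_lhs g p theta u in
  let rhs (u : 'rV[R]_(n + k) -> R) := rellich_rhs g p theta u in
  [/\ forall u, test_function u ->
        (C%:E * integral_rV (lhs u) <= integral_rV (rhs u))%E,
      forall K : R,
        (forall u, test_function u ->
          (K%:E * integral_rV (lhs u) <= integral_rV (rhs u))%E) ->
        K <= C
    & forall c : R,
        let v := fun z => c * grushin_rho g z `^ ((p * (theta + 2) - Q) / p) in
        (forall z, lsubmx z != 0 -> C * lhs v z = rhs v z) /\
        (C%:E * integral_rV (lhs v) = integral_rV (rhs v))%E].
Proof.
move=> Q C lhs rhs.
have p0 : 0 < p by exact: lt_le_trans hp.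
(* Since [c (p - 1) + a = (p theta + Q (p - 1)) / p], the base of the stated constant is [C0], and
   [hC] says that it is nonnegative. *)
have E : (Q - p * (theta + 2)) * (p * theta + Q * (p - 1)) / p ^+ 2 =
    (Q - p * (theta + 2)) / p * ((Q - p * (theta + 2)) / p * (p - 1) + (p * (theta + 2) - 2)).
  by field; rewrite gt_eqF.
have C00 : 0 <= (Q - p * (theta + 2)) / p * ((Q - p * (theta + 2)) / p * (p - 1) + (p * (theta + 2) - 2)).
  by rewrite -E divr_ge0// sqr_ge0.
rewrite /C E; split.
- by move=> u tu; exact: rellich_inequality.
- by move=> K HK; exact: (rellich_constant_optimal hn hg hp HK).
- move=> c; split; last exact: extremal_integral.
  by move=> z lz; apply: extremal_pointwise => //; rewrite xnorm2_eq0.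
Qed.
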